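(* Let $f=(f_1,f_2,f_3)\colon\mathbb{R}^3\to\mathbb{R}^3$ be a $C^2$ semi-algebraic local diffeomorphism such that $\operatorname{codim}(S_f)\geq 2$, where $S_f\subset\mathbb{R}^3$ is the set of points at which $f$ is not proper. Suppose that for each $i\in\{1,2,3\}$ the function $g=f_i\colon\mathbb{R}^3\to\mathbb{R}$ satisfies at least one of the following conditions (which one may depend on $i$): (a) $g$ is a locally trivial fibration at the image; (b) $K_\infty(g)=\varnothing$; (c) $g$ satisfies the Palais--Smale condition; (d) $\displaystyle\int_0^\infty \inf_{\|x\|=r}\|\nabla g(x)\|\,dr=\infty$. Then $f$ is bijective.
   Context: Non-proper points: a continuous map $f\colon X\to Y$ between locally compact spaces is proper at $y\in Y$ if there is a neighborhood $U$ of $y$ such that $f^{-1}(\overline{U})$ is compact; $S_f$ denotes the set of points of $Y$ where $f$ is not proper. For semi-algebraic $f$ the set $S_f$ is semi-algebraic, so its dimension and codimension in $\mathbb{R}^3$ make sense ($S_f=\varnothing$ is allowed and counts as satisfying the codimension hypothesis). Locally trivial fibrations: a continuous map $g\colon X\to Y$ of topological spaces is a trivial fibration if there are a topological space $\mathcal{F}$ and a homeomorphism $\varphi\colon\mathcal{F}\times Y\to X$ such that $g\circ\varphi$ is the projection onto $Y$. It is a locally trivial fibration at $y\in Y$ if there is an open neighborhood $U$ of $y$ in $Y$ such that $g|_{g^{-1}(U)}\colon g^{-1}(U)\to U$ is a trivial fibration. It is a locally trivial fibration if this holds at every $y\in Y$. It is a locally trivial fibration at the image if $g\colon X\to g(X)$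 is a locally trivial fibration. Notation: for a sequence, $u_l\to\infty$ means that $\{u_l\}$ has no convergent subsequence. Asymptotic critical values: for a $C^2$ function $g\colon\mathbb{R}^3\to\mathbb{R}$, $K_\infty(g)$ is the set of $y\in\mathbb{R}$ for which there is a sequence $\{u_l\}\subset\mathbb{R}^3$ with $u_l\to\infty$, $g(u_l)\to y$ and $\|u_l\|\,\|\nabla g(u_l)\|\to 0$. Palais--Smale condition: a $C^1$ function $g\colon\mathbb{R}^3\to\mathbb{R}$ satisfies it if every sequence $\{u_l\}$ in $\mathbb{R}^3$ such that $\{g(u_l)\}$ is bounded and $\nabla g(u_l)\to 0$ has a convergent subsequence. $\|\cdot\|$ is the Euclidean norm. *)

(* Defs.v *)
(* mpoly is only Required: importing it clashes with the notations of analysis. *)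
From HB Require Import structures.
From mathcomp Require Import all_boot all_order all_algebra.
From mathcomp Require Import all_classical all_reals all_analysis.
From mathcomp Require mpoly.
Set Implicit Arguments.
Unset Strict Implicit.
Unset Printing Implicit Defensive.
Import Order.TTheory GRing.Theory Num.Theory.
Import numFieldNormedType.Exports.
Local Open Scope classical_set_scope.
Local Open Scope ring_scope.

(* The library's norm `|x| on 'rV[R]_n is the sup norm. *)
Definition enorm (R : realType) (n : nat) (x : 'rV[R]_n) : R :=
  Num.sqrt (\sum_(i < n) x 0 i ^+ 2).

Definition partial_derive (R : realType) (n : nat) (V : normedModType R)
    (j : 'I_n) (f : 'rV[R]_n -> V) (x : 'rV[R]_n) : V :=
  'D_(delta_mx 0 j) f x.

Definition gradient (R : realType) (n : nat) (g : 'rV[R]_n -> R)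
    (x : 'rV[R]_n) : 'rV[R]_n :=
  \row_(j < n) partial_derive j g x.

Definition component (R : realType) (n m : nat) (f : 'rV[R]_n -> 'rV[R]_m)
    (i : 'I_m) (x : 'rV[R]_n) : R :=
  f x 0 i.

(* Meant for open U: derivatives at points of U are taken in 'rV[R]_n. *)
Fixpoint Ck_on (R : realType) (n : nat) (V : normedModType R) (k : nat)
    (U : set 'rV[R]_n) (f : 'rV[R]_n -> V) : Prop :=
  if k is k'.+1 then
    (forall x, U x -> differentiable f x) /\
    (forall j : 'I_n, Ck_on k' U (partial_derive j f))
  else forall x, U x -> {for x, continuous f}.

Definition Ck_diffeomorphism_on (R : realType) (n k : nat)
    (U : set 'rV[R]_n) (f : 'rV[R]_n -> 'rV[R]_n) : Prop :=
  [/\ open U, open (f @` U), Ck_on k U f &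
      exists g : 'rV[R]_n -> 'rV[R]_n,
        Ck_on k (f @` U) g /\ {in U, cancel f g}].

Definition Ck_local_diffeomorphism (R : realType) (n k : nat)
    (f : 'rV[R]_n -> 'rV[R]_n) : Prop :=
  forall x, exists U : set 'rV[R]_n, U x /\ Ck_diffeomorphism_on k U f.

Definition proper_at (X Y : topologicalType) (f : X -> Y) (y : Y) : Prop :=
  exists U : set Y, nbhs y U /\ compact (f @^-1` (closure U)).

Definition nonproper_set (X Y : topologicalType) (f : X -> Y) : set Y :=
  [set y | ~ proper_at f y].

Definition mpoly_eval (R : realType) (n : nat) (p : mpoly.mpoly n R)
    (x : 'rV[R]_n) : R :=
  mpoly.meval (fun i => x 0 i) p.

(* A finite union of sets {x | p x = 0 for p in s.1, q x > 0 for q in s.2}. *)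
Definition semialgebraic (R : realType) (n : nat) (A : set 'rV[R]_n) : Prop :=
  exists F : seq (seq (mpoly.mpoly n R) * seq (mpoly.mpoly n R)),
    A = [set x | has (fun s =>
           all (fun p => mpoly_eval p x == 0) s.1 &&
           all (fun q => 0 < mpoly_eval q x) s.2) F].

Definition semialgebraic_map_on (R : realType) (n m : nat) (D : set 'rV[R]_n)
    (f : 'rV[R]_n -> 'rV[R]_m) : Prop :=
  semialgebraic D /\ semialgebraic [set row_mx x (f x) | x in D].

Definition open_cube (R : realType) (d : nat) : set 'rV[R]_d :=
  [set t | forall i, 0 < t 0 i < 1].

(* A contains a subset semi-algebraically homeomorphic to ]0, 1[^d. *)
Definition contains_cell (R : realType) (n : nat) (A : set 'rV[R]_n)
    (d : nat) : Prop :=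
  exists (phi : 'rV[R]_d -> 'rV[R]_n) (psi : 'rV[R]_n -> 'rV[R]_d),
    [/\ semialgebraic_map_on (@open_cube R d) phi,
        phi @` @open_cube R d `<=` A,
        {in @open_cube R d, cancel phi psi},
        {within @open_cube R d, continuous phi} &
        {within phi @` @open_cube R d, continuous psi}].

(* Dimension of a semi-algebraic set: the largest dimension of the cells it
   contains, which is also the largest dimension occurring in any partition of
   the set into cells. The supremum is in \bar R, so that the empty set has
   dimension -oo, hence codimension +oo. *)
Definition semialgebraic_dim (R : realType) (n : nat) (A : set 'rV[R]_n) :
    \bar R :=
  ereal_sup [set d%:R%:E | d in [set d : nat | contains_cell A d]].

Definition semialgebraic_codim (R : realType) (n : nat) (A : set 'rV[R]_n) :
    \bar R :=
  (n%:R%:E - semialgebraic_dim A)%E.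

(* [set_type A], into which a set coerces, carries the subspace topology. *)
Definition trivial_fibration (X Y : topologicalType) (g : X -> Y) : Prop :=
  exists (F : topologicalType) (phi : F * Y -> X) (psi : X -> F * Y),
    [/\ continuous phi, continuous psi, cancel phi psi, cancel psi phi &
        forall z, g (phi z) = z.2].

Definition restrict_preimage (X Y : Type) (g : X -> Y) (U : set Y)
    (x : set_type (g @^-1` U)) : set_type U :=
  exist _ (g (val x)) (mem_set (set_mem (valP x) : U (g (val x)))).

Definition locally_trivial_at (X Y : topologicalType) (g : X -> Y) (y : Y) :
    Prop :=
  exists U : set Y, [/\ open U, U y &
    trivial_fibration (@restrict_preimage X Y g U)].

Definition locally_trivial_fibration (X Y : topologicalType) (g : X -> Y) :
    Prop :=
  continuous g /\ forall y, locally_trivial_at g y.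

Definition corestrict_range (X Y : Type) (g : X -> Y) (x : X) :
    set_type (range g) :=
  exist _ (g x) (mem_set (imageT g x)).

Definition locally_trivial_at_image (X Y : topologicalType) (g : X -> Y) :
    Prop :=
  locally_trivial_fibration (corestrict_range g).

Definition has_cvg_subseq (X : topologicalType) (u : nat -> X) : Prop :=
  exists s : nat -> nat, increasing_seq s /\
    exists x : X, u (s l) @[l --> \oo] --> x.

Definition K_infty (R : realType) (n : nat) (g : 'rV[R]_n -> R) : set R :=
  [set y | exists u : nat -> 'rV[R]_n,
    [/\ ~ has_cvg_subseq u,
        g (u l) @[l --> \oo] --> y &
        enorm (u l) * enorm (gradient g (u l)) @[l --> \oo] --> (0 : R)]].

Definition palais_smale (R : realType) (n : nat) (g : 'rV[R]_n -> R) : Prop :=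
  forall u : nat -> 'rV[R]_n,
    bounded_fun (fun l => g (u l)) ->
    gradient g (u l) @[l --> \oo] --> (0 : 'rV[R]_n) ->
    has_cvg_subseq u.

Definition gradient_integral_infinite (R : realType) (n : nat)
    (g : 'rV[R]_n -> R) : Prop :=
  (\int[@lebesgue_measure R]_(r in `[0%R, +oo[)
     (inf [set enorm (gradient g x) | x in [set x | enorm x = r]])%:E)%E
  = +oo%E.

(* Main.v *)
Require Import Defs.
From HB Require Import structures.
From mathcomp Require Import all_boot all_order all_algebra.
From mathcomp Require Import all_classical all_reals all_analysis.
From mathcomp Require Import measurable_realfun.
From mathcomp Require mpoly.
From mathcomp Require Import lra ring zify.
From mathcomp.real_closed Require ordered_qelim qe_rcf.
Set Implicit Arguments.
Unset Strict Implicit.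
Unset Printing Implicit Defensive.
Import Order.TTheory GRing.Theory Num.Theory.
Import numFieldNormedType.Exports.
Local Open Scope classical_set_scope.
Local Open Scope ring_scope.

(** Let [S] be the set of points at which [f] is not proper. A proper local
homeomorphism of [R^3] is bijective, because its inverse can be continued along
segments ([proper_local_homeo_bijective]); hence it suffices that [S] be empty.

Size of [S]. Being nonproper is a first-order condition on the graph of [f], so
that [S] is a closed semialgebraic set by quantifier elimination. Having
codimension at least two, it contains no two-dimensional cell, and therefore all
but countably many of the planes [y_i = c] meet it in a countable set
([countable_thick_slices]). On the other hand, a nonempty bounded slice of the
open set [f(R^3)] has an uncountable frontier, which consists of points of [S]
([bounded_slice]).

Use of the four conditions. Each of them implies that [g = f_i] and [- g] have
regular levels: far away points can be moved up to a given level without coming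
back near the origin, and two points of a superlevel can be joined inside any
larger superlevel ([component_regular]). For a fibration this follows from
transport between neighbouring levels. In the other cases there is, over every
bounded range of levels, a function that tends to infinity and whose slope is at
most the norm of the gradient of [g]: a multiple of the logarithm of the distance
to the origin, or a primitive of the minimum of that norm over spheres. Moving
along the gradient from one level to another then changes this function by a
bounded amount. Since [g] is only differentiable with a continuous gradient, the
flow is replaced by maxima of a penalised height and by finitely many small
gradient steps.

The contradiction ([nonproper_coord_exceptional]). Let [p] be a point of [S]
whose coordinate [c = p_i] is an interior value of [g] with [S] countable in the
plane [y_i = c]. Some sphere around [p], of radius [r], avoids [S] in that plane,
so that its preimage near level [c] is bounded: for [c'] near [c], the functions
[u = r - |f - p|] and [w = g - c'] have no common zero outside some cube. The
complement of a cube is simply connected, so that the pair [(u, w)] pulls the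
double cover of the punctured plane back to a trivial one. As [p] is nonproper,
there is a far away point [a] with [w a = 0] and [u a > 0]; as bounded slices are
excluded, there is a far away point [b] with [w b = 0] and [u b < 0]. Since the
levels of [g] and [- g] are regular, [a] and [b] can be joined outside the cube
both in [w >= 0] and in [w <= 0]. These two connections make a loop on which
[(u, w)] turns once around the origin, and along which the double cover is not
trivial ([branch_obstruction]).

Hence each coordinate of a point of [S] belongs to a countable set of exceptional
values. If [p] is in [S], some sphere around [p] then avoids [S] altogether and has
bounded preimage; the complement of a cube, which is connected, is mapped inside
the sphere. So [f] is bounded, and [bounded_slice] gives a contradiction. *)

(** * Row vectors, compactness, countability *)

HB.instance Definition _ (R : realType) m n := Complete.on 'M[R]_(m, n).

Lemma row_norm_coord (R : realType) n (x : 'rV[R]_n) i : `|x 0 i| <= `|x|.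
Proof.
rewrite [leRHS]/Num.Def.normr /= mx_normrE.
by apply: (@le_bigmax _ _ _ 0 (fun ij => `|x ij.1 ij.2|) (0, i)).
Qed.

Lemma row_norm_le (R : realType) n (x : 'rV[R]_n) (r : R) : 0 <= r ->
  (forall i, `|x 0 i| <= r) -> `|x| <= r.
Proof.
move=> r0 xr; rewrite [leLHS]/Num.Def.normr/= mx_normrE (bigmax_le _ r0) //.
by move=> -[i j] _ /=; rewrite (ord1 i).
Qed.

Lemma row_norm_lt (R : realType) n (x : 'rV[R]_n) (r : R) : 0 < r ->
  (forall i, `|x 0 i| < r) -> `|x| < r.
Proof.
move=> r0 xr; rewrite [ltLHS]/Num.Def.normr/= mx_normrE.
by apply: bigmax_lt => // -[i j] _ /=; rewrite (ord1 i).
Qed.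

Lemma cvg_row (R : realType) (T : Type) (F : set_system T) {FF : Filter F} n
    (h : T -> 'rV[R]_n) (l : 'rV[R]_n) :
  (forall k, h t 0 k @[t --> F] --> l 0 k) -> h t @[t --> F] --> l.
Proof.
move=> hl; apply/cvgrPdist_lt => e e0.
have : \forall t \near F, forall k, `|l 0 k - h t 0 k| < e.
  by apply: filter_forall => k; move/cvgrPdist_lt: (hl k); apply.
apply: filterS => t ht; apply: row_norm_lt => // k.
by rewrite !mxE.
Qed.

Lemma continuous_row (R : realType) (T : topologicalType) n
    (h : T -> 'rV[R]_n) x :
  (forall k, h t 0 k @[t --> x] --> h x 0 k) -> {for x, continuous h}.
Proof. by move=> hx; apply: (@cvg_row _ _ (nbhs x)) => k; exact: hx. Qed.

Lemma continuous_dist (R : realType) (T : topologicalType)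
    (V : normedModType R) (h : T -> V) x :
  {for x, continuous h} <->
  (forall e : R, 0 < e -> \forall t \near x, `|h x - h t| < e).
Proof. by split=> [hx e e0|hx]; [exact: (@cvgrPdist_lt _ _ _ (nbhs x) _ _ _).1|exact/cvgrPdist_lt]. Qed.

Lemma near_dist (R : realType) (V : normedModType R) (x : V) (e : R) :
  0 < e -> \forall y \near x, `|x - y| < e.
Proof. by move=> e0; apply: (continuous_dist id x).1 => //; exact: cvg_id. Qed.

Lemma affine_coord_continuous (R : realType) n (c r d : R) (m : 'I_n) :
  continuous (fun y : 'rV[R]_n => c + r * (y 0 m - d)).
Proof.
move=> y; apply: (@continuous_comp _ _ _ (fun y : 'rV[R]_n => y 0 m)
  (fun u => c + r * (u - d))); first exact: coord_continuous.
apply: cvgD; first exact: cvg_cst.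
apply: cvgM; first exact: cvg_cst.
by apply: cvgB; [exact: cvg_id|exact: cvg_cst].
Qed.

Lemma near_norm_lt (R : realType) (V : normedModType R) (P : V -> Prop) p :
  (\forall z \near p, P z) ->
  exists2 eta : R, 0 < eta & forall z, `|z - p| < eta -> P z.
Proof.
move=> /(@nbhs_ballP R) [e /= e0 H]; exists e => // z ze; apply: H.
by rewrite -ball_normE /= distrC.
Qed.

Section Compactness.
Context {R : realType}.

Lemma compact_rV n (A : set 'rV[R]_n) (M : R) :
  closed A -> (forall x, A x -> `|x| <= M) -> compact A.
Proof.
move=> cA AM; apply: bounded_closed_compact => //.
by exists M; split; [exact: num_real|move=> N MN x Ax; exact: le_trans (AM x Ax) (ltW MN)].
Qed.

Lemma compact_norm_le (V : normedModType R) (A : set V) : compact A ->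
  exists2 M : R, 0 < M & forall x, A x -> `|x| <= M.
Proof.
move=> /compact_bounded[M [_ HM]]; exists (`|M| + 1); first by rewrite ltr_wpDl.
by move=> x Ax; apply: (HM (`|M| + 1)) => //; rewrite (le_lt_trans (ler_norm M)) // ltrDl.
Qed.

Lemma compact_cube k (r : R) : compact [set x : 'rV[R]_k | `|x| <= r].
Proof.
apply: (@compact_rV _ _ r) => //.
rewrite (_ : [set x : 'rV[R]_k | `|x| <= r] = Num.norm @^-1` [set t | t <= r]) //.
by apply: preimage_closed; [move=> y _; exact: norm_continuous|exact: closed_le].
Qed.

End Compactness.

Section ClosedLevels.
Context {R : realType} {T : topologicalType} (h : T -> R).
Hypothesis ch : continuous h.

Lemma closed_sublevel c : closed [set y | h y <= c].
Proof.
have -> : [set y | h y <= c] = h @^-1` [set t | t <= c] by [].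
by apply: preimage_closed; [move=> y _; exact: ch|exact: closed_le].
Qed.

Lemma closed_superlevel c : closed [set y | c <= h y].
Proof.
have -> : [set y | c <= h y] = h @^-1` [set t | c <= t] by [].
by apply: preimage_closed; [move=> y _; exact: ch|exact: closed_ge].
Qed.

Lemma continuous_dist_to c : continuous (fun y => `|h y - c|).
Proof. by move=> y; apply: cvg_norm; apply: cvgB; [exact: ch|exact: cvg_cst]. Qed.

Lemma continuous_sub_cst c : continuous (fun y => h y - c).
Proof. by move=> y; apply: cvgB; [exact: ch|exact: cvg_cst]. Qed.

Lemma continuous_cst_sub c : continuous (fun y => c - h y).
Proof. by move=> y; apply: cvgB; [exact: cvg_cst|exact: ch]. Qed.

Lemma continuous_displacement (V : normedModType R) (f v : T -> V) a :
  continuous f -> continuous v -> continuous (fun y => f y + (a * h y) *: v y).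
Proof.
move=> cf cv y; apply: cvgD; first exact: cf.
apply: cvgZ; last exact: cv.
by apply: cvgM; [exact: cvg_cst|exact: ch].
Qed.

Lemma continuous_sub_scale (k : T -> R) a :
  continuous k -> continuous (fun y => h y - a * k y).
Proof.
move=> ck y; apply: cvgB; first exact: ch.
by apply: cvgM; [exact: cvg_cst|exact: ck].
Qed.
End ClosedLevels.

Lemma countable_image (T U : Type) (g : T -> U) (A : set T) :
  countable A -> countable (g @` A).
Proof. by move=> cA; apply: sub_countable cA; exact: card_image_le. Qed.

Lemma countableU (T : Type) (A B : set T) :
  countable A -> countable B -> countable (A `|` B).
Proof.
move=> cA cB; rewrite (_ : A `|` B = \bigcup_(b in [set: bool]) if b then A else B).
  by apply: bigcup_countable => [|[] _]; first exact: countableP.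
apply/seteqP; split=> [x [Ax|Bx]|x [[] _ ?]]; [by exists true|by exists false|by left|by right].
Qed.

Lemma uncountable_itv (R : realType) (a b : R) : a < b -> ~ countable `]a, b[.
Proof.
move=> ab /countable_lebesgue_measure0; rewrite lebesgue_measure_itv /= lte_fin ab.
by rewrite -EFinB => -[] /eqP; rewrite subr_eq0 gt_eqF.
Qed.

Section SemialgebraicSets.
Import ordered_qelim.
Import -(notations) mpoly.

(** * First-order definable relations *)

Section Definable.
Context {R : realType}.
Implicit Types (e : nat -> R) (P Q : (nat -> R) -> Prop).

Definition definable (P : (nat -> R) -> Prop) : Prop :=
  exists F : ord.formula R, forall e : seq R, ord.holds e F <-> P (nth 0 e).

Lemma eq_definable P Q : (forall e, P e <-> Q e) -> definable P -> definable Q.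
Proof. by move=> PQ [F FP]; exists F => e; rewrite FP. Qed.

Lemma definable_and P Q :
  definable P -> definable Q -> definable (fun e => P e /\ Q e).
Proof. by move=> [F FP] [G GQ]; exists (ord.And F G) => e /=; rewrite FP GQ. Qed.

Lemma definable_or P Q :
  definable P -> definable Q -> definable (fun e => P e \/ Q e).
Proof. by move=> [F FP] [G GQ]; exists (ord.Or F G) => e /=; rewrite FP GQ. Qed.

Lemma definable_imp P Q :
  definable P -> definable Q -> definable (fun e => P e -> Q e).
Proof.
by move=> [F FP] [G GQ]; exists (ord.Implies F G) => e /=; rewrite FP GQ.
Qed.

Lemma nth_set_env (e : seq R) i x :
  nth 0 (set_nth 0 e i x) = [eta nth 0 e with i |-> x].
Proof. by apply/funext => k; rewrite nth_set_nth. Qed.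

Lemma definable_ex i P :
  definable P -> definable (fun e => exists x, P [eta e with i |-> x]).
Proof.
move=> [F FP]; exists (ord.Exists i F) => e /=.
by split=> -[x]; [rewrite FP | rewrite -nth_set_env -FP] => Px; exists x => //;
  rewrite -nth_set_env.
Qed.

Lemma definable_all i P :
  definable P -> definable (fun e => forall x, P [eta e with i |-> x]).
Proof.
move=> [F FP]; exists (ord.Forall i F) => e /=.
split=> H x; first by rewrite -nth_set_env; apply/FP.
by apply/FP; rewrite nth_set_env.
Qed.

Definition term_fun (h : (nat -> R) -> R) : Prop :=
  exists t : GRing.term R, forall e : seq R, GRing.eval e t = h (nth 0 e).

Lemma term_fun_cst c : term_fun (fun=> c).
Proof. by exists (GRing.Const c). Qed.

Lemma term_fun_var i : term_fun (fun e => e i).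
Proof. by exists (GRing.Var _ i). Qed.

Lemma term_funD h k :
  term_fun h -> term_fun k -> term_fun (fun e => h e + k e).
Proof. by move=> [t ht] [s hs]; exists (GRing.Add t s) => e /=; rewrite ht hs. Qed.

Lemma term_funN h : term_fun h -> term_fun (fun e => - h e).
Proof. by move=> [t ht]; exists (GRing.Opp t) => e /=; rewrite ht. Qed.

Lemma term_funM h k :
  term_fun h -> term_fun k -> term_fun (fun e => h e * k e).
Proof. by move=> [t ht] [s hs]; exists (GRing.Mul t s) => e /=; rewrite ht hs. Qed.

Lemma term_funX h n : term_fun h -> term_fun (fun e => h e ^+ n).
Proof. by move=> [t ht]; exists (GRing.Exp t n) => e /=; rewrite ht. Qed.

Lemma eq_term_fun h k : h =1 k -> term_fun h -> term_fun k.
Proof. by move=> hk [t ht]; exists t => e; rewrite ht hk. Qed.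

Lemma term_fun_sum (I : Type) (r : seq I) (h : I -> (nat -> R) -> R) :
  (forall i, term_fun (h i)) -> term_fun (fun e => \sum_(i <- r) h i e).
Proof.
move=> hh; elim: r => [|i r IH].
  by apply: eq_term_fun (term_fun_cst 0) => e; rewrite big_nil.
by apply: eq_term_fun (term_funD (hh i) IH) => e; rewrite big_cons.
Qed.

Lemma term_fun_prod (I : Type) (r : seq I) (h : I -> (nat -> R) -> R) :
  (forall i, term_fun (h i)) -> term_fun (fun e => \prod_(i <- r) h i e).
Proof.
move=> hh; elim: r => [|i r IH].
  by apply: eq_term_fun (term_fun_cst 1) => e; rewrite big_nil.
by apply: eq_term_fun (term_funM (hh i) IH) => e; rewrite big_cons.
Qed.

Lemma definable_lt h k :
  term_fun h -> term_fun k -> definable (fun e => h e < k e).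
Proof.
by move=> [t ht] [s hs]; exists (ord.Lt t s) => e /=; rewrite ht hs.
Qed.

Lemma definable_le h k :
  term_fun h -> term_fun k -> definable (fun e => h e <= k e).
Proof.
by move=> [t ht] [s hs]; exists (ord.Le t s) => e /=; rewrite ht hs.
Qed.

Lemma definable_eq h k :
  term_fun h -> term_fun k -> definable (fun e => h e = k e).
Proof.
by move=> [t ht] [s hs]; exists (ord.Equal t s) => e /=; rewrite ht hs.
Qed.

Lemma definable_const (b : bool) : definable (fun=> b).
Proof. by exists (ord.Bool b). Qed.

Lemma term_fun_mpoly n (p : mpoly.mpoly n R) (s : 'I_n -> nat) :
  term_fun (fun e => mpoly_eval p (\row_i e (s i))).
Proof.
have hm : term_fun (fun e => \sum_(m <- mpoly.msupp p)
    mpoly.mcoeff m p * \prod_(i <- index_enum 'I_n) e (s i) ^+ mpoly.fun_of_multinom m i).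
  apply: term_fun_sum => m; apply: term_funM; first exact: term_fun_cst.
  by apply: term_fun_prod => i; apply: term_funX; exact: term_fun_var.
apply: eq_term_fun hm => e; rewrite /mpoly_eval mpoly.mevalE.
by apply: eq_bigr => m _; congr (_ * _); apply: eq_bigr => i _; rewrite mxE.
Qed.

Lemma definable_semialgebraic n (A : set 'rV[R]_n) (s : 'I_n -> nat) :
  semialgebraic A -> definable (fun e => A (\row_i e (s i))).
Proof.
move=> [F ->]; elim: F => [|[eqs lts] F IH] /=.
  exact: definable_const false.
have Deq : definable (fun e =>
    all (fun p => mpoly_eval p (\row_i e (s i)) == 0) eqs).
  elim: eqs => [|p eqs IH'] /=; first exact: definable_const true.
  have D := definable_and (definable_eq (term_fun_mpoly p s) (term_fun_cst 0)) IH'.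
  by apply: eq_definable D => e; split=> [[/eqP -> ->] //|/andP[/eqP ? ?]].
have Dlt : definable (fun e =>
    all (fun p => 0 < mpoly_eval p (\row_i e (s i))) lts).
  elim: lts => [|p lts IH'] /=; first exact: definable_const true.
  have D := definable_and (definable_lt (term_fun_cst 0) (term_fun_mpoly p s)) IH'.
  by apply: eq_definable D => e; split=> [[-> ->] //|/andP[]].
have D := definable_or (definable_and Deq Dlt) IH.
apply: eq_definable D => e; split=> [[[-> ->]//|->]|/orP[/andP[? ?]|?]].
- by rewrite orbT.
- by left.
- by right.
Qed.

(** The valuation of the variables of a formula by the coordinates of a vector. *)
Definition row_env n (x : 'rV[R]_n) (k : nat) : R :=
  if insub k is Some i then x 0 i else 0.

Lemma row_envE n (x : 'rV[R]_n) : row_env x = nth 0 [seq x 0 i | i <- enum 'I_n].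
Proof.
apply/funext => k; rewrite /row_env; case: insubP => [i ltkn <-|].
  by rewrite (nth_map i) ?size_enum_ord //= (nth_ord_enum i i).
by rewrite -leqNgt => le; rewrite nth_default // size_map size_enum_ord.
Qed.

Lemma term_mpoly n (t : GRing.term R) : GRing.rterm t ->
  exists p : mpoly.mpoly n R, forall x : 'rV[R]_n,
    GRing.eval [seq x 0 i | i <- enum 'I_n] t = mpoly_eval p x.
Proof.
rewrite /mpoly_eval; elim: t => //=.
- move=> k _; have [ltkn|lenk] := ltnP k n.
    exists (mpoly.mpolyX R (mpoly.mnm1 (Ordinal ltkn))) => x.
    rewrite -row_envE /row_env insubT mpoly.mevalXU //.
  exists 0 => x; rewrite mpoly.meval0 nth_default //.
  by rewrite size_map size_enum_ord.
- by move=> c _; exists (mpoly.mpolyC n c) => x; rewrite mpoly.mevalC.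
- by move=> k _; exists (mpoly.mpolyC n k%:R) => x; rewrite mpoly.mevalC.
- move=> t1 IH1 t2 IH2 /andP[/IH1[p1 H1] /IH2[p2 H2]].
  by exists (p1 + p2) => x; rewrite mpoly.mevalD H1 H2.
- by move=> t IH /IH[p H]; exists (- p) => x; rewrite mpoly.mevalN H.
- by move=> t IH k /IH[p H]; exists (p *+ k) => x; rewrite mpoly.mevalMn H.
- move=> t1 IH1 t2 IH2 /andP[/IH1[p1 H1] /IH2[p2 H2]].
  by exists (p1 * p2) => x; rewrite mpoly.mevalM H1 H2.
- by move=> t IH k /IH[p H]; exists (p ^+ k) => x; rewrite rmorphXn /= H.
Qed.

Lemma clause_mpoly n (c : seq (GRing.term R) * seq (GRing.term R)) :
    all (@GRing.rterm R) c.1 -> all (@GRing.rterm R) c.2 ->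
  exists s : seq (mpoly.mpoly n R) * seq (mpoly.mpoly n R),
    forall x : 'rV[R]_n,
    all (fun p => mpoly_eval p x == 0) s.1 && all (fun q => 0 < mpoly_eval q x) s.2
    = all (fun t => GRing.eval [seq x 0 i | i <- enum 'I_n] t == 0) c.1 &&
      all (fun t => 0 < GRing.eval [seq x 0 i | i <- enum 'I_n] t) c.2.
Proof.
have mp (l : seq (GRing.term R)) : all (@GRing.rterm R) l ->
    exists s : seq (mpoly.mpoly n R), forall x : 'rV[R]_n,
    [seq mpoly_eval p x | p <- s] =
    [seq GRing.eval [seq x 0 i | i <- enum 'I_n] t | t <- l].
  elim: l => [_|t l IH /= /andP[/(term_mpoly n)[p hp] /IH[s hs]]].
    by exists [::].
  by exists (p :: s) => x /=; rewrite hs hp.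
move=> /mp[s1 h1] /mp[s2 h2]; exists (s1, s2) => x /=.
have := congr1 (all (fun y => y == 0)) (h1 x); rewrite !all_map => ->.
by have := congr1 (all (fun y => 0 < y)) (h2 x); rewrite !all_map => ->.
Qed.

(** Quantifier elimination for real closed fields: the clauses of a disjunctive
normal form of the quantifier-free formula are the pieces of the set. *)
Lemma semialgebraic_definable n (P : (nat -> R) -> Prop) : definable P ->
  semialgebraic [set x : 'rV[R]_n | P (row_env x)].
Proof.
move=> [F FP].
pose G := ord.quantifier_elim
  (fun i s => qe_rcf.qfr_to_formula (@qe_rcf.wproj R i s)) (ord.to_rform F).
have GP (e : seq R) : reflect (ord.holds e F) (ord.qf_eval e G) by exact: qe_rcf.rcf_satP.
have Gwf : ord.qf_form G && ord.rformula G.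
  apply: ord.quantifier_elim_wf; first by move=> *; exact: qe_rcf.wf_QE_wproj.
  exact: ord.to_rform_rformula.
have /andP[_ Gr] := Gwf.
have rdnf := ord.qf_to_dnf_rterm false Gr.
have Gdnf (e : seq R) := @ord.qf_to_dnfP R e _ Gwf.
suff [Fs HFs] : exists Fs : seq (seq (mpoly.mpoly n R) * seq (mpoly.mpoly n R)),
    forall x : 'rV[R]_n, has (fun s =>
           all (fun p => mpoly_eval p x == 0) s.1 &&
           all (fun q => 0 < mpoly_eval q x) s.2) Fs <->
    ord.holds [seq x 0 i | i <- enum 'I_n]
      (ord.odnf_to_oform (ord.qf_to_odnf G false)).
  exists Fs; apply/seteqP; split=> x /=.
    move=> Px; apply/HFs; apply/ord.qf_evalP; first exact: ord.dnf_to_form_qf.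
    by rewrite Gdnf; apply/GP/FP; rewrite -row_envE.
  move=> /HFs/ord.qf_evalP; rewrite Gdnf => /(_ (ord.dnf_to_form_qf _)) /GP /FP.
  by rewrite -row_envE.
elim: (ord.qf_to_odnf G false) rdnf => [_|oc ocs IH /andP[roc rocs]].
  by exists [::].
have {IH rocs} [Fs HFs] := IH rocs.
have rw := @ord.dnf_rterm_subproof R oc roc.
have [Fs' HFs'] : exists Fs : seq (seq (mpoly.mpoly n R) * seq (mpoly.mpoly n R)),
    forall x : 'rV[R]_n, has (fun s =>
           all (fun p => mpoly_eval p x == 0) s.1 &&
           all (fun q => 0 < mpoly_eval q x) s.2) Fs <->
    ord.holds [seq x 0 i | i <- enum 'I_n]
      (ord.odnf_to_oform (map (@ord.w_to_oclause R) (ord.oclause_to_w oc))).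
  elim: (ord.oclause_to_w oc) rw => [_|c cs IH /= /andP[rc rcs]].
    by exists [::].
  have {IH rcs} [Fs' HFs'] := IH rcs.
  move: rc; rewrite /ord.dnf_rterm /= andbT => /andP[rc1 rc2].
  have [s hs] := clause_mpoly n rc1 rc2.
  exists (s :: Fs') => x /=; rewrite hs -HFs'.
  set e := [seq _ | _ <- _].
  have -> : ord.holds e (foldr (fun t => ord.And (ord.Equal t (GRing.NatConst R 0)))
      (ord.Bool true) c.1) <-> all (fun t => GRing.eval e t == 0) c.1.
    elim: (c.1) => //= t l ->.
    by split=> [[-> ->]|/andP[/eqP -> ->]] //; rewrite eqxx.
  have -> : ord.holds e (foldr (fun t => ord.And (ord.Lt (GRing.NatConst R 0) t))
      (ord.Bool true) c.2) <-> all (fun t => 0 < GRing.eval e t) c.2.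
    elim: (c.2) => //= t l ->.
    by split=> [[-> ->]|/andP[-> ->]].
  split=> [/orP[/andP[-> ->]|]|[[-> [_ [-> _]]]|->]]; [by left|by right|by []|].
  by rewrite orbT.
exists (Fs' ++ Fs) => x; rewrite has_cat.
have orE := ord.odnf_to_oform_cat [seq x 0 i | i <- enum 'I_n] [:: oc]
  ocs.
have ocE := ord.oclause_neq_leq_elimP oc [seq x 0 i | i <- enum 'I_n].
rewrite -(rwP orP) HFs HFs' -ord.oclause_to_wP -ocE.
exact: iff_sym.
Qed.

End Definable.

(** * Semialgebraic sets and open sets *)

Section Thin.
Context {R : realType} {n : nat}.
Implicit Types (p : mpoly n R) (A : set 'rV[R]_n).

Lemma continuous_mpoly_eval p : continuous (mpoly_eval p : 'rV[R]_n -> R).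
Proof.
rewrite /mpoly_eval (_ : (fun x => _) = fun x : 'rV[R]_n =>
    \sum_(m <- msupp p) mcoeff m p * \prod_i x 0 i ^+ m i); last first.
  by apply/funext => y; rewrite mevalE.
apply: (@continuous_big R _ +%R 0 xpredT) => [|m _]; first exact: add_continuous.
move=> x; apply: continuousM; first exact: cst_continuous.
move: x; apply: (@continuous_big R _ *%R 1 xpredT) => [|i _]; first exact: mul_continuous.
move=> x; apply: (@continuous_comp _ _ _ (fun y : 'rV[R]_n => y 0 i)
  (fun y => y ^+ m i)).
  exact: coord_continuous.
exact: exprn_continuous.
Qed.

Lemma mpoly_eval_line p (a b : 'rV[R]_n) :
  exists q : {poly R}, forall t, q.[t] = mpoly_eval p (a + t *: b).
Proof.
exists (\sum_(m <- msupp p) (mcoeff m p)%:P *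
  \prod_i ((a 0 i)%:P + (b 0 i) *: 'X) ^+ m i) => t.
rewrite /mpoly_eval mevalE horner_sum; apply: eq_bigr => m _.
rewrite hornerM hornerC horner_prod; congr (_ * _); apply: eq_bigr => i _.
by rewrite horner_exp !hornerE !mxE mulrC.
Qed.

Lemma finite_poly_roots (q : {poly R}) : q != 0 -> finite_set [set t | q.[t] = 0].
Proof.
move=> q0; apply: contrapT => /infiniteP /pcard_leP /injfunPex[/= u funu inju].
pose rs := [seq u k | k <- iota 0 (size q)].
have := max_poly_roots q0 (rs := rs).
rewrite size_map size_iota ltnn => H; suff: false by []; apply: H.
  by apply/allP => _ /mapP[k _ ->]; apply/rootP/funu.
rewrite map_inj_uniq ?iota_uniq // => i j; apply: inju; exact: mem_set.
Qed.

Lemma near_line (V : set 'rV[R]_n) (a b : 'rV[R]_n) : open V -> V a ->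
  exists2 e : R, 0 < e & forall t : R, `|t| < e -> V (a + t *: b).
Proof.
move=> oV Va.
have c : (fun t : R => a + t *: b) @ (0 : R) --> a + (0 : R) *: b.
  apply: cvgD; first exact: cvg_cst.
  by apply: cvgZl; exact: cvg_id.
have nV : nbhs (a + (0 : R) *: b) V.
  by rewrite scale0r addr0; apply: open_nbhs_nbhs.
have /nbhs_ballP[e /= e0 He] := c _ nV.
exists e => // t te; apply: (He t).
by rewrite /ball /= sub0r normrN.
Qed.

(** On the line from a point of [V] to [x1], the polynomial has finitely many zeros. *)
Lemma mpoly_nonzero_dense p x1 (V : set 'rV[R]_n) : mpoly_eval p x1 != 0 ->
  open V -> V !=set0 -> exists2 x, V x & mpoly_eval p x != 0.
Proof.
move=> px1 oV [a Va]; have [q qE] := mpoly_eval_line p a (x1 - a).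
have q0 : q != 0.
  apply: contraNneq px1 => q0.
  by rewrite (_ : x1 = a + 1 *: (x1 - a)) -?qE ?q0 ?horner0 // scale1r addrC subrK.
have [e e0 He] := near_line (x1 - a) oV Va.
apply: contrapT => H.
have e0' : - e < e by rewrite gtrN.
apply: (uncountable_itv e0').
apply: sub_countable (finite_set_countable (finite_poly_roots q0)).
apply: subset_card_le => t /=; rewrite in_itv /= => te.
rewrite qE; apply/eqP; apply: contra_notT H => nz; exists (a + t *: (x1 - a)) => //.
by apply: He; rewrite ltr_norml.
Qed.

Definition clause_set (s : seq (mpoly n R) * seq (mpoly n R)) : set 'rV[R]_n :=
  [set x | all (fun p => mpoly_eval p x == 0) s.1 &&
           all (fun q => 0 < mpoly_eval q x) s.2].

Lemma open_mpoly_gt0 (l : seq (mpoly n R)) :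
  open [set x : 'rV[R]_n | all (fun q => 0 < mpoly_eval q x) l].
Proof.
elim: l => [|q l IH] /=.
  by have -> : [set _ : 'rV[R]_n | true] = setT; [apply/seteqP; split|exact: openT].
rewrite (_ : [set x | _] = (mpoly_eval q @^-1` [set y | 0 < y]) `&`
   [set x : 'rV[R]_n | all (fun q => 0 < mpoly_eval q x) l]); last first.
  by apply/seteqP; split=> x /= => [/andP//|[-> ->]].
apply: openI => //; apply: open_comp; last exact: open_gt.
by move=> x _; exact: continuous_mpoly_eval.
Qed.

(** A piece of the set lies on a hypersurface if one of its equations is nontrivial,
and is open otherwise; the equations of the pieces are multiplied together. *)
Lemma semialgebraic_thin A : semialgebraic A ->
  (exists V, [/\ open V, V !=set0 & V `<=` A]) \/
  (exists p, (exists x, mpoly_eval p x != 0) /\ forall x, A x -> mpoly_eval p x = 0).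
Proof.
move=> [F ->]; elim: F => [|s F [[V [oV V0 VF]]|[p [[x1 px1] Fp]]]] /=.
- by right; exists 1; split=> //; exists 0; rewrite /mpoly_eval meval1 oner_neq0.
- by left; exists V; split=> // x /VF /= ->; rewrite orbT.
have : (exists V, [/\ open V, V !=set0 & V `<=` clause_set s]) \/
  (exists p, (exists x, mpoly_eval p x != 0) /\
     forall x, clause_set s x -> mpoly_eval p x = 0).
  have [[q [qs [x qx]]]|H] :=
    pselect (exists q, q \in s.1 /\ exists x : 'rV[R]_n, mpoly_eval q x != 0).
    right; exists q; split; first by exists x.
    by move=> y /andP[/allP /(_ _ qs) /eqP].
  have [[x xs]|H'] := pselect (exists x : 'rV[R]_n, all (fun q => 0 < mpoly_eval q x) s.2).
    left; exists [set x : 'rV[R]_n | all (fun q => 0 < mpoly_eval q x) s.2].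
    split; [exact: open_mpoly_gt0|by exists x|].
    move=> y /= ys; apply/andP; split => //; apply/allP => q qs.
    by apply: contra_notT H => qy; exists q; split=> //; exists y.
  right; exists 1; split; first by exists 0; rewrite /mpoly_eval meval1 oner_neq0.
  by move=> y /andP[_ ys]; exfalso; apply: H'; exists y.
case=> [[V [oV V0 VF]]|[q [[x2 qx2] Fq]]].
  by left; exists V; split=> // x /VF /=; rewrite /clause_set /= => ->.
right; exists (p * q); rewrite /mpoly_eval; split.
  have oV : open [set x : 'rV[R]_n | mpoly_eval p x != 0].
    rewrite (_ : [set x | _] = mpoly_eval p @^-1` [set y | y != 0]) //.
    apply: open_comp => [x _|]; [exact: continuous_mpoly_eval|exact: open_neq].
  have [|x px qx] := mpoly_nonzero_dense qx2 oV; first by exists x1.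
  by exists x; rewrite mevalM mulf_neq0.
move=> x /orP[xs|xF]; rewrite mevalM.
  by rewrite [X in _ * X]Fq ?mulr0.
by rewrite [X in X * _]Fp ?mul0r.
Qed.

(** On a small enough open set, each of the polynomials has a constant sign. *)
Lemma semialgebraic_local_decide A (V : set 'rV[R]_n) :
  semialgebraic A -> open V -> V !=set0 ->
  exists W, [/\ open W, W !=set0, W `<=` V & W `<=` A \/ W `<=` ~` A].
Proof.
move=> [F ->].
have sgp p (U : set 'rV[R]_n) : open U -> U !=set0 -> exists W,
    [/\ open W, W !=set0, W `<=` U &
     forall x y, W x -> W y -> Num.sg (mpoly_eval p x) = Num.sg (mpoly_eval p y)].
  move=> oU U0; have [[x [Ux px]]|H] := pselect (exists x, U x /\ mpoly_eval p x != 0); last first.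
    exists U; split=> // x y Ux Uy.
    suff z u : U u -> mpoly_eval p u = 0 by rewrite !z.
    by move=> Uu; apply/eqP; apply: contra_notT H => nz; exists u.
  have c := @continuous_mpoly_eval p x.
  move: px; rewrite neq_lt => /orP[px|px].
    exists (U `&` mpoly_eval p @^-1` [set y | y < 0]); split.
    - apply: openI => //; apply: open_comp => [z _|]; [exact: continuous_mpoly_eval|exact: open_lt].
    - by exists x.
    - by move=> z [].
    - by move=> y z [_ /= yn] [_ /= zn]; rewrite !ltr0_sg.
  exists (U `&` mpoly_eval p @^-1` [set y | 0 < y]); split.
  - apply: openI => //; apply: open_comp => [z _|]; [exact: continuous_mpoly_eval|exact: open_gt].
  - by exists x.
  - by move=> z [].
  - by move=> y z [_ /= yn] [_ /= zn]; rewrite !gtr0_sg.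
have sgl (l : seq (mpoly n R)) (U : set 'rV[R]_n) : open U -> U !=set0 -> exists W,
    [/\ open W, W !=set0, W `<=` U &
     forall x y, W x -> W y -> forall p, p \in l ->
       Num.sg (mpoly_eval p x) = Num.sg (mpoly_eval p y)].
  elim: l U => [|p l IH] U oU U0; first by exists U; split.
  have [W1 [oW1 W10 WU WE]] := sgp p U oU U0.
  have [W2 [oW2 W20 W21 WE2]] := IH _ oW1 W10.
  exists W2; split=> //; first exact: subset_trans WU.
  move=> x y Wx Wy q; rewrite inE => /orP[/eqP ->|]; last exact: WE2.
  by apply: WE; exact: W21.
elim: F V => [|s F IH] V oV V0 /=; first by exists V; split=> //; right => x _ /=.
have [W1 [oW1 W10 W1V WE]] := sgl (s.1 ++ s.2) V oV V0.
have [W2 [oW2 W20 W21 WE2]] := IH _ oW1 W10.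
exists W2; split=> //; first exact: subset_trans W1V.
have clE x y : W2 x -> W2 y -> clause_set s x -> clause_set s y.
  move=> /W21 Wx /W21 Wy /andP[/allP h1 /allP h2]; apply/andP; split; apply/allP => p ps.
    rewrite -sgr_eq0 -(WE x y Wx Wy) ?mem_cat ?ps // sgr_eq0; exact: h1.
  rewrite -sgr_gt0 -(WE x y Wx Wy) ?mem_cat ?ps ?orbT // sgr_gt0; exact: h2.
case: WE2 => [WF|WF]; first by left => x /WF /= ->; rewrite orbT.
have [x0 Wx0] := W20; have [sx|nsx] := pselect (clause_set s x0).
  by left => x Wx /=; apply/orP; left; exact: (clE x0).
right => x Wx /= /orP[sx|]; last exact: WF.
by apply: nsx; exact: (clE x).
Qed.

End Thin.

(** * Slices of a semialgebraic set without two-dimensional cells *)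

Section Slices.
Context {R : realType}.

Definition row2 (x y : R) : 'rV[R]_2 := \row_m (if m == 0 then x else y).

Lemma row2E (q : 'rV[R]_2) : q = row2 (q 0 0) (q 0 1).
Proof. by apply/rowP; case=> -[|[|//]] Hm; rewrite mxE; congr (q _ _); apply/val_inj. Qed.

Lemma row_envEord n (q : 'rV[R]_n) (m : 'I_n) : row_env q m = q 0 m.
Proof. by rewrite /row_env valK. Qed.

Lemma row_env2 (q : 'rV[R]_2) : (row_env q 0 = q 0 0) * (row_env q 1 = q 0 1).
Proof. by split; [rewrite -(row_envEord q 0)|rewrite -(row_envEord q 1)]. Qed.

Lemma row_norm2_lt (q : 'rV[R]_2) (d : R) :
  (`|q| < d) = (0 < d) && ((`|q 0 0| < d) && (`|q 0 1| < d)).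
Proof.
apply/idP/idP => [qd|/and3P[d0 q0 q1]].
  rewrite (le_lt_trans (normr_ge0 _) qd) /=.
  by rewrite !(le_lt_trans (row_norm_coord _ _) qd).
apply: row_norm_lt => // -[[|[|//]] Hm].
  by rewrite (_ : Ordinal _ = 0) //; apply/val_inj.
by rewrite (_ : Ordinal _ = 1) //; apply/val_inj.
Qed.

Lemma ord3_third (i j : 'I_3) : i != j ->
  exists k : 'I_3, [/\ k != i, k != j & forall m, [\/ m = i, m = j | m = k]].
Proof.
move=> ij; have [k Hk] : exists k : 'I_3, (k != i) && (k != j).
  case: i j ij => -[|[|[|//]]] Hi [[|[|[|//]]] Hj] //= _;
  solve [by exists 0|by exists 1|by exists 2%:R].
have /andP[ki kj] := Hk; exists k; split=> // m.
have [|mi] := eqVneq m i; first by constructor 1.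
have [|mj] := eqVneq m j; first by constructor 2.
constructor 3; apply/val_inj => /=.
move: ij ki kj mi mj; rewrite -!val_eqE /=.
have := ltn_ord i; have := ltn_ord j; have := ltn_ord k; have := ltn_ord m; lia.
Qed.

Variables (S : set 'rV[R]_3) (i j : 'I_3).
Hypotheses (S_sa : semialgebraic S) (S_closed : closed S) (ij : i != j).

(** Coordinates [i] and [j] parametrize the base of a projection, and the remaining
one its fibres. *)
Definition pt3 (x y z : R) : 'rV[R]_3 :=
  \row_m (if m == i then x else if m == j then y else z).

Lemma definable_pt3 (a b c : nat) :
  definable (fun e : nat -> R => S (pt3 (e a) (e b) (e c))).
Proof.
pose s (m : 'I_3) := if m == i then a else if m == j then b else c.
have D := definable_semialgebraic s S_sa; apply: eq_definable D => e.
rewrite (_ : pt3 _ _ _ = \row_m e (s m)) //.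
by apply/rowP => m; rewrite !mxE /s; case: ifP => //; case: ifP.
Qed.

Definition shadow : set 'rV[R]_2 :=
  [set q | exists s, S (pt3 (q 0 0) (q 0 1) s)].

Lemma semialgebraic_shadow : semialgebraic shadow.
Proof.
have D := semialgebraic_definable 2 (definable_ex 2 (definable_pt3 0 1 2)).
rewrite (_ : shadow = [set q | exists s, S (pt3 (row_env q 0) (row_env q 1) s)]) //.
by apply/seteqP; split=> q /= [s]; rewrite !row_env2; exists s.
Qed.

(** A definable choice of a point in each fibre of the projection: fibres being
closed, each of them has a point closest to zero, and in case of a tie the
nonnegative one is preferred. *)
Definition nearest (x y s : R) : Prop :=
  S (pt3 x y s) /\ forall s', S (pt3 x y s') ->
    s ^+ 2 < s' ^+ 2 \/ (s ^+ 2 = s' ^+ 2 /\ s' <= s).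

Lemma nearest_uniq x y s s' : nearest x y s -> nearest x y s' -> s = s'.
Proof.
move=> [Ss Hs] [Ss' Hs']; have := Hs _ Ss'; have := Hs' _ Ss.
case=> [lt1|[e1 le1]] [lt2|[e2 le2]]; [lra|lra|lra|].
by apply/eqP; rewrite eq_le le1 le2.
Qed.

Lemma continuous_pt3 x y : continuous (pt3 x y).
Proof.
move=> s; apply: continuous_row => k; under eq_fun do rewrite mxE; rewrite mxE.
case: ifP => _; first exact: cvg_cst.
by case: ifP => _; [exact: cvg_cst|exact: cvg_id].
Qed.

Lemma nearest_ex x y : (exists s, S (pt3 x y s)) -> exists s, nearest x y s.
Proof.
move=> [s0 Ss0].
pose Z := [set s | S (pt3 x y s)].
have cZ : closed Z.
  by apply: preimage_closed S_closed => s _; exact: continuous_pt3.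
pose K : set R := `[- `|s0|, `|s0|] `&` Z.
have cK : compact K.
  by apply: compact_closedI cZ; exact: segment_compact.
have K0 : K !=set0.
  exists s0; split => //=; rewrite in_itv /= -ler_norml //.
have [c cK' Hc] := @compact_EVT_min R R (fun s => s ^+ 2) K K0 cK
  (continuous_subspaceT (@exprn_continuous R 2)).
have [_ Zc] := set_mem cK'.
have Hc2 s' : S (pt3 x y s') -> c ^+ 2 <= s' ^+ 2.
  move=> Ss'; have [le|lt] := leP `|s'| `|s0|.
    by apply: Hc; rewrite inE; split=> //=; rewrite in_itv /= -ler_norml.
  apply: (@le_trans _ _ (s0 ^+ 2)).
    by apply: Hc; rewrite inE; split=> //=; rewrite in_itv /= -ler_norml.
  by rewrite -[leLHS]real_normK ?num_real // -[leRHS]real_normK ?num_real //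
    lerXn2r ?nnegrE // ltW.
have [Sn|nSn] := pselect (S (pt3 x y `|c|)).
  exists `|c|; split=> // s' Ss'; have := Hc2 _ Ss'.
  rewrite le_eqVlt real_normK ?num_real // => /orP[/eqP cs|->]; last by left.
  right; split=> //; rewrite (le_trans (ler_norm _)) //.
  have : `|c| ^+ 2 == `|s'| ^+ 2 by rewrite !real_normK ?num_real // cs.
  by rewrite eqrXn2 // => /eqP ->.
exists c; split=> // s' Ss'; have := Hc2 _ Ss'.
rewrite le_eqVlt => /orP[/eqP cs|->]; last by left.
right; split=> //; have /eqP : c ^+ 2 = s' ^+ 2 by [].
rewrite eqf_sqr => /orP[/eqP ->//|/eqP cs'].
have [c0|c0] := leP 0 c; first by move: nSn; rewrite ger0_norm.
by move: nSn; rewrite ltr0_norm // cs' opprK.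
Qed.

Lemma definable_nearest (a b c : nat) :
  definable (fun e : nat -> R => nearest (e a) (e b) (e c)).
Proof.
pose d := (a + b + c).+1.
have D := definable_and (definable_pt3 a b c) (definable_all d (definable_imp
  (definable_pt3 a b d) (definable_or
   (definable_lt (term_funX 2 (term_fun_var c)) (term_funX 2 (term_fun_var d)))
   (definable_and
   (definable_eq (term_funX 2 (term_fun_var c)) (term_funX 2 (term_fun_var d)))
   (definable_le (term_fun_var d) (term_fun_var c)))))).
apply: eq_definable D => e /=; rewrite eqxx.
have -> : (a == d) = false by rewrite /d; lia.
have -> : (b == d) = false by rewrite /d; lia.
by have -> : (c == d) = false by rewrite /d; lia.
Qed.

(** Continuity of the selection is studied through these sets, which are
semialgebraic, hence decided near generic points. *)
Definition selection_lt (t : R) : set 'rV[R]_2 :=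
  [set q | exists s, nearest (q 0 0) (q 0 1) s /\ s < t].

Lemma semialgebraic_selection_lt t : semialgebraic (selection_lt t).
Proof.
have D := semialgebraic_definable 2 (definable_ex 2 (definable_and
  (definable_nearest 0 1 2) (definable_lt (term_fun_var 2) (term_fun_cst t)))).
rewrite (_ : selection_lt t =
  [set q | exists s, nearest (row_env q 0) (row_env q 1) s /\ s < t]) //.
by apply/seteqP; split=> q /= [s]; rewrite !row_env2; exists s.
Qed.

(** Spelled out with strict inequalities between coordinates, so that it is visibly a
first-order formula. *)
Definition selection_continuous_at (x y : R) : Prop :=
  forall eps, 0 < eps -> exists d, 0 < d /\ forall x' y',
    ((- d < x' - x /\ x' - x < d) /\ (- d < y' - y /\ y' - y < d)) ->
    forall s s', nearest x y s -> nearest x' y' s' ->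
    (- eps < s' - s /\ s' - s < eps).

Lemma definable_between (a b c : nat) : definable (fun e : nat -> R =>
  - e a < e b - e c /\ e b - e c < e a).
Proof.
have B := @term_funD R _ _ (term_fun_var b) (term_funN (term_fun_var c)).
have D := definable_and (definable_lt (term_funN (term_fun_var a)) B)
  (definable_lt B (term_fun_var a)).
exact: D.
Qed.

Lemma semialgebraic_selection_continuous :
  semialgebraic [set q : 'rV[R]_2 | selection_continuous_at (q 0 0) (q 0 1)].
Proof.
have pos a := @definable_lt R _ _ (term_fun_cst 0) (term_fun_var a).
have D := definable_all 2 (definable_imp (pos 2) (definable_ex 3 (definable_and
  (pos 3) (definable_all 4 (definable_all 5 (definable_imp
   (definable_and (definable_between 3 4 0) (definable_between 3 5 1))
   (definable_all 6 (definable_all 7 (definable_imp (definable_nearest 0 1 6)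
     (definable_imp (definable_nearest 4 5 7) (definable_between 2 7 6))))))))))).
have := semialgebraic_definable 2 D.
rewrite /= (_ : [set q | _] =
  [set q : 'rV[R]_2 | selection_continuous_at (q 0 0) (q 0 1)]) //.
by apply/seteqP; split=> q /=; rewrite !row_env2.
Qed.

Lemma selection_decided_dense t :
  dense ((selection_lt t)° `|` (~` selection_lt t)°).
Proof.
move=> V V0 oV.
have [W [oW [x Wx] WV WS]] :=
  semialgebraic_local_decide (semialgebraic_selection_lt t) oV V0.
by exists x; split; [exact: WV|];
  case: WS => WS; [left|right]; rewrite /interior; apply: filterS WS _;
  exact: open_nbhs_nbhs.
Qed.

(** If the continuity points, which form a semialgebraic set, were not dense
somewhere in [V], then none would exist in some open part of [V]. But by Baire's
theorem this part has a point near which each set [selection_lt t] with [t]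
rational is decided, and the selection is continuous there. *)
Lemma selection_continuous_somewhere (V : set 'rV[R]_2) :
  open V -> V !=set0 -> V `<=` shadow ->
  exists W, [/\ open W, W !=set0, W `<=` V &
    forall q, W q -> selection_continuous_at (q 0 0) (q 0 1)].
Proof.
move=> oV V0 Vs.
have [W [oW W0 WV [WD|WD]]] := semialgebraic_local_decide
  semialgebraic_selection_continuous oV V0; first by exists W; split.
exfalso.
pose O k : set 'rV[R]_2 := let t := ratr (odflt 0 (unpickle k)) in
  (selection_lt t)° `|` (~` selection_lt t)°.
have bO : dense (\bigcap_k (O k)).
  apply: Baire => k; split; last exact: selection_decided_dense.
  by apply: openU; exact: open_interior.
have [q [Wq Oq]] := bO W W0 oW.
apply: (WD q Wq) => /= eps eps0.
have [s Hs] := nearest_ex (Vs _ (WV _ Wq)).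
have s_lt : s < s + eps by rewrite ltrDl.
have lt_s : s - eps < s by rewrite ltrBlDr ltrDl.
have [b] := rat_in_itvoo s_lt; have [a] := rat_in_itvoo lt_s.
rewrite !in_itv /= => /andP[a1 a2] /andP[b1 b2].
have nb : nbhs q (selection_lt (ratr b)).
  have := Oq (pickle b) I; rewrite /O pickleK /= => -[//|].
  by move=> /interior_subset[]; exists s.
have na : nbhs q (~` selection_lt (ratr a)).
  have := Oq (pickle a) I; rewrite /O pickleK /= => -[|//].
  move=> /interior_subset[s' [Hs' lt]]; move: lt.
  by rewrite -(nearest_uniq Hs Hs') ltNge (ltW a2).
have nab : nbhs q (selection_lt (ratr b) `&` ~` selection_lt (ratr a)).
  exact: filterI.
have [d /= d0 Hd] := (@nbhs_ballP R _ _ _).1 nab.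
exists d; split => // x' y' [[x1 x2] [y1 y2]] s1 s' Hs1 Hs'.
rewrite -(nearest_uniq Hs Hs1).
have /Hd : ball q d (row2 x' y').
  rewrite -ball_normE /= row_norm2_lt d0 !mxE /= !ltr_norml.
  by apply/andP; split; apply/andP; split; lra.
move=> [[s2 []]] /[!mxE] /= Hs2; rewrite -(nearest_uniq Hs' Hs2) => lt1 H3.
have le2 : ratr a <= s'.
  rewrite leNgt; apply/negP => lt3; apply: H3; exists s'.
  by rewrite !mxE.
by split; lra.
Qed.

Lemma pt3_coord x y z k : k != i -> k != j ->
  [/\ pt3 x y z 0 i = x, pt3 x y z 0 j = y & pt3 x y z 0 k = z].
Proof.
move=> ki kj; rewrite !mxE eqxx eqxx (eq_sym j) (negPf ij) (negPf ki) (negPf kj).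
by [].
Qed.

(** Over a small square on which the selection is continuous, its graph is a cell,
with the rescaled projection as inverse chart. *)
Lemma shadow_cell (V : set 'rV[R]_2) :
  open V -> V !=set0 -> V `<=` shadow -> contains_cell S 2.
Proof.
move=> oV V0 Vs.
have [W [oW [w Ww] WV Wc]] := selection_continuous_somewhere oV V0 Vs.
have [r /= r0 Wr] := (@nbhs_ballP R _ _ _).1 (open_nbhs_nbhs (conj oW Ww)).
have [k [ki kj kP]] := ord3_third ij.
pose a (t : 'rV[R]_2) : 'rV[R]_2 :=
  row2 (w 0 0 + r * (t 0 0 - 2^-1)) (w 0 1 + r * (t 0 1 - 2^-1)).
have a_cont : continuous a.
  move=> t; apply: continuous_row => m; rewrite /a.
  under eq_fun do rewrite mxE; rewrite mxE; case: ifP => _;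
  exact: affine_coord_continuous.
have a_W t : open_cube t -> W (a t).
  move=> ct; apply: Wr; rewrite -ball_normE /= row_norm2_lt r0 !mxE /=.
  have /andP[u1 u2] := ct 0; have /andP[v1 v2] := ct 1.
  by apply/andP; split; rewrite ltr_norml; apply/andP; split; nra.
pose h (q : 'rV[R]_2) := xget 0 (nearest (q 0 0) (q 0 1)).
have hP q : W q -> nearest (q 0 0) (q 0 1) (h q).
  move=> Wq; have [s Hs] := nearest_ex (Vs _ (WV _ Wq)).
  by apply: xgetPex; exists s.
have h_cont q : W q -> {for q, continuous h}.
  move=> Wq; apply/continuous_dist => eps eps0.
  have [d [d0 Hd]] := Wc q Wq eps eps0.
  have nW : nbhs q W by exact: open_nbhs_nbhs.
  apply: filterS (filterI (near_dist q d0) nW) => q' [qd Wq'].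
  rewrite distrC ltr_norml.
  have H := Hd (q' 0 0) (q' 0 1) _ (h q) (h q') (hP q Wq) (hP q' Wq').
  apply/andP; apply: H; move: qd; rewrite distrC row_norm2_lt !mxE !ltr_norml.
  by move=> /and3P[_ /andP[-> ->] /andP[-> ->]].
pose phi t := pt3 (a t 0 0) (a t 0 1) (h (a t)).
pose psi (y : 'rV[R]_3) : 'rV[R]_2 :=
  row2 (2^-1 + r^-1 * (y 0 i - w 0 0)) (2^-1 + r^-1 * (y 0 j - w 0 1)).
exists phi, psi; split.
- split.
    have pos c := @definable_lt R _ _ (term_fun_cst 0) (term_fun_var c).
    have lt1 c := @definable_lt R _ _ (term_fun_var c) (term_fun_cst 1).
    have := semialgebraic_definable 2 (definable_and (definable_and (pos 0) (lt1 0))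
      (definable_and (pos 1) (lt1 1))).
    rewrite (_ : [set _ | _] = @open_cube R 2) //.
    apply/seteqP; split=> q /=; rewrite !row_env2.
      move=> [[u1 u2] [v1 v2]] [[|[|//]] Hm].
        by rewrite (_ : Ordinal _ = 0) ?u1 //; apply/val_inj.
      by rewrite (_ : Ordinal _ = 1) ?v1 //; apply/val_inj.
    by move=> H; have /andP[-> ->] := H 0; have /andP[-> ->] := H 1.
  have pos c := @definable_lt R _ _ (term_fun_cst 0) (term_fun_var c).
  have lt1 c := @definable_lt R _ _ (term_fun_var c) (term_fun_cst 1).
  have aff c d (w0 : R) := @definable_eq R _ _ (term_fun_var c) (term_funD
    (term_fun_cst w0) (term_funM (term_fun_cst r)
      (term_funD (term_fun_var d) (term_fun_cst (- 2^-1))))).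
  have := semialgebraic_definable 5 (definable_and (definable_and
      (definable_and (pos 0) (lt1 0)) (definable_and (pos 1) (lt1 1)))
    (definable_and (definable_and (aff (2 + i)%N 0 (w 0 0)) (aff (2 + j)%N 1 (w 0 1)))
     (definable_nearest (2 + i) (2 + j) (2 + k)))).
  have eL (z : 'rV[R]_5) : (row_env z 0 = z 0 (lshift 3 (0 : 'I_2))) *
      (row_env z 1 = z 0 (lshift 3 (1 : 'I_2))).
    by split; rewrite -row_envEord.
  have eR (z : 'rV[R]_5) (m : 'I_3) : row_env z (2 + m)%N = z 0 (rshift 2 m).
    by rewrite -row_envEord.
  rewrite (_ : [set _ | _] = [set row_mx x (phi x) | x in @open_cube R 2]) //.
  apply/seteqP; split=> z /=.
    rewrite !eL !eR => -[[[u1 u2] [v1 v2]] [[zi zj] Hz]].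
    pose t := row2 (z 0 (lshift 3 (0 : 'I_2))) (z 0 (lshift 3 (1 : 'I_2))).
    have ct : open_cube t.
      by move=> [[|[|//]] Hm]; rewrite mxE /= ?u1 ?v1.
    exists t => //.
    rewrite -[RHS](@hsubmxK _ 1 2 3 z); congr row_mx.
      by rewrite [RHS]row2E !mxE.
    have ati : a t 0 0 = z 0 (rshift 2 i) by rewrite zi !mxE.
    have atj : a t 0 1 = z 0 (rshift 2 j) by rewrite zj !mxE.
    have Ht := hP _ (a_W t ct).
    rewrite ati atj in Ht.
    have [e1 e2 e3] := pt3_coord (a t 0 0) (a t 0 1) (h (a t)) ki kj.
    apply/rowP => m; rewrite [RHS]mxE; case: (kP m) => ->; rewrite /phi ?e1 ?e2 ?e3 //.
    exact: nearest_uniq Ht Hz.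
  move=> [t ct zE].
  have zl (m : 'I_2) : z 0 (lshift 3 m) = t 0 m by rewrite -zE; exact: row_mxEl.
  have zr (m : 'I_3) : z 0 (rshift 2 m) = phi t 0 m by rewrite -zE; exact: row_mxEr.
  rewrite !eL !eR !zl !zr.
  have [e1 e2 e3] := pt3_coord (a t 0 0) (a t 0 1) (h (a t)) ki kj.
  have /andP[u1 u2] := ct 0; have /andP[v1 v2] := ct 1.
  rewrite /phi e1 e2 e3; split=> //; split; last exact: hP (a_W t ct).
  by rewrite !mxE.
- by move=> _ [t ct <-]; have [] := hP _ (a_W t ct).
- move=> t _; have [e1 e2 _] := pt3_coord (a t 0 0) (a t 0 1) (h (a t)) ki kj.
  rewrite /psi /phi e1 e2 [RHS]row2E !mxE /=.
  by congr row2; field; rewrite gt_eqF.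
- apply: continuous_in_subspaceT => t /set_mem ct; apply: continuous_row => m.
  under eq_fun do rewrite mxE; rewrite mxE.
  have cc (m' : 'I_2) : continuous (fun q : 'rV[R]_2 => q 0 m').
    by move=> q; exact: coord_continuous.
  have ac m' : {for t, continuous (fun t => a t 0 m')}.
    by apply: (@continuous_comp _ _ _ a (fun q : 'rV[R]_2 => q 0 m')); [exact: a_cont|exact: cc].
  case: ifP => _; first exact: ac.
  case: ifP => _; first exact: ac.
  by apply: (@continuous_comp _ _ _ a h); [exact: a_cont|apply: h_cont; exact: a_W].
- apply: continuous_subspaceT => y; apply: continuous_row => m.
  under eq_fun do rewrite mxE; rewrite mxE.
  by case: ifP => _; exact: affine_coord_continuous.
Qed.

(** Without interior points, the shadow lies on an algebraic curve, which contains
finitely many of the lines and meets each of the others in a finite set. *)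
Lemma countable_shadow_slices : ~ contains_cell S 2 ->
  countable [set c | ~ countable [set t | shadow (row2 c t)]].
Proof.
move=> nS; case: (semialgebraic_thin semialgebraic_shadow) => [[V [oV V0 Vs]]|].
  by case: nS; exact: shadow_cell Vs.
move=> [p [[x1 px1] Hp]].
have [q qE] := mpoly_eval_line p (row2 0 (x1 0 1)) (row2 1 0).
have lineE c : row2 0 (x1 0 1) + c *: row2 1 0 = row2 c (x1 0 1).
  by apply/rowP => m; rewrite !mxE; case: ifP => _; rewrite ?mulr1 ?mulr0 ?add0r ?addr0.
have q0 : q != 0.
  apply: contraNneq px1 => q0; rewrite (row2E x1) -lineE -qE q0 horner0 //.
apply: sub_countable (finite_set_countable (finite_poly_roots q0)).
apply: subset_card_le => c /= Hc; rewrite qE lineE.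
apply: contrapT => pc; apply: Hc.
have [q' q'E] := mpoly_eval_line p (row2 c 0) (row2 0 1).
have lineE' t : row2 c 0 + t *: row2 0 1 = row2 c t.
  by apply/rowP => m; rewrite !mxE; case: ifP => _; rewrite ?mulr1 ?mulr0 ?add0r ?addr0.
have q'0 : q' != 0.
  by apply/eqP => q'0; apply: pc; rewrite -lineE' -q'E q'0 horner0.
apply: sub_countable (finite_set_countable (finite_poly_roots q'0)).
by apply: subset_card_le => t /= Ht; rewrite q'E lineE'; exact: Hp.
Qed.

End Slices.

Section SliceCount.
Context {R : realType}.

(** A slice of [S] lies in the product of the slices, at the same level, of two
shadows of [S]. *)
Lemma countable_thick_slices (S : set 'rV[R]_3) (i : 'I_3) :
  semialgebraic S -> closed S -> ~ contains_cell S 2 ->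
  countable [set c | ~ countable (S `&` [set y | y 0 i = c])].
Proof.
move=> S_sa S_cl nS.
have [j ij] : exists j, i != j.
  by case: i => -[|m] Hm; [exists 1|exists 0].
have [k [ki kj kP]] := ord3_third ij.
have ik : i != k by rewrite eq_sym.
have Cj := countable_shadow_slices S_sa S_cl ij nS.
have Ck := countable_shadow_slices S_sa S_cl ik nS.
apply: sub_countable (countableU Cj Ck).
apply: subset_card_le => c /= Hc; apply: contrapT => /not_orP[/contrapT cj /contrapT ck].
apply: Hc.
pose g (q : R * R) : 'rV[R]_3 := pt3 i j c q.1 q.2.
apply: sub_countable (countable_image g (countableX cj ck)).
apply: subset_card_le => y [Sy yi].
have yE : y = g (y 0 j, y 0 k).
  rewrite /g /=; have [e1 e2 e3] := pt3_coord ij c (y 0 j) (y 0 k) ki kj.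
  by apply/rowP => m; case: (kP m) => ->; rewrite ?e1 ?e2 ?e3.
exists (y 0 j, y 0 k) => //; split; rewrite /= /shadow /= !mxE /=.
  by exists (y 0 k); rewrite -/(g (y 0 j, y 0 k)) -yE.
exists (y 0 j); rewrite (_ : pt3 _ _ _ _ _ = y) //.
apply/rowP => m; rewrite !mxE; case: (kP m) => ->.
- by rewrite eqxx.
- by rewrite eq_sym (negPf ij) eq_sym (negPf kj).
- by rewrite (negPf ki) eqxx.
Qed.

End SliceCount.

(** * The nonproper set *)

Section Nonproper.
Context {R : realType}.

(** Closed bounded sets being compact, properness at [y] means that some ball around
[y] has a bounded preimage. *)
Lemma nonproperP n m (f : 'rV[R]_n -> 'rV[R]_m) (y : 'rV[R]_m) : continuous f ->
  nonproper_set f y <-> forall eps N : R, 0 < eps -> 0 < N ->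
    exists x, N < `|x| /\ `|f x - y| < eps.
Proof.
move=> cf; split=> [np eps N eps0 N0|H [U [yU cU]]].
  apply: contrapT => H; apply: np.
  have eps20 : 0 < eps / 2 by rewrite divr_gt0.
  exists [set z | `|y - z| < eps / 2]; split; first exact: (near_dist y eps20).
  have cl : closure [set z | `|y - z| < eps / 2] `<=` [set z | `|y - z| <= eps / 2].
    have c2 : closed [set z : 'rV[R]_m | `|y - z| <= eps / 2].
      have -> : [set z : 'rV[R]_m | `|y - z| <= eps / 2] = closed_ball_ Num.norm y (eps / 2).
        by [].
      exact: closed_closed_ball_.
    rewrite [X in _ `<=` X](closure_id _).1 //; apply: closureS => z /= /ltW //.
  apply: (@compact_rV _ _ _ N).
    by apply: preimage_closed; [move=> x _; exact: cf|exact: closed_closure].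
  move=> x /cl /= xz; rewrite leNgt; apply/negP => Nx; apply: H; exists x.
  split=> //; rewrite distrC (le_lt_trans xz) // ltr_pdivrMr // ltr_pMr // ltr1n.
  by [].
have [e /= e0 eU] := (@nbhs_ballP R _ _ _).1 yU.
have [M M0 HM] := compact_norm_le cU.
have [x [Mx fx]] := H e M e0 M0.
have := HM x; rewrite leNgt Mx => /(_ _) H'; suff: false by []; apply: H'.
by apply: subset_closure; apply: eU; rewrite -ball_normE /= distrC.
Qed.

Lemma closed_nonproper n m (f : 'rV[R]_n -> 'rV[R]_m) : closed (nonproper_set f).
Proof.
have -> : nonproper_set f = ~` [set y | proper_at f y] by [].
apply: open_closedC.
rewrite openE => y [U [yU cU]].
move: yU; rewrite nbhsE => -[V [oV Vy] VU].
by rewrite /interior nbhsE; exists V => // z Vz; exists U; split=> //;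
  rewrite nbhsE; exists V.
Qed.

Lemma row3_norm_lt (z : 'rV[R]_3) (e : R) : 0 < e ->
  `|z| < e <-> (- e < z 0 0 /\ z 0 0 < e) /\ ((- e < z 0 1 /\ z 0 1 < e) /\
    (- e < z 0 2%:R /\ z 0 2%:R < e)).
Proof.
move=> e0; split=> [ze|[[a1 a2] [[b1 b2] [c1 c2]]]].
  have H m : - e < z 0 m /\ z 0 m < e.
    by apply/andP; rewrite -ltr_norml; exact: le_lt_trans (row_norm_coord _ _) ze.
  by split; [exact: H|split; exact: H].
apply: row_norm_lt => // -[[|[|[|//]]] Hm]; rewrite ltr_norml.
- by rewrite (_ : Ordinal _ = 0) ?a1 //; apply/val_inj.
- by rewrite (_ : Ordinal _ = 1) ?b1 //; apply/val_inj.
- by rewrite (_ : Ordinal _ = 2%:R) ?c1 //; apply/val_inj.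
Qed.

(** Squares avoid absolute values, which are not terms of the language. *)
Lemma row3_norm_gt (z : 'rV[R]_3) (e : R) : 0 < e ->
  e < `|z| <-> e ^+ 2 < z 0 0 ^+ 2 \/ (e ^+ 2 < z 0 1 ^+ 2 \/ e ^+ 2 < z 0 2%:R ^+ 2).
Proof.
move=> e0.
have sqE m : (e ^+ 2 < z 0 m ^+ 2) = (e < `|z 0 m|).
  by rewrite -[z 0 m ^+ 2]real_normK ?num_real // ltr_pXn2r ?nnegrE // ltW.
rewrite !sqE; split=> [ez|[|[]] H]; last 3 first.
- exact: lt_le_trans H (row_norm_coord _ _).
- exact: lt_le_trans H (row_norm_coord _ _).
- exact: lt_le_trans H (row_norm_coord _ _).
apply: contrapT => /not_orP[/negP + /not_orP[/negP + /negP]].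
rewrite -!leNgt => h0 h1 h2; move: ez; rewrite ltNge => /negP; apply.
apply: row_norm_le; first exact: ltW.
case=> -[|[|[|//]]] Hm.
- by rewrite (_ : Ordinal _ = 0) //; apply/val_inj.
- by rewrite (_ : Ordinal _ = 1) //; apply/val_inj.
- by rewrite (_ : Ordinal _ = 2%:R) //; apply/val_inj.
Qed.

Lemma row_env3 (q : 'rV[R]_3) :
  (row_env q 0 = q 0 0) * ((row_env q 1 = q 0 1) * (row_env q 2 = q 0 2%:R)).
Proof.
by split; [rewrite -(row_envEord q 0)|split;
  [rewrite -(row_envEord q 1)|rewrite -(row_envEord q 2%:R)]].
Qed.

Lemma semialgebraic_nonproper (f : 'rV[R]_3 -> 'rV[R]_3) : continuous f ->
  semialgebraic_map_on setT f -> semialgebraic (nonproper_set f).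
Proof.
move=> cf [_ Gsa].
have G := definable_semialgebraic (fun m : 'I_(3 + 3) => (5 + m)%N) Gsa.
have pos c := @definable_lt R _ _ (term_fun_cst 0) (term_fun_var c).
have far c := @definable_lt R _ _ (term_funX 2 (term_fun_var 4)) (term_funX 2 (term_fun_var c)).
(* Variables 0 to 2 are the coordinates of [y], variable 3 is [eps], variable 4 is
   [N], variables 5 to 7 are the coordinates of [x] and 8 to 10 those of [f x]. *)
have D := definable_all 3 (definable_all 4 (definable_imp (pos 3) (definable_imp (pos 4)
  (definable_ex 5 (definable_ex 6 (definable_ex 7 (definable_ex 8 (definable_ex 9
   (definable_ex 10 (definable_and G (definable_and
     (definable_or (far 5) (definable_or (far 6) (far 7)))
     (definable_and (definable_between 3 8 0) (definable_and (definable_between 3 9 1)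
       (definable_between 3 10 2))))))))))))))%N.
have := semialgebraic_definable 3 D; rewrite /=.
rewrite (_ : [set _ | _] = nonproper_set f) //.
apply/seteqP; split=> y /=.
  move=> H; apply/(nonproperP _ cf) => eps N eps0 N0.
  have [x0 [x1 [x2 [z0 [z1 [z2 [[x _ xE] [xN yE]]]]]]]] := H eps N eps0 N0.
  have xl (m : 'I_3) := congr1 (fun r : 'rV[R]_(3 + 3) => r 0 (lshift 3 m)) xE.
  have xr (m : 'I_3) := congr1 (fun r : 'rV[R]_(3 + 3) => r 0 (rshift 3 m)) xE.
  exists x; split.
    apply/row3_norm_gt => //.
    have := xl 0; have := xl 1; have := xl 2%:R.
    by rewrite !row_mxEl !mxE /= => -> -> ->.
  apply/row3_norm_lt => //; rewrite !mxE.
  have := xr 0; have := xr 1; have := xr 2%:R; rewrite !row_mxEr !mxE /= => -> -> ->.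
  by move: yE; rewrite !row_env3.
move=> /(nonproperP _ cf) H eps N eps0 N0.
have [x [xN fx]] := H eps N eps0 N0.
exists (x 0 0), (x 0 1), (x 0 2%:R), (f x 0 0), (f x 0 1), (f x 0 2%:R).
split.
  exists x => //; apply/rowP => m; case: (split_ordP m) => k ->;
  rewrite ?row_mxEl ?row_mxEr mxE; case: k => -[|[|[|//]]] Hk /=; congr (_ _ _);
  exact/val_inj.
split; first exact/row3_norm_gt.
by move: fx => /(row3_norm_lt _ eps0); rewrite !mxE !row_env3.
Qed.

Lemma codim2_no_cell (A : set 'rV[R]_3) :
  (2%:R%:E <= semialgebraic_codim A)%E -> ~ contains_cell A 2.
Proof.
move=> codim c2; have : (2%:R%:E <= semialgebraic_dim A)%E.
  by apply: ereal_sup_ubound; exists 2%N.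
move: codim; rewrite /semialgebraic_codim.
case: (semialgebraic_dim A) => [r| |] //.
by rewrite -EFinB !lee_fin => ? ?; lra.
Qed.

End Nonproper.

End SemialgebraicSets.

(** * Connected and convex sets *)

Section Connectedness.

Lemma connected_local_ind (X : topologicalType) (C : set X) (P : X -> Prop) (x0 : X) :
  connected C -> C x0 -> P x0 ->
  (forall x, C x -> P x -> \forall y \near x, C y -> P y) ->
  (forall x, C x -> ~ P x -> \forall y \near x, C y -> ~ P y) ->
  forall x, C x -> P x.
Proof.
move=> cC Cx0 Px0 oP cP.
suff E : C `&` P = C by move=> x; rewrite -E => -[].
apply: cC; first by exists x0.
- exists (interior [set y | C y -> P y]); first exact: open_interior.
  apply/seteqP; split=> x [Cx Px]; split=> //; first exact: oP.
  by have := interior_subset Px; apply.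
- exists (~` interior [set y | C y -> ~ P y]).
    by apply: open_closedC; exact: open_interior.
  apply/seteqP; split=> x [Cx Px]; split=> //.
    by move=> /interior_subset /(_ Cx); apply.
  by apply: contrapT => nP; apply: Px; exact: cP.
Qed.

Variable R : realType.

(** The supremum of the times reached is reached, and cannot be less than one. *)
Lemma real_induction (P : R -> Prop) : P 0 ->
  (forall t t', 0 <= t' <= t -> P t -> P t') ->
  (forall t, 0 <= t <= 1 -> (forall t', 0 <= t' < t -> P t') ->
     exists2 e, 0 < e & P (t + e)) ->
  P 1.
Proof.
move=> P0 Pd Pe.
pose S : set R := [set t | 0 <= t <= 1 /\ P t].
have S0 : S 0 by split=> //; rewrite lexx ler01.
have ubS : ubound S 1 by move=> t [/andP[]].
have supS : has_sup S by split; [exists 0|exists 1].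
have u0 : 0 <= sup S by apply: sup_upper_bound.
have u1 : sup S <= 1 by apply: ge_sup => //; exists 0.
have [||e e0 Pu] := Pe (sup S); first by rewrite u0.
  move=> t' /andP[t0 tu]; have [s [s01 Ps] ts] := sup_gt (proj1 supS) tu.
  by apply: Pd Ps; rewrite t0 ltW.
have [le1|lt1] := leP 1 (sup S + e).
  by apply: Pd Pu; rewrite le1 ler01.
have : S (sup S + e) by split=> //; rewrite addr_ge0 ?(ltW lt1) // ltW.
by move/(sup_upper_bound supS); rewrite gerDl leNgt e0.
Qed.

Variable V : normedModType R.
Implicit Types (a b x y z : V) (A : set V).

Definition convexset A := forall a b t, A a -> A b -> 0 <= t <= 1 -> A (a + t *: (b - a)).

Lemma segment_continuous a b : continuous (fun t : R => a + t *: (b - a)).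
Proof.
move=> t; apply: cvgD; first exact: cvg_cst.
by apply: cvgZl; exact: cvg_id.
Qed.

Definition segment a b : set V := [set a + t *: (b - a) | t in `[0, 1]].

Lemma connected_segment a b : connected (segment a b).
Proof.
apply: connected_continuous_connected; first exact: segment_connected.
by apply: continuous_subspaceT; exact: segment_continuous.
Qed.

Lemma segment_left a b : segment a b a.
Proof. by exists 0; rewrite ?scale0r ?addr0 //= in_itv /= lexx ler01. Qed.

Lemma segment_right a b : segment a b b.
Proof. by exists 1; rewrite ?scale1r ?[a + _]addrC ?subrK //= in_itv /= lexx ler01. Qed.

Lemma starshaped_connected A a : A a -> (forall b, A b -> segment a b `<=` A) ->
  connected A.
Proof.
move=> Aa HA; rewrite (_ : A = \bigcup_(b in A) segment a b).
  apply: bigcup_connected => [|b _]; last exact: connected_segment.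
  by exists a => b _; exact: segment_left.
apply/seteqP; split=> [b Ab|x [b Ab]]; last exact: HA.
by exists b => //; exact: segment_right.
Qed.

Lemma convex_connected A : convexset A -> connected A.
Proof.
move=> cA; have [[a Aa]|/forallNP A0] := pselect (A !=set0).
  apply: (starshaped_connected Aa) => b Ab _ [t /= t01 <-]; apply: cA => //.
rewrite (_ : A = set0); first exact: connected0.
by apply/seteqP; split=> // x /A0.
Qed.

Lemma convexI A B : convexset A -> convexset B -> convexset (A `&` B).
Proof. by move=> cA cB a b t [Aa Ba] [Ab Bb] t01; split; [exact: cA|exact: cB]. Qed.

Lemma convex_ball x (r : R) : convexset [set z | `|z - x| < r].
Proof.
move=> a b t /= ax bx /andP[t0 t1].
have -> : a + t *: (b - a) - x = (1 - t) *: (a - x) + t *: (b - x).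
  rewrite scalerBl scale1r -[in RHS]addrA [- (_ *: _) + _]addrC -scalerBr opprB addrA subrK.
  by rewrite addrAC.
have t1' : 0 <= 1 - t by rewrite subr_ge0.
rewrite (le_lt_trans (ler_normD _ _)) // !normrZ (ger0_norm t0) (ger0_norm t1').
have [-> |tn0] := eqVneq t 0; first by rewrite subr0 mul1r mul0r addr0.
have t0' : 0 < t by rewrite lt_neqAle eq_sym tn0.
apply: (@lt_le_trans _ _ ((1 - t) * r + t * r)); last by rewrite -mulrDl subrK mul1r.
by rewrite ler_ltD ?ltr_pM2l // ler_wpM2l // ltW.
Qed.

(** A neighbourhood of an initial part of the segment from [x] to [y]. It is convex,
so that sections over two such sets can be compared on their intersection. *)
Definition tube x y (t r : R) : set V :=
  [set z | exists2 s, 0 <= s <= t & `|z - (x + s *: (y - x))| < r].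

Lemma convex_tube x y t r : convexset (tube x y t r).
Proof.
move=> a b c [s /andP[s0 st] az] [s' /andP[s0' st'] bz] /andP[c0 c1].
exists (s + c * (s' - s)); first by apply/andP; split; nra.
set p := x + s *: (y - x) in az; set p' := x + s' *: (y - x) in bz.
have -> : x + (s + c * (s' - s)) *: (y - x) = p + c *: (p' - p).
  rewrite /p /p' [in RHS](addrC x (s' *: _)) opprD addrA addrK -scalerBl scalerA.
  by rewrite -addrA -scalerDl.
have -> : a + c *: (b - a) - (p + c *: (p' - p)) =
    (a - p) + c *: ((b - p') - (a - p)).
  rewrite opprD addrACA -scalerBr; congr (_ + c *: _).
  by rewrite !opprB addrACA [in RHS]addrACA [- p' - a]addrC.
have := @convex_ball 0 r (a - p) (b - p') c; rewrite /= !subr0; apply=> //.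
by rewrite c0.
Qed.

Lemma tube_open x y t r : open (tube x y t r).
Proof.
rewrite openE => z [s s0t zr]; rewrite /interior.
have e0 : 0 < r - `|z - (x + s *: (y - x))| by rewrite subr_gt0.
apply: filterS (near_dist z e0) => z' zz'; exists s => //.
rewrite -(subrK z z') -addrA (le_lt_trans (ler_normD _ _)) //.
by move: zz'; rewrite distrC ltrBrDr.
Qed.

End Connectedness.

(** * Continuation of sections along segments *)

Section GermSections.
Context {R : realType} {V : normedModType R} {T : Type}.
Variable loc : (V -> T) -> V -> Prop.
(** [loc s x] is meant to say that the germ of [s] at [x] is the germ of a section of
some local homeomorphism: this depends on the germ only, and two such germs
either coincide or have nowhere equal representatives. *)
Record rigid_germs := RigidGerms {
  germ_local : forall s s' x, (\forall y \near x, s y = s' y) -> loc s x -> loc s' x;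
  germ_eq : forall s s' x, loc s x -> loc s' x -> s x = s' x ->
    \forall y \near x, s y = s' y;
  germ_neq : forall s s' x, loc s x -> loc s' x -> s x <> s' x ->
    \forall y \near x, s y <> s' y }.

Hypothesis loc_rigid : rigid_germs.

Lemma section_unique (C : set V) s s' x0 : connected C -> C x0 ->
  (forall x, C x -> loc s x) -> (forall x, C x -> loc s' x) -> s x0 = s' x0 ->
  forall x, C x -> s x = s' x.
Proof.
move=> cC Cx0 ls ls' e0.
apply: (connected_local_ind cC Cx0 e0) => x Cx sx.
  by apply: filterS (germ_eq loc_rigid (ls x Cx) (ls' x Cx) sx) => y -> _.
by apply: filterS (germ_neq loc_rigid (ls x Cx) (ls' x Cx) sx) => y H _.
Qed.

Lemma section_glue (A B : set V) s s' : open A -> open B ->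
  (forall x, A x -> loc s x) -> (forall x, B x -> loc s' x) ->
  (forall x, A x -> B x -> s x = s' x) ->
  exists g, (forall x, A x -> g x = s x) /\ (forall x, A x \/ B x -> loc g x).
Proof.
move=> oA oB ls ls' E; pose g x := if x \in A then s x else s' x.
have gA x : A x -> g x = s x by rewrite /g => Ax; rewrite mem_set.
have gB x : B x -> g x = s' x.
  by rewrite /g => Bx; case: ifPn => // /set_mem Ax; exact: E.
exists g; split=> // x [Ax|Bx].
  apply: (germ_local loc_rigid) (ls x Ax).
  by apply: filterS (open_nbhs_nbhs (conj oA Ax)) => y /gA.
apply: (germ_local loc_rigid) (ls' x Bx).
by apply: filterS (open_nbhs_nbhs (conj oB Bx)) => y /gB.
Qed.

Variables (Y : set V) (x0 : V) (v0 : T).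
Hypotheses (oY : open Y) (Y0 : Y x0).

Definition tube_section y t : Prop := exists r s,
  [/\ 0 < r, forall z, tube x0 y t r z -> loc s z & s x0 = v0].

Hypothesis sec0 : exists r s,
  [/\ 0 < r, forall z, `|z - x0| < r -> loc s z & s x0 = v0].

Hypothesis extend : forall y t, Y y -> 0 < t <= 1 ->
  (forall t', 0 <= t' < t -> tube_section y t') ->
  exists eta t1, [/\ 0 < eta, 0 <= t1 < t,
    `|(x0 + t1 *: (y - x0)) - (x0 + t *: (y - x0))| < eta &
    forall r s, 0 < r -> (forall z, tube x0 y t1 r z -> loc s z) -> s x0 = v0 ->
    exists s', (forall z, `|z - (x0 + t *: (y - x0))| < eta -> loc s' z) /\
      s' (x0 + t1 *: (y - x0)) = s (x0 + t1 *: (y - x0))].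

(** The section over an initial part is glued, along a convex intersection, with the
local section provided by [extend]; the new radius is small enough for the longer
tube to be covered by the two domains. *)
Lemma tube_section1 y : Y y -> tube_section y 1.
Proof.
move=> Yy; set v := y - x0; have nv : 0 < `|v| + 1 by rewrite ltr_wpDl.
apply: real_induction.
- have [r [s [r0 ls sx0]]] := sec0; exists r, s; split=> // z [u].
  by rewrite -eq_le => /eqP <-; rewrite scale0r addr0; exact: ls.
- move=> t t' /andP[t0 tt'] [r [s [r0 ls sx0]]]; exists r, s; split=> // z [u].
  move=> /andP[u0 ut] zu; apply: ls; exists u => //.
  by rewrite u0 (le_trans ut).
- move=> t /andP[t0 t1] H; move: t0; rewrite le_eqVlt => /orP[/eqP <-|t0].
    have [r [s [r0 ls sx0]]] := sec0.
    exists (r / 2 / (`|v| + 1)); first by rewrite !divr_gt0.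
    exists (r / 2), s; split=> //; first by rewrite divr_gt0.
    move=> z [u /andP[u0]]; rewrite add0r ler_pdivlMr // => ur zu; apply: ls.
    rewrite -(subrK (x0 + u *: v) z) -addrA -[_ + u *: v - x0]addrAC subrr add0r.
    rewrite (le_lt_trans (ler_normD _ _)) // normrZ (ger0_norm u0).
    by move: zu; rewrite -/v; have := normr_ge0 v; nra.
  have t01 : 0 < t <= 1 by rewrite t0.
  have [eta [t1' [eta0 /andP[s0 s1] ds ext]]] := extend Yy t01 H.
  have [r [s [r0 ls sx0]]] := H t1' (introT andP (conj s0 s1)).
  have [s' [ls' es]] := ext r s r0 ls sx0.
  pose p u := x0 + u *: v.
  have pB u u' : p u - p u' = (u - u') *: v.
    by rewrite /p (addrC x0 (u *: v)) opprD addrA addrK -scalerBl.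
  have dpt : (t - t1') * `|v| < eta.
    by move: ds; rewrite -/(p t1') -/(p t) pB normrZ distrC gtr0_norm // subr_gt0.
  have oB : open [set z | `|z - p t| < eta].
    rewrite openE => z /= zp; rewrite /interior.
    have e0 : 0 < eta - `|z - p t| by rewrite subr_gt0.
    apply: filterS (near_dist z e0) => z' /= zz'.
    rewrite -(subrK z z') -addrA (le_lt_trans (ler_normD _ _)) //.
    by move: zz'; rewrite distrC ltrBrDr.
  have [|g [gs lg]] := section_glue (@tube_open _ _ x0 y t1' r) oB ls ls'.
    have cI : connected (tube x0 y t1' r `&` [set z | `|z - p t| < eta]).
      apply: convex_connected; apply: convexI; first exact: convex_tube.
      exact: convex_ball.
    move=> z Az Bz; apply: (section_unique cI _ _ _ (esym es)) => //.
    - split=> //; exists t1'; first by rewrite s0 lexx.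
      by rewrite subrr normr0.
    - by move=> x [/ls].
    - by move=> x [_ /ls'].
  pose r' := Num.min r (Num.min ((eta - (t - t1') * `|v|) / 2) (eta / 2)).
  have r'0 : 0 < r' by rewrite !lt_min r0 !divr_gt0 // subr_gt0.
  have r'r : r' <= r by rewrite ge_min lexx.
  have r'1 : r' <= (eta - (t - t1') * `|v|) / 2 by rewrite !ge_min lexx orbT.
  have r'2 : r' <= eta / 2 by rewrite !ge_min lexx !orbT.
  exists (r' / (`|v| + 1)); first by rewrite divr_gt0.
  exists r', g; split=> //; last first.
    rewrite gs //; exists 0; first by rewrite lexx.
    by rewrite scale0r addr0 subrr normr0.
  move=> z [u /andP[u0 ut] zu]; apply: lg.
  have [ut1|ut1] := leP u t1'.
    by left; exists u; [rewrite u0|exact: lt_le_trans r'r].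
  right; rewrite /= -(subrK (p u) z) -addrA pB (le_lt_trans (ler_normD _ _)) //.
  rewrite normrZ; have : `|u - t| * `|v| <= Num.max ((t - t1') * `|v|) r'.
    have [ut2|ut2] := leP u t.
      rewrite le_max distrC ger0_norm ?subr_ge0 // ler_wpM2r // lerD2l lerN2.
      exact: ltW.
    rewrite le_max; apply/orP; right; rewrite gtr0_norm ?subr_gt0 //.
    have : (u - t) * (`|v| + 1) <= r' by rewrite -ler_pdivlMr // lerBlDl.
    by apply: le_trans; rewrite ler_wpM2l ?lerDl // subr_ge0 ltW.
  by rewrite le_max => /orP[H1|H1]; move: zu; rewrite -/v -/(p u); lra.
Qed.

(** The value at [y] is that of a section over the tube around the segment from [x0]
to [y]; such sections agree on the intersections of the tubes. *)
Lemma starshaped_section :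
  exists g, (forall z, Y z -> loc g z) /\ g x0 = v0.
Proof.
have [R_ HR] : {R_ : V -> R * (V -> T) & forall y, Y y ->
    [/\ 0 < (R_ y).1, forall z, tube x0 y 1 (R_ y).1 z -> loc (R_ y).2 z &
        (R_ y).2 x0 = v0]}.
  apply: (@choice _ _ (fun y p => Y y -> [/\ 0 < p.1,
    forall z, tube x0 y 1 p.1 z -> loc p.2 z & p.2 x0 = v0])) => y.
  have [Yy|nY] := pselect (Y y); last first.
    by have [r [s _]] := sec0; exists (r, s).
  by have [r [s H]] := tube_section1 Yy; exists (r, s).
pose g y := (R_ y).2 y.
have seg_tube y y' r : `|y' - y| < r -> segment x0 y' `<=` tube x0 y 1 r.
  move=> yy' z [t t01 <-]; move: t01; rewrite /= in_itv /= => /andP[t0 t1].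
  exists t; first by rewrite t0.
  rewrite opprD addrACA subrr add0r -scalerBr opprB addrA subrK.
  rewrite normrZ ger0_norm //; apply: le_lt_trans yy'.
  by rewrite ler_piMl.
have gE y y' : Y y -> Y y' -> `|y' - y| < (R_ y).1 -> g y' = (R_ y).2 y'.
  move=> Yy Yy' yy'; rewrite /g.
  have [r0 l0 e0] := HR y Yy; have [r1 l1 e1] := HR y' Yy'.
  apply: (section_unique (@connected_segment _ _ x0 y') (@segment_left _ _ x0 y')).
  - move=> x sx; apply: l1; apply: seg_tube sx; by rewrite subrr normr0.
  - by move=> x sx; apply: l0; apply: seg_tube sx.
  - by rewrite e0 e1.
  - exact: segment_right.
exists g; split.
  move=> y Yy; have [r0 l0 e0] := HR y Yy.
  have ly : loc (R_ y).2 y.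
    apply: l0; apply: (@seg_tube y y); first by rewrite subrr normr0.
    exact: segment_right.
  apply: (germ_local loc_rigid) ly.
  apply: filterS (filterI (near_dist y r0) (open_nbhs_nbhs (conj oY Yy))) => y' [yy' Yy'].
  by rewrite (gE y y') // distrC.
by rewrite /g; have [] := HR x0 Y0.
Qed.

End GermSections.

(** * Branches of a double cover *)

Section DoubleCover.
Context {R : realType} {V : normedModType R}.
Variables (u w : V -> R).
Hypotheses (cu : continuous u) (cw : continuous w).

(** A branch of the double cover obtained by pulling back, along [(u, w)], the
connected double cover of the punctured plane: it is locally constant except
across the half-line [u > 0, w = 0], where it changes sign. *)
Definition branch (k : V -> bool) (y : V) : Prop :=
  \forall z \near y, k z = k y (+) [&& 0 < u y, w y == 0 & w z < 0].

Lemma branch_rigid : rigid_germs branch.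
Proof.
split=> [s s' x E bs|s s' x bs bs' e|s s' x bs bs' ne].
- have e := nbhs_singleton E.
  by apply: filterS (filterI E bs) => z [<-]; rewrite -e.
- by apply: filterS (filterI bs bs') => z [-> ->]; rewrite e.
- apply: filterS (filterI bs bs') => z [-> ->] H; apply: ne.
  by apply: (can_inj (addbK _)) H.
Qed.

Lemma branch_flip b k y : branch k y -> branch (fun z => b (+) k z) y.
Proof. by apply: filterS => z ->; rewrite addbA. Qed.

Lemma near_pos (h : V -> R) z : continuous h -> 0 < h z -> \forall y \near z, 0 < h y.
Proof.
move=> ch hz; have := (continuous_dist h z).1 (ch z) _ hz.
apply: filterS => y; rewrite ltr_norml => /andP[_]; lra.
Qed.

Lemma near_neg (h : V -> R) z : continuous h -> h z < 0 -> \forall y \near z, h y < 0.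
Proof.
move=> ch hz; have hz' : 0 < - h z by rewrite oppr_gt0.
have := (continuous_dist h z).1 (ch z) _ hz'.
apply: filterS => y; rewrite ltr_norml => /andP[+ _]; lra.
Qed.

(** The sign of [w] is a branch near the half-line, and a constant is one elsewhere. *)
Lemma branch_local p : ~ (u p = 0 /\ w p = 0) ->
  exists2 eta : R, 0 < eta & exists k, forall z, `|z - p| < eta -> branch k z.
Proof.
move=> nz; have wlt z : w z != 0 -> \forall y \near z, (w y < 0) = (w z < 0).
  rewrite neq_lt => /orP[wz|wz].
    by apply: filterS (near_neg cw wz) => y ->; rewrite wz.
  apply: filterS (near_pos cw wz) => y wy.
  by rewrite ltNge (ltW wy) ltNge (ltW wz).
have [up|up] := ltP 0 (u p).
  have [eta eta0 H] := near_norm_lt (near_pos cu up).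
  exists eta => //; exists (fun z => w z < 0) => z /H uz.
  rewrite /branch uz /=; have [w0|wn0] := eqVneq (w z) 0.
    by apply: nearW => y; rewrite w0 ltxx.
  by apply: filterS (wlt z wn0) => y ->; rewrite addbF.
have [w0|wn0] := eqVneq (w p) 0.
  have un : u p < 0.
    by rewrite lt_neqAle up andbT; apply/eqP => u0; apply: nz.
  have [eta eta0 H] := near_norm_lt (near_neg cu un).
  exists eta => //; exists (fun=> true) => z /H uz.
  by apply: nearW => y; rewrite ltNge (ltW uz).
have nw : \forall z \near p, w z != 0.
  move: wn0; rewrite neq_lt => /orP[wp|wp].
    by apply: filterS (near_neg cw wp) => y /lt_eqF ->.
  by apply: filterS (near_pos cw wp) => y /gt_eqF ->.
have [eta eta0 H] := near_norm_lt nw.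
exists eta => //; exists (fun=> true) => z /H wz.
by apply: nearW => y; rewrite (negPf wz) andbF.
Qed.

Lemma branch_convex (Y : set V) : open Y -> convexset Y -> Y !=set0 ->
  (forall y, Y y -> ~ (u y = 0 /\ w y = 0)) ->
  exists k, forall y, Y y -> branch k y.
Proof.
move=> oY cY [x0 Y0] nz.
suff [g [gb _]] : exists g, (forall z, Y z -> branch g z) /\ g x0 = true by exists g.
apply: (starshaped_section branch_rigid oY Y0).
  have [eta eta0 [k kb]] := branch_local (nz _ Y0).
  exists eta, (fun z => (~~ k x0) (+) k z); split=> //.
    by move=> z /kb; exact: branch_flip.
  by case: (k x0).
move=> y t Yy /andP[t0 t1] _.
have Yt : Y (x0 + t *: (y - x0)) by apply: cY => //; rewrite (ltW t0).
have [eta eta0 [k kb]] := branch_local (nz _ Yt).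
pose nv := `|y - x0| + 1; have nv0 : 0 < nv by rewrite ltr_wpDl.
pose d := Num.min t (eta / nv).
have d0 : 0 < d by rewrite lt_min t0 divr_gt0.
exists eta, (t - d / 2); split=> //.
- have dt : d <= t by rewrite ge_min lexx.
  by apply/andP; split; lra.
- rewrite opprD addrACA subrr add0r -scalerBl normrZ.
  have -> : `|t - d / 2 - t| = d / 2.
    by rewrite addrAC subrr add0r normrN gtr0_norm ?divr_gt0.
  have dn : d * nv <= eta by rewrite -ler_pdivlMr // ge_min lexx orbT.
  have := normr_ge0 (y - x0); move: dn; rewrite /nv; nra.
move=> r s r0 ls sx0.
set q := x0 + (t - d / 2) *: (y - x0).
exists (fun z => (s q (+) k q) (+) k z); split.
  by move=> z /kb; exact: branch_flip.
by rewrite -addbA addbb addbF.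
Qed.

(** The intersection being connected, the two branches agree there up to a sign. *)
Lemma branch_glue (A B : set V) k k' : open A -> open B -> connected (A `&` B) ->
  (forall y, A y -> branch k y) -> (forall y, B y -> branch k' y) ->
  exists g, forall y, (A `|` B) y -> branch g y.
Proof.
move=> oA oB cAB kb kb'.
have [[x0 [A0 B0]]|nAB] := pselect ((A `&` B) !=set0); last first.
  have [|g [_ H]] := section_glue branch_rigid oA oB kb kb'.
    by move=> x Ax Bx; case: nAB; exists x.
  by exists g.
pose k2 z := (k x0 (+) k' x0) (+) k' z.
have kb2 y : B y -> branch k2 y.
  by move=> /kb'; exact: branch_flip.
have [|g [_ H]] := section_glue branch_rigid oA oB kb kb2; last by exists g.
move=> x Ax Bx; apply: (section_unique branch_rigid cAB (conj A0 B0) _ _ _ (conj Ax Bx)).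
- by move=> z [/kb].
- by move=> z [_ /kb2].
- by rewrite /k2 -addbA addbb addbF.
Qed.

End DoubleCover.

(** * The complement of a cube *)

Section OutsideCube.
Context {R : realType}.
Implicit Type (rho : R).

Definition halfspace rho (i : 'I_3) (b : bool) : set 'rV[R]_3 :=
  [set x | rho < (-1) ^+ b * x 0 i].

Lemma halfspace_open rho i b : open (halfspace rho i b).
Proof.
rewrite (_ : halfspace rho i b =
  (fun x : 'rV[R]_3 => 0 + (-1) ^+ b * (x 0 i - 0)) @^-1` [set y | rho < y]); last first.
  by apply/seteqP; split=> x; rewrite /halfspace /= add0r subr0.
apply: open_comp; last exact: open_gt.
by move=> x _; exact: affine_coord_continuous.
Qed.

Lemma halfspace_convex rho i b : convexset (halfspace rho i b).
Proof.
move=> x y t; rewrite /halfspace /= !mxE; set s := (-1) ^+ b => xr yr /andP[t0 t1].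
have -> : s * (x 0 i + t * (y 0 i - x 0 i)) = (1 - t) * (s * x 0 i) + t * (s * y 0 i).
  by ring.
move: (s * x 0 i) (s * y 0 i) xr yr => a c ar cr.
by have [ac|ca] := leP a c; nra.
Qed.

Lemma halfspaces_meet rho (b0 b1 b2 : bool) : 0 <= rho -> exists x,
  [/\ halfspace rho 0 b0 x, halfspace rho 1 b1 x & halfspace rho 2%:R b2 x].
Proof.
move=> rho0; pose v (i : 'I_3) := if i == 0 then b0 else if i == 1 then b1 else b2.
exists (\row_i ((-1) ^+ (v i) * (rho + 1))).
by split; rewrite /halfspace /= mxE /v /= mulrA -signr_addb addbb mul1r ltrDl.
Qed.

Lemma halfspace_disjoint rho i x : 0 <= rho ->
  halfspace rho i false x -> halfspace rho i true x -> False.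
Proof. rewrite /halfspace /= expr0 expr1; lra. Qed.

Lemma halfspace_outside rho i b x : halfspace rho i b x -> rho < `|x|.
Proof.
move=> H; apply: lt_le_trans H (le_trans (ler_norm _) _).
by rewrite normrM normr_sign mul1r row_norm_coord.
Qed.

Lemma outside_cubeE rho : 0 <= rho -> [set x : 'rV[R]_3 | rho < `|x|] =
  halfspace rho 2%:R false `|` halfspace rho 0 false `|` halfspace rho 1 false
  `|` halfspace rho 0 true `|` halfspace rho 1 true `|` halfspace rho 2%:R true.
Proof.
move=> rho0; apply/seteqP; split=> x; rewrite /halfspace /= !expr0 !expr1 !mul1r !mulN1r.
  move=> xr; apply: contrapT => H.
  have lt i : ~ (rho < x 0 i) -> ~ (rho < - x 0 i) -> `|x 0 i| <= rho.
    by move=> /negP + /negP; rewrite -!leNgt => h1 h2; rewrite ler_norml; lra.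
  move: xr; rewrite ltNge => /negP; apply; apply: row_norm_le => // i.
  have i3 : [\/ i = 0, i = 1 | i = 2%:R].
    by case: i => -[|[|[|//]]] Hi; [constructor 1|constructor 2|constructor 3]; apply/val_inj.
  by case: i3 => ->; apply: lt => ?; apply: H; tauto.
have c i (b : bool) : rho < (-1) ^+ b * x 0 i -> rho < `|x|.
  by move=> h; apply: (@halfspace_outside rho i b).
have := c ^~ true; have := c ^~ false; rewrite expr0 expr1 => {}c c'.
move=> [[[[[]|]|]|]|]; rewrite ?mulN1r; last first.
- by move=> H; apply: c'; rewrite mulN1r; exact: H.
- by move=> H; apply: c'; rewrite mulN1r; exact: H.
- by move=> H; apply: c'; rewrite mulN1r; exact: H.
- by move=> H; apply: c; rewrite mul1r; exact: H.
- by move=> H; apply: c; rewrite mul1r; exact: H.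
- by move=> H; apply: c; rewrite mul1r; exact: H.
Qed.

Section Gluing.
Variables (rho : R) (rho0 : 0 <= rho).
Let H := halfspace rho.
Let z : 'I_3 := 2%:R.

(* Each half-space is added in turn to the union of the previous ones, which it
meets in a connected set: it is disjoint from the opposite half-space, and its
intersections with the others are convex and overlap in turn. *)
Let U1 := H z false `|` H 0 false.
Let U2 := U1 `|` H 1 false.
Let U3 := U2 `|` H 0 true.
Let U4 := U3 `|` H 1 true.

Let cI i b i' b' : connected (H i b `&` H i' b').
Proof. by apply: convex_connected; apply: convexI; exact: halfspace_convex. Qed.

Let nI i x : H i false x -> H i true x -> False.
Proof. exact: halfspace_disjoint. Qed.

Let cU1 : connected (H z false `&` H 0 false).
Proof. exact: cI. Qed.

Let cU2 : connected (U1 `&` H 1 false).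
Proof.
rewrite /U1 setIUl; apply: connectedU; [|exact: cI|exact: cI].
by have [x [x0 x1 x2]] := halfspaces_meet false false false rho0; exists x.
Qed.

Let cU3 : connected (U2 `&` H 0 true).
Proof.
have -> : U2 `&` H 0 true = (H z false `&` H 0 true) `|` (H 1 false `&` H 0 true).
  apply/seteqP; split=> x; rewrite /U2 /U1.
    by move=> [[[hz|h0]|h1] h]; [left|case: (nI h0 h)|right].
  by move=> [[hz h]|[h1 h]]; split=> //; [left; left|right].
apply: connectedU; [|exact: cI|exact: cI].
by have [x [x0 x1 x2]] := halfspaces_meet true false false rho0; exists x.
Qed.

Let cU4 : connected (U3 `&` H 1 true).
Proof.
have -> : U3 `&` H 1 true = (H z false `&` H 1 true) `|` (H 0 false `&` H 1 true)
    `|` (H 0 true `&` H 1 true).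
  apply/seteqP; split=> x; rewrite /U3 /U2 /U1.
    move=> [[[[hz|h0]|h1]|h0] h]; [by left; left|by left; right| |by right].
    by case: (nI h1 h).
  by move=> [[[hz h]|[h1 h]]|[h0 h]]; split=> //;
    [left; left; left|left; left; right|right].
apply: connectedU; [|apply: connectedU; [|exact: cI|exact: cI]|exact: cI].
  have [x [x0 x1 x2]] := halfspaces_meet true true false rho0.
  by exists x; split; [left|].
by have [x [x0 x1 x2]] := halfspaces_meet false true false rho0; exists x.
Qed.

Let cU5 : connected (U4 `&` H z true).
Proof.
have -> : U4 `&` H z true = ((H 0 false `&` H z true) `|` (H 1 false `&` H z true))
    `|` (H 0 true `&` H z true) `|` (H 1 true `&` H z true).
  apply/seteqP; split=> x; rewrite /U4 /U3 /U2 /U1.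
    move=> [[[[[hz|h0]|h1]|h0]|h1] h].
    - by case: (nI hz h).
    - by left; left; left.
    - by left; left; right.
    - by left; right.
    - by right.
  move=> [[[[h0 h]|[h1 h]]|[h0 h]]|[h1 h]]; split=> //.
  - by left; left; left; right.
  - by left; left; right.
  - by left; right.
  - by right.
apply: connectedU; [|apply: connectedU; [|apply: connectedU; [|exact: cI|exact: cI]
  |exact: cI]|exact: cI].
- have [x [x0 x1 x2]] := halfspaces_meet true true true rho0.
  by exists x; split; [right|].
- have [x [x0 x1 x2]] := halfspaces_meet true false true rho0.
  by exists x; split; [right|].
- by have [x [x0 x1 x2]] := halfspaces_meet false false true rho0; exists x.
Qed.

Let oH i b : open (H i b). Proof. exact: halfspace_open. Qed.

Lemma connected_outside_cube : connected [set x : 'rV[R]_3 | rho < `|x|].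
Proof.
rewrite outside_cubeE //.
have cH i b : connected (H i b) by apply: convex_connected; exact: halfspace_convex.
have W b0 b1 b2 := halfspaces_meet b0 b1 b2 rho0.
apply: connectedU; [|apply: connectedU; [|apply: connectedU; [|apply: connectedU;
  [|apply: connectedU; [|exact: cH|exact: cH]|exact: cH]|exact: cH]|exact: cH]|exact: cH].
- by have [x [x0 x1 x2]] := W false false true; exists x; split => //; do 3 left; right.
- by have [x [x0 x1 x2]] := W false true false; exists x; split => //; do 2 left; right.
- by have [x [x0 x1 x2]] := W true false false; exists x; split => //; right.
- by have [x [x0 x1 x2]] := W false false false; exists x; split => //; right.
- by have [x [x0 x1 x2]] := W false false false; exists x.
Qed.

(** Away from a cube, three-space is simply connected: branches on the six
half-spaces that cover it can be glued one after the other. *)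
Lemma branch_outside_cube (u w : 'rV[R]_3 -> R) : continuous u -> continuous w ->
  (forall x, rho < `|x| -> ~ (u x = 0 /\ w x = 0)) ->
  exists k, forall x, rho < `|x| -> branch u w k x.
Proof.
move=> cu cw nz.
have bH i b : exists k, forall x, H i b x -> branch u w k x.
  apply: branch_convex => //; first exact: halfspace_convex.
    exists (\row_j ((-1) ^+ b * (rho + 1))).
    by rewrite /H /halfspace /= mxE mulrA -signr_addb addbb mul1r ltrDl.
  by move=> y /halfspace_outside; exact: nz.
have step (A : set 'rV[R]_3) i b : open A -> connected (A `&` H i b) ->
    (exists k, forall x, A x -> branch u w k x) ->
    exists k, forall x, (A `|` H i b) x -> branch u w k x.
  move=> oA cA [k kb]; have [k' kb'] := bH i b.
  exact: branch_glue cA kb kb'.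
have oU1 : open U1 by apply: openU.
have oU2 : open U2 by apply: openU.
have oU3 : open U3 by apply: openU.
have oU4 : open U4 by apply: openU.
have [k kb] := step _ _ _ oU4 cU5 (step _ _ _ oU3 cU4 (step _ _ _ oU2 cU3
  (step _ _ _ oU1 cU2 (step _ _ _ (@oH _ _) cU1 (bH _ _))))).
exists k => x xr; apply: kb; suff : [set x : 'rV[R]_3 | rho < `|x|] x by rewrite outside_cubeE.
exact: xr.
Qed.

End Gluing.
End OutsideCube.

(** * Proper local homeomorphisms *)

Section LocalHomeo.
Context {R : realType} {n : nat}.
Notation E := 'rV[R]_n.
Implicit Types (f g : E -> E).

Definition local_homeo f : Prop := continuous f /\ forall x, exists U g,
  [/\ open U, U x, open (f @` U), forall y, (f @` U) y -> {for y, continuous g} &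
      forall z, U z -> g (f z) = z].

Lemma Ck_on_continuous (W : normedModType R) k (U : set E) (f : E -> W) :
  Ck_on k U f -> forall x, U x -> {for x, continuous f}.
Proof.
by case: k => [//|k] [df _] x Ux; apply: differentiable_continuous; exact: df.
Qed.

Lemma Ck_local_homeo k f : Ck_local_diffeomorphism k f -> local_homeo f.
Proof.
move=> Hf; split=> x; have [U [Ux [oU oV CU [g [Cg gK]]]]] := Hf x.
  exact: Ck_on_continuous CU x Ux.
exists U, g; split=> //; first by move=> y; exact: (Ck_on_continuous Cg).
by move=> z Uz; apply: gK; exact: mem_set.
Qed.

Variable f : E -> E.
Hypothesis f_lh : local_homeo f.

Lemma local_homeo_continuous : continuous f. Proof. exact: (proj1 f_lh). Qed.

Lemma local_homeo_nbhs x (A : set E) : nbhs x A -> nbhs (f x) (f @` A).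
Proof.
move=> xA; have [U [g [oU Ux oV cg gK]]] := (proj2 f_lh) x.
have fxU : (f @` U) (f x) by exists x.
have gA : \forall y \near f x, A (g y).
  by apply: (cg _ fxU); rewrite gK.
apply: filterS (filterI gA (open_nbhs_nbhs (conj oV fxU))) => y [Ag [z Uz zy]].
by exists (g y) => //; rewrite -zy gK.
Qed.

(** The germs to be continued are those of the continuous right inverses of [f]. *)
Definition lifts_id (s : E -> E) (y : E) : Prop :=
  (\forall z \near y, f (s z) = z) /\ {for y, continuous s}.

Lemma lifts_id_rigid : rigid_germs lifts_id.
Proof.
split=> [s s' x H [fs cs]|s s' x [fs cs] [fs' cs'] e|s s' x [fs cs] [fs' cs'] ne].
- split; first by apply: filterS (filterI H fs) => z [<-].
  have e := nbhs_singleton H.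
  apply/continuous_dist => eps eps0.
  apply: filterS (filterI H ((continuous_dist s x).1 cs _ eps0)) => z [<-].
  by rewrite -e.
- have [U [g [oU Ux oV cg gK]]] := (proj2 f_lh) (s x).
  have Us : \forall z \near x, U (s z) by apply: cs; exact: open_nbhs_nbhs.
  have Us' : \forall z \near x, U (s' z).
    by apply: cs'; apply: open_nbhs_nbhs; rewrite -e.
  apply: filterS (filterI (filterI fs fs') (filterI Us Us')) => z [[h1 h2] [h3 h4]].
  by rewrite -(gK _ h3) -(gK _ h4) h1 h2.
- have d0 : 0 < `|s x - s' x| / 2 by rewrite divr_gt0 // normr_gt0 subr_eq0; apply/eqP.
  apply: filterS (filterI ((continuous_dist s x).1 cs _ d0)
    ((continuous_dist s' x).1 cs' _ d0)) => z [h1 h2] e.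
  have : `|s x - s' x| < `|s x - s' x|.
    rewrite -[X in `|X| < _](subrKA (s z)) (le_lt_trans (ler_normD _ _)) //.
    by rewrite [X in _ < X]splitr ltrD // e distrC.
  by rewrite ltxx.
Qed.

Lemma local_section x : exists U g, [/\ open U, U x, nbhs (f x) (f @` U),
  forall y, (f @` U) y -> lifts_id g y & forall z, U z -> g (f z) = z].
Proof.
have [U [g [oU Ux oV cg gK]]] := (proj2 f_lh) x.
exists U, g; split=> //.
  by apply: open_nbhs_nbhs; split=> //; exists x.
move=> y Uy; split; last exact: cg.
by apply: filterS (open_nbhs_nbhs (conj oV Uy)) => _ [z Uz <-]; rewrite gK.
Qed.

(** Hadamard's argument: along a segment, the lifts of points that converge to [p]
remain in the compact preimage of a neighbourhood of [p], and the local inverse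
of [f] at a cluster point of the lifts continues them beyond [p]. *)
Lemma proper_global_section x0 : nonproper_set f = set0 ->
  exists G, (forall y, lifts_id G y) /\ G (f x0) = x0.
Proof.
move=> S0; have pr y : proper_at f y.
  by apply: contrapT => np; have : nonproper_set f y by []; rewrite S0.
suff [G [lG G0]] : exists G, (forall y, setT y -> lifts_id G y) /\ G (f x0) = x0.
  by exists G; split=> // y; exact: lG.
apply: (starshaped_section lifts_id_rigid openT I).
  have [U [g [oU Ux nU lg gK]]] := local_section x0.
  have [r r0 rU] := near_norm_lt nU.
  by exists r, g; split=> //; [move=> z /rU; exact: lg|exact: gK].
move=> y t _ /andP[t0 t1] sec.
set p := f x0 + t *: (y - f x0).
have [W [pW cW]] := pr p.
pose tn k := t - t / k.+1%:R.
have tn_ok k : 0 <= tn k < t.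
  rewrite /tn subr_ge0 ltrBlDr ltrDl divr_gt0 // andbT ler_pdivrMr // ler_peMr ?(ltW t0) //.
  by rewrite ler1n.
have [xs Hxs] : {xs : nat -> E & forall k, exists r s, [/\ 0 < r,
    forall z, tube (f x0) y (tn k) r z -> lifts_id s z, s (f x0) = x0 &
    s (f x0 + tn k *: (y - f x0)) = xs k]}.
  apply: (@choice _ _ (fun k v => exists r s, [/\ 0 < r,
    forall z, tube (f x0) y (tn k) r z -> lifts_id s z, s (f x0) = x0 &
    s (f x0 + tn k *: (y - f x0)) = v])) => k.
  by have [r [s [r0 ls s0]]] := sec _ (tn_ok k);
    exists (s (f x0 + tn k *: (y - f x0))), r, s.
pose pn k := f x0 + tn k *: (y - f x0).
have tube_end k r : 0 < r -> tube (f x0) y (tn k) r (pn k).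
  move=> r0; exists (tn k); last by rewrite subrr normr0.
  by have /andP[-> _] := tn_ok k; rewrite lexx.
have fxs k : f (xs k) = pn k.
  have [r [s [r0 ls s0 <-]]] := Hxs k.
  by have [H _] := ls _ (tube_end k r r0); have := nbhs_singleton H.
have pn_cvg : pn k @[k --> \oo] --> p.
  have -> : p = f x0 + (t - t * 0) *: (y - f x0) by rewrite mulr0 subr0.
  apply: cvgD; first exact: cvg_cst.
  apply: cvgZl; apply: cvgB; first exact: cvg_cst.
  apply: cvgM; first exact: cvg_cst.
  exact: cvg_harmonic.
have xsK : \forall k \near \oo, (f @^-1` closure W) (xs k).
  have nW : \forall k \near \oo, W (pn k) := pn_cvg _ pW.
  apply: filterS nW => k Wk /=; rewrite fxs.
  exact: subset_closure.
have [z [_ zc]] := cW (xs k @[k --> \oo]) _ xsK.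
have fz : f z = p.
  apply: contrapT => ne.
  have d0 : 0 < `|f z - p| / 2 by rewrite divr_gt0 // normr_gt0 subr_eq0; apply/eqP.
  have n1 := (continuous_dist f z).1 (@local_homeo_continuous z) _ d0.
  have n2 : \forall k \near \oo, `|p - pn k| < `|f z - p| / 2 := pn_cvg _ (near_dist p d0).
  have [_ [[k h2 <-] h1]] : ((xs @` [set k | `|p - pn k| < `|f z - p| / 2])
      `&` [set x | `|f z - f x| < `|f z - p| / 2]) !=set0.
    by apply: zc n1; apply: filterS n2 => k hk /=; exists k.
  move: h1; rewrite /= fxs => h1.
  have : `|f z - p| < `|f z - p|.
    rewrite -[X in `|X| < _](subrKA (pn k)) (le_lt_trans (ler_normD _ _)) //.
    by rewrite [X in _ < X]splitr ltrD // distrC.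
  by rewrite ltxx.
have [U [g [oU Uz nU lg gK]]] := local_section z.
rewrite fz in nU; have [eta eta0 etaU] := near_norm_lt nU.
have n3 : \forall k \near \oo, `|p - pn k| < eta := pn_cvg _ (near_dist p eta0).
have [_ [[k h2 <-] h1]] : ((xs @` [set k | `|p - pn k| < eta]) `&` U) !=set0.
  apply: zc; last exact: open_nbhs_nbhs.
  by apply: filterS n3 => k hk /=; exists k.
exists eta, (tn k); split=> //.
  by rewrite -/(pn k) -/p distrC.
move=> r s r0 ls s0; exists g; split; first by move=> x /etaU; exact: lg.
rewrite -/(pn k) -[X in g X]fxs gK //.
have [r' [s' [r'0 ls' s'0 <-]]] := Hxs k.
have r''0 : 0 < Num.min r r' by rewrite lt_min r0.
have sub r1 : Num.min r r' <= r1 ->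
    tube (f x0) y (tn k) (Num.min r r') `<=` tube (f x0) y (tn k) r1.
  by move=> le x [u uk xu]; exists u => //; exact: lt_le_trans le.
apply: (section_unique lifts_id_rigid (convex_connected (@convex_tube _ _ (f x0) y (tn k)
  (Num.min r r'))) (x0 := f x0)).
- exists 0; first by rewrite lexx; have /andP[] := tn_ok k.
  by rewrite scale0r addr0 subrr normr0.
- by move=> x; move/(sub r' _); rewrite ge_min lexx orbT => /(_ isT)/ls'.
- by move=> x; move/(sub r _); rewrite ge_min lexx => /(_ isT)/ls.
- by rewrite s'0.
- exact: tube_end.
Qed.

(** The right inverse [G] is also a left one, as [G \o f] and the identity are
continuous lifts of [f] along itself that agree at the origin. *)
Lemma proper_local_homeo_bijective : nonproper_set f = set0 -> bijective f.
Proof.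
move=> S0; have [G [lG G0]] := proper_global_section 0 S0.
have GK : cancel G f by move=> y; have [H _] := lG y; have := nbhs_singleton H.
exists G => // x.
have cT : connected [set: E] by apply: convex_connected.
have cGf : continuous (G \o f).
  move=> z; apply: continuous_comp; first exact: local_homeo_continuous.
  by have [] := lG (f z).
suff: forall z, [set: E] z -> G (f z) = z by exact.
apply: (@connected_local_ind _ _ (fun z => G (f z) = z) 0 cT I G0) => {x} x _ Gx; last first.
  have d0 : 0 < `|G (f x) - x| / 2 by rewrite divr_gt0 // normr_gt0 subr_eq0; apply/eqP.
  apply: filterS (filterI ((continuous_dist (G \o f) x).1 (cGf x) _ d0)
     (near_dist x d0)) => z /= [h1 h2] _ e.
  rewrite /= e in h1.
  have : `|G (f x) - x| < `|G (f x) - x|.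
    rewrite -[X in `|X| < _](subrKA z) (le_lt_trans (ler_normD _ _)) //.
    by rewrite [X in _ < X]splitr ltrD // distrC.
  by rewrite ltxx.
have [U [g [oU Ux oV cg gK]]] := (proj2 f_lh) x.
have U1 : \forall z \near x, U (G (f z)).
  by apply: (cGf x); apply: open_nbhs_nbhs; rewrite /= Gx.
apply: filterS (filterI U1 (open_nbhs_nbhs (conj oU Ux))) => z [h1 h2] _.
by rewrite -[LHS]gK // GK gK.
Qed.

End LocalHomeo.

(** * Transport between the levels of a fibration *)

Lemma nbhs_set_type (X : topologicalType) (A : set X) (x : set_type A)
    (N : set (set_type A)) : nbhs x N ->
  exists O : set X, [/\ open O, O (val x) & val @^-1` O `<=` N].
Proof.
rewrite nbhsE => -[B [[C oC CB] Bx] BN]; exists C; split => //.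
  by move: Bx; rewrite -CB.
by move=> y Cy; apply: BN; rewrite -CB.
Qed.

Section Transport.
Context {R : realType} {E : topologicalType}.
Implicit Type g : E -> R.

(** Ehresmann's transport between nearby levels: [tau x t] is the point of level [t]
over the same point of the typical fibre as [x]. *)
Definition transport_near g (e eta : R) (tau : E -> R -> E) : Prop :=
  forall x t, `|g x - e| < eta -> `|t - e| < eta ->
  [/\ g (tau x t) = t, tau x (g x) = x,
      forall s, `|s - e| < eta -> tau (tau x s) t = tau x t &
      {for (x, t), continuous (fun p : E * R => tau p.1 p.2)}].

Definition has_transport g : Prop := forall e, range g e ->
  exists2 eta, 0 < eta & exists tau, transport_near g e eta tau.

(** In the coordinates of a trivialization, transport changes the second component
only. The base is a neighbourhood in the range of [g]; as the range is open, it
contains an interval of levels. *)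
Lemma locally_trivial_transport g : open (range g) ->
  locally_trivial_at_image g -> continuous g -> has_transport g.
Proof.
move=> og [cg lt] gcont e re.
pose e' : set_type (range g) := exist _ e (mem_set re).
have [U [oU Ue' [F [phi [psi [cphi cpsi phiK psiK phig]]]]]] := lt e'.
have [W [oW /= We WU]] := nbhs_set_type (open_nbhs_nbhs (conj oU Ue')).
have nW : nbhs e (W `&` range g) by apply: filterI; apply: open_nbhs_nbhs.
have [eta eta0 etaW] := near_norm_lt nW.
have mkTex (t : R) : `|t - e| < eta -> {y : set_type U | val (val y) = t}.
  move=> /etaW[Wt rt].
  pose yt : set_type (range g) := exist _ t (mem_set rt).
  have Ut : U yt by apply: WU.
  by exists (exist _ yt (mem_set Ut) : set_type U).
pose mkT t (h : `|t - e| < eta) := proj1_sig (mkTex t h).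
have mkTE t h : val (val (mkT t h)) = t by rewrite /mkT; case: (mkTex t h).
have mkX0 x : `|g x - e| < eta ->
    {y : set_type (corestrict_range g @^-1` U) | val y = x}.
  move=> /etaW[Wt rt].
  have Ut : U (corestrict_range g x) by apply: WU.
  have Ux : (corestrict_range g @^-1` U) x by [].
  by exists (exist _ x (mem_set Ux) : set_type (corestrict_range g @^-1` U)).
pose mkX x (h : `|g x - e| < eta) := proj1_sig (mkX0 x h).
have mkXE x h : val (mkX x h) = x by rewrite /mkX; case: (mkX0 x h).
have gphi z : g (val (phi z)) = val (val z.2).
  by have := congr1 (fun y => val (val y)) (phig z).
(* The points of the subspaces that [phi] and [psi] relate carry membership proofs,
   so that [tau] needs default values outside the neighbouring levels. *)
pose tau x t := match pselect (`|g x - e| < eta), pselect (`|t - e| < eta) with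
  | left hx, left ht => val (phi ((psi (mkX x hx)).1, mkT t ht))
  | _, _ => x end.
have tauE x t (hx : `|g x - e| < eta) (ht : `|t - e| < eta) :
    tau x t = val (phi ((psi (mkX x hx)).1, mkT t ht)).
  rewrite /tau; case: pselect => [hx'|//]; case: pselect => [ht'|//].
  by rewrite (bool_irrelevance hx' hx) (bool_irrelevance ht' ht).
have gtau x t : `|g x - e| < eta -> `|t - e| < eta -> g (tau x t) = t.
  by move=> hx ht; rewrite tauE gphi mkTE.
exists eta => //; exists tau => x t hx ht; split.
- exact: gtau.
- rewrite (tauE _ _ hx hx).
  have -> : mkT (g x) hx = (psi (mkX x hx)).2.
    apply: val_inj; apply: val_inj; rewrite mkTE.
    by rewrite -gphi psiK mkXE.
  by rewrite -surjective_pairing psiK mkXE.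
- move=> s hs; have hts : `|g (tau x s) - e| < eta by rewrite gtau.
  rewrite (tauE _ _ hts ht) (tauE _ _ hx ht).
  have -> : mkX (tau x s) hts = phi ((psi (mkX x hx)).1, mkT s hs).
    by apply: val_inj; rewrite mkXE (tauE _ _ hx hs).
  by rewrite phiK.
- move=> N /=; rewrite tauE => nN.
  have cvp : {for ((psi (mkX x hx)).1, mkT t ht), continuous (fun z => val (phi z))}.
    by apply: continuous_comp; [exact: cphi|exact: initial_continuous].
  have : nbhs ((psi (mkX x hx)).1, mkT t ht) ((fun z => val (phi z)) @^-1` N).
    exact: cvp.
  move=> [[N1 N2] /= [nN1 nN2] N12].
  have : nbhs (mkX x hx) ((fun z => (psi z).1) @^-1` N1).
    apply: (@continuous_comp _ _ _ psi fst (mkX x hx)) nN1; first exact: cpsi.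
    exact: cvg_fst.
  move=> /nbhs_set_type[W1 [oW1]]; rewrite mkXE => W1x W1N.
  have [W2' [oW2' W2't W2'N]] := nbhs_set_type nN2.
  have [W2 [oW2 W2t W2N]] := nbhs_set_type (open_nbhs_nbhs (conj oW2' W2't)).
  rewrite mkTE in W2t.
  have nx : \forall z \near x, W1 z /\ `|g z - e| < eta.
    apply: filterI; first exact: open_nbhs_nbhs.
    have d0 : 0 < eta - `|g x - e| by rewrite subr_gt0.
    apply: filterS ((continuous_dist g x).1 (gcont x) _ d0) => z zd.
    rewrite -(subrKA (g x)) (le_lt_trans (ler_normD _ _)) //.
    by move: zd; rewrite distrC ltrBrDr.
  have nt : \forall s \near t, W2 s /\ `|s - e| < eta.
    apply: filterI; first exact: open_nbhs_nbhs.
    have d0 : 0 < eta - `|t - e| by rewrite subr_gt0.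
    apply: filterS (near_dist t d0) => z zd.
    rewrite -(subrKA t) (le_lt_trans (ler_normD _ _)) //.
    by move: zd; rewrite distrC ltrBrDr.
  exists ([set z | W1 z /\ `|g z - e| < eta], [set s | W2 s /\ `|s - e| < eta]) => //.
  move=> [z s] /= [[W1z hz] [W2s hs]]; rewrite (tauE _ _ hz hs).
  apply: (N12 (_, _)); split=> /=.
    by apply: W1N => /=; rewrite mkXE.
  by apply: W2'N; apply: W2N => /=; rewrite mkTE.
Qed.

Lemma has_transportN g : has_transport g -> has_transport (fun x => - g x).
Proof.
move=> H e [x0 _ gx0]; have [|eta eta0 [tau Htau]] := H (- e).
  by exists x0 => //; rewrite -gx0 opprK.
have nn (a b : R) : `|- a - b| = `|a + b| by rewrite -opprD normrN.
exists eta => //; exists (fun x t => tau x (- t)) => x t hx ht.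
have hx' : `|g x - - e| < eta by move: hx; rewrite nn opprK.
have nt s : `|s - e| < eta -> `|- s - - e| < eta by rewrite -opprD normrN.
have [h1 h2 h3 h4] := Htau x (- t) hx' (nt _ ht).
have [_ h2' _ _] := Htau x (g x) hx' hx'.
split; [by rewrite h1 opprK|by rewrite opprK|by move=> s hs; apply: h3; exact: nt|].
apply: (@continuous_comp _ _ _ (fun p : E * R => (p.1, - p.2)) (fun p => tau p.1 p.2)).
  have c1 : (fun p : E * R => p.1) @ (x, t) --> x by exact: cvg_fst.
  have c2 : (fun p : E * R => p.2) @ (x, t) --> t by exact: cvg_snd.
  exact: (cvg_pair c1 (cvgN c2)).
exact: h4.
Qed.

End Transport.

(** * Functions with regular levels *)

Section Regular.
Context {R : realType} {n : nat}.
Notation E := 'rV[R]_n.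
Implicit Type g : E -> R.

(** Points that are far away need not be lowered, nor come back to the cube of size
[rho], in order to reach level [c2]. *)
Definition ascends_far g (c1 c2 : R) : Prop := forall rho, exists rho',
  forall x, rho' < `|x| -> c1 <= g x <= c2 -> exists S,
  [/\ connected S, S x, forall y, S y -> rho < `|y| /\ g x <= g y &
      exists2 y, S y & g y = c2].

Definition joined_in (A : set E) (a b : E) : Prop :=
  exists S, [/\ connected S, S a, S b & S `<=` A].

(** The slack between [d'] and [d] leaves room for connections that only approach
level [d]. *)
Definition superlevels_joined g : Prop := forall d' d a b,
  d' < d -> d <= g a -> d <= g b -> joined_in [set x | d' <= g x] a b.

(** What is needed of a fibration over an interval; only levels above a given one are
concerned, and the levels below are dealt with through the opposite function. *)
Definition regular_upwards g : Prop :=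
  (forall c1 c2, c1 <= c2 -> range g c1 -> range g c2 -> ascends_far g c1 c2) /\
  superlevels_joined g.

(** By induction on the reals along the segment from [c1] to [c2]. *)
Lemma interval_chain (P : R -> R -> Prop) (I : set R) c1 c2 :
  (forall a b c, a <= b -> b <= c -> P a b -> P b c -> P a c) ->
  (forall e, I e -> exists2 eta, 0 < eta & forall a b, a <= b ->
     `|a - e| < eta -> `|b - e| < eta -> P a b) ->
  c1 <= c2 -> (forall t, c1 <= t <= c2 -> I t) -> P c1 c2.
Proof.
move=> Ptr Ploc c12 Ic; pose d := c2 - c1; have d0 : 0 <= d by rewrite subr_ge0.
pose Q s := forall s', 0 <= s' <= s -> P c1 (c1 + s' * d).
suff : Q 1 by move=> /(_ 1); rewrite mul1r /d addrC subrK; apply; rewrite ler01 lexx.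
have loc t : 0 <= t <= 1 -> exists2 eta, 0 < eta & forall s s', s <= s' ->
    `|s - t| < eta -> `|s' - t| < eta -> P (c1 + s * d) (c1 + s' * d).
  move=> /andP[t0 t1]; have [|eta eta0 H] := Ploc (c1 + t * d).
    by apply: Ic; apply/andP; split; rewrite /d in d0 *; nra.
  have d1 : 0 < d + 1 by rewrite ltr_wpDl.
  exists (eta / (d + 1)); first by rewrite divr_gt0.
  have ok s : `|s - t| < eta / (d + 1) -> `|c1 + s * d - (c1 + t * d)| < eta.
    rewrite ltr_pdivlMr // opprD addrACA subrr add0r -mulrBl normrM (ger0_norm d0).
    by apply: le_lt_trans; rewrite ler_wpM2l // lerDl.
  by move=> s s' ss' hs hs'; apply: H; [rewrite lerD2l ler_wpM2r|exact: ok|exact: ok].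
apply: real_induction.
- move=> s'; rewrite -eq_le => /eqP <-; rewrite mul0r addr0.
  have [|eta eta0 H] := loc 0; first by rewrite lexx ler01.
  by have := H 0 0 (lexx _); rewrite mul0r addr0 subrr normr0; apply.
- move=> t t' /andP[t0 tt'] H s' /andP[s0 s1]; apply: H.
  by rewrite s0 (le_trans s1).
move=> t /andP[t0 t1] H; have [|eta eta0 Heta] := loc t; first by rewrite t0.
exists (eta / 2); first by rewrite divr_gt0.
move=> s /andP[s0 st].
pose t' := Num.max 0 (t - eta / 2).
have t't : t' <= t by rewrite ge_max t0 gerBl ltW // divr_gt0.
have t'0 : 0 <= t' by rewrite le_max lexx.
have t'e : `|t' - t| < eta.
  rewrite distrC ger0_norm ?subr_ge0 //.
  have : t - eta / 2 <= t' by rewrite le_max lexx orbT.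
  lra.
have P1 : P c1 (c1 + t' * d).
  have [t00|tn0] := eqVneq t 0.
    have t'00 : t' = 0 by apply/eqP; rewrite eq_le t'0 andbT -t00.
    rewrite t'00; have [|eta' eta'0 H'] := loc 0; first by rewrite lexx ler01.
    by have := H' 0 0 (lexx _); rewrite mul0r addr0 subrr normr0; apply.
  have tpos : 0 < t by rewrite lt_neqAle eq_sym tn0.
  apply: (H t'); last by rewrite t'0 lexx.
  rewrite t'0 /= /t' gt_max tpos gtrBl divr_gt0 //.
have [st'|st'] := leP s t'.
  have [t't0|t'tn] := eqVneq t' t.
    have [t00|tn0] := eqVneq t 0.
      have -> : s = t' by apply/eqP; rewrite eq_le st' t't0 t00.
      exact: P1.
    have tpos : 0 < t by rewrite lt_neqAle eq_sym tn0.
    have : t' < t by rewrite /t' gt_max tpos gtrBl divr_gt0.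
    by rewrite t't0 ltxx.
  have lt' : t' < t by rewrite lt_neqAle t'tn.
  by apply: (H t'); rewrite ?t'0 ?lt' // s0.
apply: Ptr P1 _; first by rewrite lerDl mulr_ge0.
- by rewrite lerD2l ler_wpM2r // ltW.
- apply: Heta => //; first exact: ltW.
  rewrite ltr_norml; apply/andP; split; last by lra.
  by move: t'e; rewrite ltr_norml => /andP[]; lra.
Qed.

Variable g : E -> R.
Hypotheses (g_cont : continuous g) (g_tr : has_transport g).

Lemma ascends_far_trans a b c : a <= b -> b <= c ->
  ascends_far g a b -> ascends_far g b c -> ascends_far g a c.
Proof.
move=> ab bc H1 H2 rho; have [r2 Hr2] := H2 rho.
have [r1 Hr1] := H1 (Num.max rho r2).
exists (Num.max r1 r2) => x; rewrite gt_max => /andP[x1 x2] /andP[ax xc].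
have [bx|xb] := leP b (g x); first by apply: Hr2; rewrite // bx.
have [|S [cS Sx HS [y Sy gy]]] := Hr1 x x1; first by rewrite ax ltW.
have [+ gxy] := HS y Sy; rewrite gt_max => /andP[yr yr2].
have [|S' [cS' S'y HS' [z S'z gz]]] := Hr2 y yr2; first by rewrite gy lexx.
exists (S `|` S'); split.
- by apply: connectedU => //; exists y.
- by left.
- move=> w [/HS[+ ?]|/HS'[? le]]; first by rewrite gt_max => /andP[].
  by split=> //; exact: le_trans le.
- by exists z => //; right.
Qed.

(** The points whose transport meets the cube are themselves transports of points of
a compact set. *)
Lemma ascends_far_local e : range g e -> exists2 eta, 0 < eta &
  forall a b, a <= b -> `|a - e| < eta -> `|b - e| < eta -> ascends_far g a b.
Proof.
move=> re; have [eta eta0 [tau Ht]] := g_tr re.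
exists eta => // a b ab ae be rho.
have between t : a <= t <= b -> `|t - e| < eta.
  move: ae be; rewrite !ltr_norml => /andP[? ?] /andP[? ?] /andP[? ?].
  by apply/andP; split; lra.
pose K := [set y : E | `|y| <= rho] `&` [set y | a <= g y <= b].
have cK : compact K.
  apply: compact_closedI; first exact: compact_cube.
  rewrite (_ : [set y | a <= g y <= b] = [set y | a <= g y] `&` [set y | g y <= b]).
    by apply: closedI; [exact: closed_superlevel|exact: closed_sublevel].
  by apply/seteqP; split=> y /= => [/andP[]|[-> ->]].
pose Q : set (E * R) := K `*` `[a, b]%classic.
have cQ : compact ((fun p : E * R => tau p.1 p.2) @` Q).
  apply: continuous_compact; last by apply: compact_setX => //; exact: segment_compact.
  apply: continuous_in_subspaceT => -[y t] /set_mem[/= [_ yab]].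
  by rewrite in_itv /= => tab; have [] := Ht y t (between _ yab) (between _ tab).
have [M M0 HM] := compact_norm_le cQ.
exists M => x Mx xab; have hx := between _ xab; have /andP[ax xb] := xab.
have bt t : g x <= t <= b -> `|t - e| < eta.
  by move=> /andP[xt tb]; apply: between; rewrite tb (le_trans ax).
have gE t : g x <= t <= b -> g (tau x t) = t.
  by move=> /bt ht; have [] := Ht x t hx ht.
exists [set tau x t | t in `[g x, b]]; split.
- apply: connected_continuous_connected; first exact: segment_connected.
  apply: continuous_in_subspaceT => t /set_mem; rewrite /= in_itv /= => /bt ht.
  have [_ _ _ ct] := Ht x t hx ht.
  apply: (@continuous_comp _ _ _ (fun t : R => (x, t)) (fun p : E * R => tau p.1 p.2)) => //.
  have c1 : (fun=> x) @ t --> x by exact: cvg_cst.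
  have c2 : id @ t --> t by exact: cvg_id.
  exact: (cvg_pair c1 c2).
- exists (g x); first by rewrite /= in_itv /= lexx.
  by have [] := Ht x (g x) hx hx.
- move=> _ [t /= + <-]; rewrite in_itv /= => tx; split; last by rewrite gE //; case/andP: tx.
  rewrite ltNge; apply/negP => yrho; move: Mx; rewrite ltNge => /negP; apply.
  apply: HM; exists (tau x t, g x).
    split; [split|] => //=.
    by rewrite gE //; have /andP[xt ->] := tx; rewrite (le_trans ax).
  have [_ tx2 _ _] := Ht x (g x) hx hx.
  by have [_ _ H _] := Ht x (g x) hx hx; rewrite /= H ?tx2 //; exact: bt.
- exists (tau x b); last by rewrite gE // xb lexx.
  by exists b => //=; rewrite in_itv /= xb lexx.
Qed.

(** A connection above level [c1] can be replaced by one above level [c2]. *)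
Definition pushes_joined (c1 c2 : R) : Prop := forall a b, c2 <= g a -> c2 <= g b ->
  joined_in [set x | c1 <= g x] a b -> joined_in [set x | c2 <= g x] a b.

(** The part of the connection below level [c2] is transported to that level; this
does not move the points of level [c2], so that the map is continuous. *)
Lemma pushes_joined_local e : range g e -> exists2 eta, 0 < eta &
  forall c1 c2, c1 <= c2 -> `|c1 - e| < eta -> `|c2 - e| < eta -> pushes_joined c1 c2.
Proof.
move=> re; have [eta eta0 [tau Ht]] := g_tr re.
exists eta => // c1 c2 c12 e1 e2 a b ga gb [S [cS Sa Sb Sc]].
have between t : c1 <= t <= c2 -> `|t - e| < eta.
  move: e1 e2; rewrite !ltr_norml => /andP[? ?] /andP[? ?] /andP[? ?].
  by apply/andP; split; lra.
pose r x := if g x < c2 then tau x c2 else x.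
have rup x : c2 <= g x -> r x = x by rewrite /r ltNge => ->.
exists (r @` S); split.
- apply: connected_continuous_connected => //.
  apply: continuous_in_subspaceT => x /set_mem /Sc /= gx.
  have ctau : g x <= c2 -> {for x, continuous (fun z => tau z c2)}.
    move=> xc; have [|_ _ _ ct] := Ht x c2 _ e2; first by apply: between; rewrite gx.
    apply: (@continuous_comp _ _ _ (fun z : E => (z, c2)) (fun p : E * R => tau p.1 p.2)) => //.
    have k1 : id @ x --> x by exact: cvg_id.
    have k2 : (fun _ : E => c2 : R) @ x --> (c2 : R) by exact: (@cst_continuous _ _ (c2 : R) x).
    exact: (cvg_pair k1 k2).
  apply/continuous_dist => eps eps0.
  have [lt|gt|eq] := ltgtP (g x) c2.
  + have gx' : 0 < c2 - g x by rewrite subr_gt0.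
    have H1 := (continuous_dist g x).1 (@g_cont x) _ gx'.
    have H2 := (continuous_dist _ x).1 (ctau (ltW lt)) _ eps0.
    apply: filterS (filterI H1 H2) => z [h1 h2]; rewrite /r lt.
    by rewrite (_ : g z < c2) //; move: h1; rewrite ltr_norml => /andP[]; lra.
  + have gx' : 0 < g x - c2 by rewrite subr_gt0.
    have H1 := (continuous_dist g x).1 (@g_cont x) _ gx'.
    apply: filterS (filterI H1 (near_dist x eps0)) => z [h1 h2].
    rewrite !rup // ?ltW //; move: h1; rewrite ltr_norml => /andP[_]; lra.
  + have H2 := (continuous_dist _ x).1 (ctau _) _ eps0.
    rewrite eq lexx in H2; have {}H2 := H2 isT.
    apply: filterS (filterI H2 (near_dist x eps0)) => z [h1 h2].
    rewrite rup ?eq // /r; case: ifP => // _.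
    suff tx : tau x c2 = x by rewrite -{1}tx.
    have hx : `|g x - e| < eta by apply: between; rewrite gx eq lexx.
    by rewrite -eq; have [] := Ht x (g x) hx hx.
- by exists a => //; exact: rup.
- by exists b => //; exact: rup.
- move=> _ [x /Sc /= gx <-]; rewrite /r; case: ltP => // lt.
  by have [|-> //] := Ht x c2 _ e2; apply: between; rewrite gx ltW.
Qed.

Lemma range_interval a b t : range g a -> range g b -> a <= t <= b -> range g t.
Proof.
move=> ra rb tab; have cT : connected [set: E] by apply: convex_connected.
have : connected (range g).
  by apply: connected_continuous_connected cT _; exact: continuous_subspaceT.
by move=> /connected_intervalP iv; exact: iv tab.
Qed.

Lemma segment_min_level a b : exists2 m, range g m &
  joined_in [set x | m <= g x] a b.
Proof.
have cS : compact (segment a b).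
  apply: continuous_compact; last exact: segment_compact.
  by apply: continuous_subspaceT; exact: segment_continuous.
have [||c _ Hc] := @compact_EVT_min _ R g (segment a b) _ cS.
- by exists a; exact: segment_left.
- exact: continuous_subspaceT.
exists (g c); first by exists c.
exists (segment a b); split; [exact: connected_segment|exact: segment_left|exact: segment_right|].
by move=> x sx; apply: Hc; exact: mem_set.
Qed.

Lemma transport_regular : regular_upwards g.
Proof.
split.
  move=> c1 c2 c12 r1 r2; apply: (@interval_chain _ (range g)) => //.
  - exact: ascends_far_trans.
  - exact: ascends_far_local.
  - by move=> t; exact: range_interval.
move=> d' d a b dd da db.
suff [S [cS Sa Sb Sd]] : joined_in [set x | d <= g x] a b.
  by exists S; split=> // x /Sd /= h; exact: le_trans (ltW dd) h.
have [m rm Jm] := segment_min_level a b.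
have [dm|md] := leP d m.
  by have [S [cS Sa Sb Sd]] := Jm; exists S; split=> // x /Sd /=; exact: le_trans.
suff : pushes_joined m d by apply.
apply: (@interval_chain _ (range g)) => //.
- move=> x y z xy yz H1 H2 a' b' za zb J; apply: H2 => //; apply: H1 => //;
  exact: le_trans yz _.
- exact: pushes_joined_local.
- exact: ltW.
- move=> t /andP[mt td]; apply: (@range_interval m (g a)) => //.
  by rewrite mt (le_trans td).
Qed.

End Regular.

(** * Euclidean norm and gradient *)

Section Euclid.
Context {R : realType} {n : nat}.
Implicit Types (u v x : 'rV[R]_n).

Definition dotp u v : R := \sum_i u 0 i * v 0 i.

Lemma dotpC u v : dotp u v = dotp v u.
Proof. by apply: eq_bigr => i _; rewrite mulrC. Qed.

Lemma dotpDl u v x : dotp (u + v) x = dotp u x + dotp v x.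
Proof. by rewrite -big_split /=; apply: eq_bigr => i _; rewrite mxE mulrDl. Qed.

Lemma dotpZl a u v : dotp (a *: u) v = a * dotp u v.
Proof. by rewrite /dotp big_distrr /=; apply: eq_bigr => i _; rewrite mxE mulrA. Qed.

Lemma dotpDr u v x : dotp x (u + v) = dotp x u + dotp x v.
Proof. by rewrite !(dotpC x) dotpDl. Qed.

Lemma dotpZr a u v : dotp u (a *: v) = a * dotp u v.
Proof. by rewrite !(dotpC u) dotpZl. Qed.

Lemma dotp_ge0 u : 0 <= dotp u u.
Proof. by apply: sumr_ge0 => i _; rewrite -expr2 sqr_ge0. Qed.

Lemma enorm_ge0 u : 0 <= enorm u. Proof. exact: sqrtr_ge0. Qed.

Lemma enorm_sqr u : enorm u ^+ 2 = dotp u u.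
Proof.
rewrite /enorm sqr_sqrtr; first by apply: eq_bigr => i _; rewrite expr2.
by apply: sumr_ge0 => i _; rewrite sqr_ge0.
Qed.

Lemma coord_le_enorm u i : `|u 0 i| <= enorm u.
Proof.
rewrite -(@ler_pXn2r _ 2) ?nnegrE ?enorm_ge0 // real_normK ?num_real // enorm_sqr.
rewrite /dotp (bigD1 i) //= -expr2 lerDl; apply: sumr_ge0 => j _.
by rewrite -expr2 sqr_ge0.
Qed.

Lemma norm_le_enorm u : `|u| <= enorm u.
Proof. by apply: row_norm_le; [exact: enorm_ge0|move=> i; exact: coord_le_enorm]. Qed.

Lemma enorm_eq0 u : enorm u = 0 -> u = 0.
Proof.
move=> u0; apply/eqP; rewrite -normr_eq0 eq_le normr_ge0 andbT.
by rewrite -u0 norm_le_enorm.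
Qed.

Lemma enormZ a u : enorm (a *: u) = `|a| * enorm u.
Proof.
apply/eqP; rewrite -(@eqrXn2 _ 2) ?mulr_ge0 ?enorm_ge0 // exprMn !enorm_sqr.
by rewrite real_normK ?num_real // dotpZl dotpZr mulrA expr2.
Qed.

Lemma cauchy_schwarz u v : `|dotp u v| <= enorm u * enorm v.
Proof.
rewrite -(@ler_pXn2r _ 2) ?nnegrE ?mulr_ge0 ?enorm_ge0 //.
rewrite real_normK ?num_real // exprMn !enorm_sqr.
have [v0|vn0] := eqVneq (dotp v v) 0.
  have -> : v = 0 by apply: enorm_eq0; apply/eqP; rewrite -sqrf_eq0 enorm_sqr v0.
  rewrite /dotp big1 ?expr0n ?mulr_ge0 ?dotp_ge0 //.
  by move=> i _; rewrite mxE mulr0.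
have vpos : 0 < dotp v v by rewrite lt_neqAle eq_sym vn0 dotp_ge0.
have := dotp_ge0 (dotp v v *: u + (- dotp u v) *: v).
rewrite dotpDl !dotpDr !dotpZl !dotpZr (dotpC v u).
set a := dotp u u; set b := dotp u v; set c := dotp v v in vpos *.
suff -> : c * (c * a) + c * (- b * b) + (- b * (c * b) + - b * (- b * c)) =
    c * (a * c - b ^+ 2) by rewrite pmulr_rge0 // subr_ge0.
by ring.
Qed.

Lemma enormD u v : enorm (u + v) <= enorm u + enorm v.
Proof.
rewrite -(@ler_pXn2r _ 2) ?nnegrE ?addr_ge0 ?enorm_ge0 //.
rewrite sqrrD !enorm_sqr dotpDl !dotpDr (dotpC v u).
have := le_trans (ler_norm _) (cauchy_schwarz u v); lra.
Qed.

Lemma enormN u : enorm (- u) = enorm u.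
Proof. by rewrite -scaleN1r enormZ normrN normr1 mul1r. Qed.

Lemma enormB_le u v : `|enorm u - enorm v| <= enorm (u - v).
Proof.
have h1 := enormD (u - v) v; have h2 := enormD (v - u) u.
rewrite !subrK -opprB enormN in h1 h2.
by rewrite ler_norml; apply/andP; split; rewrite -?(enormN (u - v)) ?opprB //; lra.
Qed.

Lemma enorm_le_norm u : enorm u <= n%:R * `|u|.
Proof.
rewrite -(@ler_pXn2r _ 2) ?nnegrE ?mulr_ge0 ?enorm_ge0 // enorm_sqr.
apply: (@le_trans _ _ (\sum_(i < n) `|u| ^+ 2)).
  apply: ler_sum => i _; rewrite -expr2 -[leLHS]real_normK ?num_real //.
  by rewrite lerXn2r ?nnegrE // row_norm_coord.
rewrite sumr_const card_ord exprMn -[leLHS]mulr_natl ler_wpM2r ?sqr_ge0 //.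
by rewrite -natrX ler_nat -mulnn; case: (n) => // m; rewrite leq_pmulr.
Qed.

Lemma enorm_continuous : continuous (@enorm R n).
Proof.
move=> x; apply/continuous_dist => e e0.
have n1 : 0 < n%:R + 1 :> R by rewrite ltr_wpDl.
apply: filterS (near_dist x (divr_gt0 e0 n1)) => y xy.
apply: (le_lt_trans (enormB_le _ _)); apply: (le_lt_trans (enorm_le_norm _)).
rewrite ltr_pdivlMr // in xy; apply: le_lt_trans xy.
by rewrite mulrC ler_wpM2l // lerDl.
Qed.

End Euclid.

Section Gradient.
Context {R : realType} {n : nat}.
Notation E := 'rV[R]_n.
Variable g : E -> R.
Hypotheses (g_diff : forall x, differentiable g x)
  (grad_cont : continuous (gradient g)).

Lemma derive_dotp x v : 'D_v g x = dotp (gradient g x) v.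
Proof.
rewrite deriveE // {1}(row_sum_delta v) linear_sum /=; apply: eq_bigr => j _.
by rewrite linearZ /= -deriveE // mxE /partial_derive mulrC.
Qed.

Lemma line_is_derive x v (s : R) :
  is_derive s 1 (fun s : R => g (x + s *: v)) (dotp (gradient g (x + s *: v)) v).
Proof.
have dv : derivable g (x + s *: v) v by exact: diff_derivable.
have E0 : (fun h : R => h^-1 *: (((fun s : R => g (x + s *: v)) \o shift s) (h *: (1 : R^o))
     - g (x + s *: v))) =
   (fun h : R => h^-1 *: ((g \o shift (x + s *: v)) (h *: v) - g (x + s *: v))).
  apply/funext => h; rewrite /= /shift /=; congr (_ *: (g _ - _)).
  by rewrite -[_ *: (1 : R^o)]/(h * 1) mulr1 scalerDl addrCA.
split; first by rewrite /derivable E0.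
by rewrite -derive_dotp /derive E0.
Qed.

Lemma mean_value_line x v (s : R) : 0 < s ->
  exists2 c, 0 < c < s & g (x + s *: v) - g x = s * dotp (gradient g (x + c *: v)) v.
Proof.
move=> s0.
have [|c cs] := MVT s0 (fun t _ => line_is_derive x v t).
  apply: continuous_subspaceT => t; apply: differentiable_continuous.
  by apply/derivable1_diffP; have [] := line_is_derive x v t.
rewrite scale0r addr0 subr0 mulrC => H; by exists c.
Qed.

End Gradient.

(** * Controlled functions *)

Section Arithmetic.
Variable R : realType.
Implicit Types a b s D : R.

Lemma quarter_error s a D : 0 < s -> - (a / 4%:R * a) <= D -> D <= a / 4%:R * a ->
  3%:R / 4%:R * (s * a ^+ 2) <= s * (D + a ^+ 2) <= 5%:R / 4%:R * (s * a ^+ 2).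
Proof.
move=> s0 l1 l2.
have h1 : 0 <= s * (D + a / 4%:R * a) by apply: mulr_ge0; [exact: ltW|lra].
have h2 : 0 <= s * (a / 4%:R * a - D) by apply: mulr_ge0; [exact: ltW|lra].
by rewrite expr2; apply/andP; split; lra.
Qed.

Lemma half_close a b : `|b - a| < b / 2 -> b / 2 < a < 2 * b.
Proof. by rewrite ltr_norml => /andP[? ?]; apply/andP; split; lra. Qed.

Lemma eighth_le a b : b / 2 < a -> b / 8%:R <= a / 4%:R.
Proof. lra. Qed.

Lemma close_succ a b : `|b - a| < 1 -> a < b + 1.
Proof. by rewrite ltr_norml => /andP[? ?]; lra. Qed.

End Arithmetic.

Section Metric.
Context {R : realType} {n : nat}.
Notation E := 'rV[R]_n.
Variable g : E -> R.
Hypotheses (g_diff : forall x, differentiable g x)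
  (grad_cont : continuous (gradient g)) (grad_neq0 : forall x, gradient g x <> 0).

(** A function that tends to infinity and whose slope is at most that of [g] on the
given range of levels: along gradient lines of [g], it varies no more than [g]. *)
Definition controlled (c1 c2 : R) : Prop := exists N : E -> R,
  [/\ continuous N, forall B, exists M, forall x, N x <= B -> `|x| <= M &
      forall x, c1 <= g x <= c2 -> exists2 eta, 0 < eta & forall y z,
        `|y - x| < eta -> `|z - x| < eta ->
        `|N y - N z| <= enorm (gradient g y) * enorm (y - z)].

Let G x := enorm (gradient g x).

Let g_cont : continuous g.
Proof. by move=> x; exact: differentiable_continuous. Qed.

Lemma gradient_norm_gt0 x : 0 < G x.
Proof.
rewrite lt_neqAle enorm_ge0 andbT eq_sym; apply/eqP => /enorm_eq0.
exact: grad_neq0.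
Qed.

Lemma gradient_norm_continuous : continuous G.
Proof.
move=> x; apply: continuous_comp; first exact: grad_cont.
exact: enorm_continuous.
Qed.

Lemma compact_uniform (K : set E) (P : E -> R -> Prop) : compact K ->
  (forall x0, K x0 -> exists2 eta, 0 < eta & forall x s, `|x - x0| < eta ->
     0 <= s < eta -> P x s) ->
  exists2 eta, 0 < eta & forall x s, K x -> 0 <= s < eta -> P x s.
Proof.
move=> /compact_near_coveringP cK HP.
have H : \forall i \near (0 : R)^'+, K `<=` (fun x => forall s, 0 <= s < i -> P x s).
  apply: cK => x Kx; have [eta eta0 H] := HP x Kx.
  exists ([set z | `|x - z| < eta], [set i | i < eta]) => /=.
    by split; [exact: (near_dist x eta0)|exact: nbhs_right_lt].
  move=> [z i] /= [zx ie] s /andP[s0 si]; apply: H; first by rewrite distrC.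
  by rewrite s0 (lt_trans si).
have [eta [He eta0]] := filter_ex (filterI H (nbhs_right_gt (0 : R))).
by exists eta => // x s Kx hs; apply: He hs.
Qed.

(** To first order the increment is [s * G x ^+ 2], and by continuity the gradient
changes by less than a quarter of its norm along a short step. *)
Lemma gradient_step x0 : exists2 eta, 0 < eta & forall x s, `|x - x0| < eta ->
  0 <= s < eta ->
  3%:R / 4%:R * (s * G x ^+ 2) <= g (x + s *: gradient g x) - g x <= 5%:R / 4%:R * (s * G x ^+ 2).
Proof.
have G0 := gradient_norm_gt0 x0.
have n1 : 0 < n%:R + 1 :> R by rewrite ltr_wpDl.
have [e e0 eE] : exists2 e, 0 < e & (n%:R + 1) * (2 * e) = G x0 / 8%:R.
  exists (G x0 / 16%:R / (n%:R + 1)); first by rewrite !divr_gt0.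
  move: n1 (G x0) => + a; move: (n%:R + 1) => b b0.
  by field; rewrite gt_eqF.
have [eta eta0 Heta] := near_norm_lt ((continuous_dist _ x0).1 (@grad_cont x0) e e0).
have G2 : 0 < G x0 / 2 by rewrite divr_gt0.
have [eta2 eta20 Heta2] :=
  near_norm_lt ((continuous_dist G x0).1 (@gradient_norm_continuous x0) _ G2).
have [eta3 eta30 eta3E] : exists2 eta3, 0 < eta3 & eta3 * (2 * G x0) = eta / 2.
  exists (eta / 2 / (2 * G x0)); first by rewrite !divr_gt0 // mulr_gt0.
  by rewrite divfK // gt_eqF // mulr_gt0.
exists (Num.min (eta / 2) (Num.min eta2 eta3)).
  by rewrite !lt_min eta20 eta30 divr_gt0.
move=> x s; rewrite !lt_min => /and3P[x1 x2 _] /andP[s0 /and3P[_ _ s3]].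
have /andP[Gl Gu] : G x0 / 2 < G x < 2 * G x0.
  exact: half_close (Heta2 x x2).
move: s0; rewrite le_eqVlt => /orP[/eqP <-|s0].
  by rewrite scale0r addr0 subrr mul0r !mulr0 lexx.
have [c /andP[c0 cs] ->] := mean_value_line g_diff x (gradient g x) s0.
set y := x + c *: gradient g x.
have xy : `|y - x| < eta / 2.
  rewrite /y [x + _]addrC addrK normrZ (gtr0_norm c0).
  have h1 : `|gradient g x| < 2 * G x0 := le_lt_trans (norm_le_enorm _) Gu.
  have h2 : c * (2 * G x0) < eta / 2.
    by rewrite -eta3E ltr_pM2r; [exact: lt_trans cs s3|rewrite mulr_gt0].
  by apply: le_lt_trans h2; rewrite ler_wpM2l ?ltW.
have yx0 : `|y - x0| < eta.
  by rewrite -(subrKA x) (le_lt_trans (ler_normD _ _)) // [eta]splitr ltrD.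
have xx0 : `|x - x0| < eta by apply: lt_trans x1 _; rewrite ltr_pdivrMr // ltr_pMr // ltr1n.
have dgrad : enorm (gradient g y - gradient g x) <= G x / 4%:R.
  have h1 := Heta _ yx0; have h2 := Heta _ xx0.
  have h3 : `|gradient g y - gradient g x| < 2 * e.
    rewrite -(subrKA (gradient g x0)) (le_lt_trans (ler_normD _ _)) //.
    rewrite mulr_natl mulr2n; apply: ltrD; last exact: h2.
    by rewrite distrC; exact: h1.
  apply: le_trans (enorm_le_norm _) _.
  apply: (@le_trans _ _ ((n%:R + 1) * (2 * e))).
    by apply: ler_pM => //; [rewrite lerDl|exact: ltW].
  by rewrite eE; exact: eighth_le.
have -> : dotp (gradient g y) (gradient g x) =
    dotp (gradient g y - gradient g x) (gradient g x) + G x ^+ 2.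
  by rewrite /G enorm_sqr -dotpDl subrK.
have := le_trans (cauchy_schwarz (gradient g y - gradient g x) (gradient g x))
  (ler_wpM2r (enorm_ge0 _) dgrad).
rewrite -/(G x) ler_norml => /andP[].
set D := dotp _ _ => l1 l2.
exact: quarter_error.
Qed.

Lemma controlled_step c1 c2 (N : E -> R) x0 :
  (forall x, c1 <= g x <= c2 -> exists2 eta, 0 < eta & forall y z,
        `|y - x| < eta -> `|z - x| < eta ->
        `|N y - N z| <= enorm (gradient g y) * enorm (y - z)) ->
  c1 <= g x0 <= c2 -> exists2 eta, 0 < eta & forall x s, `|x - x0| < eta ->
  0 <= s < eta -> `|N x - N (x + s *: gradient g x)| <= s * G x ^+ 2.
Proof.
move=> HN gx0; have [eta eta0 H] := HN x0 gx0.
have [eta2 eta20 Heta2] :=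
  near_norm_lt ((continuous_dist G x0).1 (@gradient_norm_continuous x0) _ ltr01).
pose M := G x0 + 1; have M0 : 0 < M by rewrite ltr_wpDl // ltW // gradient_norm_gt0.
exists (Num.min (eta / 2) (Num.min eta2 (eta / 2 / M))).
  by rewrite !lt_min eta20 !divr_gt0.
move=> x s; rewrite !lt_min => /and3P[x1 x2 _] /andP[s0 /and3P[_ _ s3]].
have GM : G x < M.
  exact: close_succ (Heta2 x x2).
have xx0 : `|x - x0| < eta by apply: lt_trans x1 _; rewrite ltr_pdivrMr // ltr_pMr // ltr1n.
apply: le_trans (H x (x + s *: gradient g x) xx0 _) _.
  rewrite addrAC (le_lt_trans (ler_normD _ _)) // [eta]splitr ltr_leD //.
  rewrite normrZ (ger0_norm s0).
  have h1 : `|gradient g x| <= M := le_trans (norm_le_enorm _) (ltW GM).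
  have h2 : s * M < eta / 2 by rewrite -ltr_pdivlMr.
  by apply: ltW; apply: le_lt_trans h2; rewrite ler_wpM2l.
rewrite opprD addrA subrr add0r enormN enormZ (ger0_norm s0) -/(G x).
by rewrite mulrCA expr2.
Qed.

End Metric.

Section Arithmetic.
Variable R : realType.
Implicit Types a b c d s t N : R.

Lemma penalty_gain (q N N' N0 a b : R) : 0 < q -> 3%:R / 4%:R * q <= b - a ->
  `|N - N'| <= q -> a - 1 / 2 * `|N - N0| < b - 1 / 2 * `|N' - N0|.
Proof.
move=> q0 ab NN'; have : `|N' - N0| <= `|N - N0| + q.
  have -> : N' - N0 = (N - N0) + (N' - N) by ring.
  by apply: le_trans (ler_normD _ _) _; rewrite lerD2l distrC.
move: (`|N' - N0|) (`|N - N0|) => u v; lra.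
Qed.

Lemma push_region (g g' N N' B q c d : R) : 0 <= q ->
  3%:R / 4%:R * q <= g' - g -> `|N - N'| <= q -> g' <= d -> g <= d ->
  1 / 2 * Num.max 0 (N - B) <= Num.min g d - c ->
  1 / 2 * Num.max 0 (N' - B) <= Num.min g' d - c.
Proof.
move=> q0 gg NN g'd gd; rewrite (min_idPl gd) (min_idPl g'd) => H.
have : Num.max 0 (N' - B) <= Num.max 0 (N - B) + q.
  rewrite ge_max addr_ge0 ?le_max ?lexx //=.
  have h1 : N - B <= Num.max 0 (N - B) by rewrite le_max lexx orbT.
  by move: NN; rewrite distrC ler_norml => /andP[_]; move: h1; move: (Num.max _ _) => m; lra.
by move: H; move: (Num.max 0 (N - B)) (Num.max 0 (N' - B)) => m m'; lra.
Qed.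

Lemma max0_lip a b : `|Num.max 0 a - Num.max 0 b| <= `|a - b|.
Proof.
have h1 := ler_norm (a - b); have h2 := ler_norm (b - a); rewrite distrC in h2.
rewrite /Num.max; case: ltP => ha; case: ltP => hb; rewrite ler_norml;
by apply/andP; split; lra.
Qed.

Lemma small_push (h d t c u v w : R) : 0 <= d - t -> h * (5%:R / 4%:R) * u <= 1 ->
  0 <= h -> 0 <= v <= u -> 3%:R / 4%:R * (h * (d - t) * u) <= w - t ->
  w - t <= 5%:R / 4%:R * (h * (d - t) * u) ->
  w <= d /\ d - w <= (1 - 3%:R / 4%:R * (h * v)) * (d - t).
Proof.
move=> dt h1 h0 /andP[v0 vu] lo up; split.
  have : 0 <= (1 - h * (5%:R / 4%:R) * u) * (d - t) by rewrite mulr_ge0 // subr_ge0.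
  by move: up; lra.
have : 0 <= h * (u - v) * (d - t) by rewrite !mulr_ge0 // subr_ge0.
by move: lo; lra.
Qed.

Lemma region_bound (N B m g d c : R) : N - B <= m -> 1 / 2 * m <= g - c -> g <= d ->
  N <= B + 2 * (d - c).
Proof. by move=> *; lra. Qed.

Lemma small_step (l e M : R) : 0 <= l -> 0 < e -> 0 < M ->
  exists2 h, 0 < h & h * l < e /\ h * (5%:R / 4%:R) * M <= 1.
Proof.
move=> l0 e0 M0; have l1 : 0 < l + 1 by rewrite ltr_wpDl.
pose h := Num.min (e / (l + 1)) (4%:R / 5%:R / M).
have h0 : 0 < h by rewrite lt_min !divr_gt0.
exists h => //; split.
  have : h * (l + 1) <= e by rewrite -ler_pdivlMr // ge_min lexx.
  by rewrite mulrDr mulr1; apply: lt_le_trans; rewrite ltrDl.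
have : h * M <= 4%:R / 5%:R by rewrite -ler_pdivlMr // ge_min lexx orbT.
by rewrite mulrAC; move: (h * M) => y; lra.
Qed.

Lemma contraction_rate (h u M : R) : 0 < h * u -> h * u <= h * M ->
  h * (5%:R / 4%:R) * M <= 1 -> 0 <= 1 - 3%:R / 4%:R * (h * u) < 1.
Proof. by move=> a b c; apply/andP; split; lra. Qed.

Lemma below_gap (d g m k d' : R) : d - g <= m -> m <= k -> k < d - d' -> d' <= g.
Proof. by move=> *; lra. Qed.

Lemma far_penalty a b c d u : a <= d -> c <= b -> 2 * (d - c) < u -> a - 1 / 2 * u <= b.
Proof. by move=> *; lra. Qed.
End Arithmetic.

Section MetricRegular.
Context {R : realType} {n : nat}.
Notation E := 'rV[R]_n.
Variable g : E -> R.
Hypotheses (g_diff : forall x, differentiable g x)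
  (grad_cont : continuous (gradient g)) (grad_neq0 : forall x, gradient g x <> 0).
Let G x := enorm (gradient g x).

Let g_cont : continuous g.
Proof. by move=> x; exact: differentiable_continuous. Qed.

Lemma continuous_bounded_ball (h : E -> R) (r : R) : continuous h ->
  exists2 M, 0 < M & forall x, `|x| <= r -> h x <= M.
Proof.
move=> ch; have cB := @compact_cube R n r.
have [|M M0 HM] := @compact_norm_le R R (h @` [set x : E | `|x| <= r]).
  by apply: continuous_compact cB; exact: continuous_subspaceT.
exists M => // x xr; apply: le_trans (ler_norm _) _.
by apply: HM; exists x.
Qed.

(** Let [S] be the component of [x0] in the set of points between the level of [x0]
and [c2] that are away from the cube. The height [g - |N - N x0| / 2], penalised
in order to have a maximum on [S], increases along short gradient steps; so its
maximum is at level [c2]. *)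
Lemma controlled_ascends c1 c2 : controlled g c1 c2 -> ascends_far g c1 c2.
Proof.
move=> [N [cN pN sN]] rho.
have [M M0 HM] := continuous_bounded_ball (rho + 1) cN.
have [rho' Hrho'] := pN (M + 2 * (c2 - c1)).
exists rho' => x0 x0far /andP[c1x0 x0c2].
have N0 : M + 2 * (c2 - c1) < N x0.
  by rewrite ltNge; apply/negP => /Hrho'; rewrite leNgt x0far.
have c12 : c1 <= c2 := le_trans c1x0 x0c2.
pose Z := [set y : E | g x0 <= g y] `&` [set y | g y <= c2] `&` [set y | rho + 1 <= `|y|].
have far_out y : M < N y -> rho + 1 < `|y|.
  by move=> My; rewrite ltNge; apply/negP => /HM; rewrite leNgt My.
have x0M : M < N x0.
  by apply: le_lt_trans N0; rewrite lerDl mulr_ge0 // subr_ge0.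
have Zx0 : Z x0 by split; [split=> //=|exact/ltW/far_out].
have cZ : closed Z.
  apply: closedI; first apply: closedI.
  - exact: closed_superlevel.
  - exact: closed_sublevel.
  - by apply: closed_superlevel; exact: norm_continuous.
pose S := connected_component Z x0.
have Sx0 : S x0 by exact: connected_component_refl.
have cS : closed S by exact: component_closed.
have SZ : S `<=` Z by exact: connected_component_sub.
pose Psi y := g y - 1 / 2 * `|N y - N x0|.
have cPsi : continuous Psi.
  by apply: continuous_sub_scale => //; exact: continuous_dist_to.
(* Outside this compact set the penalty exceeds the gain of height. *)
pose K := S `&` [set y | `|N y - N x0| <= 2 * (c2 - c1)].
have cK : compact K.
  have [MK HMK] := pN (N x0 + 2 * (c2 - c1)).
  apply: (@compact_rV _ _ _ MK).
    apply: closedI => //.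
    by apply: closed_sublevel; exact: continuous_dist_to.
  by move=> y [_ /=]; rewrite ler_distl => /andP[_ H]; exact: HMK.
have K0 : K !=set0.
  by exists x0; split=> //=; rewrite subrr normr0 mulr_ge0 // subr_ge0.
have [y yK Hy] := compact_EVT_max K0 cK (continuous_subspaceT cPsi).
have [Sy Ny] := set_mem yK.
have maxS z : S z -> Psi z <= Psi y.
  move=> Sz; have [le|lt] := leP `|N z - N x0| (2 * (c2 - c1)).
    by apply: Hy; apply: mem_set.
  apply: (@le_trans _ _ (Psi x0)); last first.
    by apply: Hy; apply: mem_set; split=> //=; rewrite subrr normr0 mulr_ge0 // subr_ge0.
  rewrite /Psi subrr normr0 mulr0 subr0; have [[_ /= zc2] _] := SZ _ Sz.
  exact: far_penalty zc2 c1x0 lt.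
have [[/= xy yc2] yfar] := SZ _ Sy.
have yM : M < N y.
  move: Ny; rewrite /= ler_distl => /andP[H _].
  by apply: lt_le_trans H; rewrite ltrBrDr.
exists S; split=> //; first exact: component_connected.
  move=> z /SZ[[/= xz _] zfar]; split=> //.
  by apply: lt_le_trans zfar; rewrite ltrDl.
exists y => //; apply: contrapT => /eqP yn.
have ylt : g y < c2 by rewrite lt_neqAle yn.
have wy : c1 <= g y <= c2 by rewrite (le_trans c1x0).
have [e1 e10 He1] := gradient_step g_diff grad_cont grad_neq0 y.
have [e2 e20 He2] := controlled_step grad_cont grad_neq0 sN wy.
have G0 : 0 < G y := gradient_norm_gt0 grad_neq0 y.
have line_cont : continuous (fun s : R => y + s *: gradient g y).
  move=> s; apply: cvgD; first exact: cvg_cst.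
  by apply: cvgZl; exact: cvg_id.
have [e3 e30 He3] : exists2 e3, 0 < e3 & forall s, 0 <= s < e3 ->
    rho + 1 <= `|y + s *: gradient g y| /\ g (y + s *: gradient g y) <= c2.
  have nA : \forall z \near y, M < N z /\ g z < c2.
    have d1 : 0 < N y - M by rewrite subr_gt0.
    have d2 : 0 < c2 - g y by rewrite subr_gt0.
    apply: filterS (filterI ((continuous_dist N y).1 (@cN y) _ d1)
      ((continuous_dist g y).1 (@g_cont y) _ d2)) => z [+ +].
    rewrite !ltr_norml => /andP[_ h1] /andP[h2 _]; split.
      by rewrite ltrD2l ltrN2 in h1.
    by move: h2; rewrite opprB ltrD2l ltrN2.
  have nA0 : nbhs (y + (0 : R) *: gradient g y) [set z | M < N z /\ g z < c2].
    by rewrite scale0r addr0.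
  have nA1 : \forall s \near (0 : R), M < N (y + s *: gradient g y) /\
    g (y + s *: gradient g y) < c2 by exact: (@line_cont 0 _ nA0).
  have [e3 e30 H] := near_norm_lt nA1.
  exists e3 => // s /andP[s0 s3].
  have [|h1 h2] := H s; first by rewrite subr0 ger0_norm.
  by split; [exact/ltW/far_out|exact: ltW].
pose e := Num.min e1 (Num.min e2 e3) / 2.
have m0 : 0 < Num.min e1 (Num.min e2 e3) by rewrite !lt_min e10 e20.
have e0 : 0 < e by rewrite divr_gt0.
have em : e < Num.min e1 (Num.min e2 e3) by rewrite ltr_pdivrMr // ltr_pMr // ltr1n.
move: (em); rewrite !lt_min => /and3P[ee1 ee2 ee3].
have yy r : 0 < r -> `|y - y| < r by rewrite subrr normr0.
have seg s : 0 <= s <= e -> Z (y + s *: gradient g y).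
  move=> /andP[s0 se].
  have h1 : 0 <= s < e1 by rewrite s0 (le_lt_trans se).
  have h3 : 0 <= s < e3 by rewrite s0 (le_lt_trans se).
  have [f1 f2] := He3 s h3; split=> //; split=> //=.
  have /andP[h _] := He1 y s (yy _ e10) h1.
  apply: le_trans xy _; rewrite -subr_ge0; apply: le_trans h.
  by rewrite mulr_ge0 // mulr_ge0 // sqr_ge0.
have Sye : S (y + e *: gradient g y).
  have c : connected [set y + s *: gradient g y | s in `[0, e]].
    apply: connected_continuous_connected; first exact: segment_connected.
    exact: continuous_subspaceT.
  apply: (connected_component_trans Sy).
  apply: (connected_component_max _ _ c).
  - by exists 0; rewrite ?scale0r ?addr0 //= in_itv /= lexx ltW.
  - by move=> _ [s + <-]; rewrite /= in_itv /=; exact: seg.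
  - by exists e => //=; rewrite in_itv /= lexx ltW.
have := maxS _ Sye; rewrite leNgt => /negP; apply.
have /andP[h1 _] := He1 y e (yy _ e10) (introT andP (conj (ltW e0) ee1)).
have h2 := He2 y e (yy _ e20) (introT andP (conj (ltW e0) ee2)).
rewrite /Psi; apply: (penalty_gain (N x0) _ h1 h2).
by rewrite mulr_gt0 // exprn_gt0.
Qed.

Lemma continuous_max0 (T : topologicalType) (h : T -> R) :
  continuous h -> continuous (fun y => Num.max 0 (h y)).
Proof.
move=> ch y; apply/continuous_dist => e e0.
apply: filterS ((continuous_dist h y).1 (@ch y) e e0) => z.
exact: le_lt_trans (max0_lip _ _).
Qed.

Lemma continuous_min_cst (T : topologicalType) (h : T -> R) d :
  continuous h -> continuous (fun y => Num.min (h y) d).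
Proof.
move=> ch; have -> : (fun y => Num.min (h y) d) = (fun y => d - 1 * Num.max 0 (d - h y)).
  apply/funext => y; rewrite mul1r /Num.min /Num.max subr_gt0.
  by case: ltP => _; rewrite ?subr0 // opprB addrC subrK.
apply: continuous_sub_scale; first exact: cst_continuous.
by apply: continuous_max0; exact: continuous_cst_sub.
Qed.

(** The region [W], bounded below level [d], is invariant under short gradient steps,
which make the distance to level [d] decrease geometrically there. Iterating them
pushes the segment from [a] to [b] close to that level and fixes its end points. *)
Lemma controlled_joined : (forall c1 c2, controlled g c1 c2) -> superlevels_joined g.
Proof.
move=> ctr d' d a b dd da db.
have cS : compact (segment a b).
  apply: continuous_compact; last exact: segment_compact.
  by apply: continuous_subspaceT; exact: segment_continuous.
have S0 : segment a b !=set0 by exists a; exact: segment_left.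
have [x0 _ Hx0] := compact_EVT_min S0 cS (continuous_subspaceT g_cont).
pose c := Num.min (g x0) d.
have cd : c <= d by rewrite ge_min lexx orbT.
have [N [cN pN sN]] := ctr c d.
have [x1 _ Hx1] := compact_EVT_max S0 cS (continuous_subspaceT cN).
pose B := N x1.
(* On the segment the penalty vanishes, and a gradient step increases the penalty by
   less than the height. *)
pose pen x := 1 / 2 * Num.max 0 (N x - B).
pose W := [set x | pen x <= Num.min (g x) d - c].
have pen0 x : 0 <= pen x by rewrite mulr_ge0 // le_max lexx.
have Wc x : W x -> c <= g x.
  move=> Wx; have := le_trans (pen0 x) Wx; rewrite subr_ge0 => h.
  by apply: le_trans h _; rewrite ge_min lexx.
have WN x : W x -> N x <= B + 2 * (d - c).
  move=> Wx; have h1 : N x - B <= Num.max 0 (N x - B) by rewrite le_max lexx orbT.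
  have h2 : Num.min (g x) d <= d by rewrite ge_min lexx orbT.
  exact: region_bound h1 Wx h2.
have cW : closed W.
  have -> : W = [set x | 0 <= (Num.min (g x) d - 1 * c) - 1 / 2 * Num.max 0 (N x - B)].
    by apply/funext => x; rewrite /W /mkset mul1r subr_ge0.
  apply: closed_superlevel; apply: continuous_sub_scale.
    apply: continuous_sub_scale; [exact: continuous_min_cst|exact: cst_continuous].
  by apply: continuous_max0; exact: continuous_sub_cst.
pose K := W `&` [set x | g x <= d].
have cK : compact K.
  have [M HM] := pN (B + 2 * (d - c)).
  apply: (@compact_rV _ _ _ M); first by apply: closedI => //; exact: closed_sublevel.
  by move=> x [/WN] /HM.
have Kw x : K x -> c <= g x <= d by move=> [/Wc -> /= ->].
have [e1 e10 He1] := compact_uniform cK (fun x _ => gradient_step g_diff grad_cont grad_neq0 x).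
have [e2 e20 He2] := compact_uniform cK (fun x Kx =>
  controlled_step grad_cont grad_neq0 sN (Kw x Kx)).
have cG : continuous G by exact: gradient_norm_continuous.
have [M M0 HM] : exists2 M, 0 < M & forall x, K x -> G x <= M.
  have [|M M0 HM] := @compact_norm_le R R (G @` K).
    by apply: continuous_compact cK; exact: continuous_subspaceT.
  by exists M => // x Kx; apply: le_trans (ler_norm _) (HM _ _); exists x.
have [de [de0 deM Hde]] : exists de, [/\ 0 < de, de <= M & forall x, K x -> de <= G x].
  have [K0|/forallNP K0] := pselect (K !=set0); last first.
    by exists M; split=> // x /K0.
  have [z _ Hz] := compact_EVT_min K0 cK (continuous_subspaceT cG).
  exists (Num.min (G z) M); split.
  - by rewrite lt_min M0 andbT; exact: gradient_norm_gt0.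
  - by rewrite ge_min lexx orbT.
  - by move=> x Kx; rewrite ge_min; apply/orP; left; apply: Hz; exact: mem_set.
have [h h0 [h1 h2]] : exists2 h, 0 < h & h * (d - c) < Num.min e1 e2 /\
    h * (5%:R / 4%:R) * M ^+ 2 <= 1.
  by apply: small_step; rewrite ?lt_min ?e10 ?exprn_gt0 // subr_ge0.
pose F x := x + (h * Num.max 0 (d - g x)) *: gradient g x.
have cF : continuous F.
  apply: continuous_displacement => //; last by move=> x; exact: cvg_id.
  by apply: continuous_max0; exact: continuous_cst_sub.
have Ffix x : d <= g x -> F x = x.
  move=> dx; rewrite /F (_ : Num.max 0 (d - g x) = 0) ?mulr0 ?scale0r ?addr0 //.
  by apply/max_idPl; rewrite subr_le0.
pose q := 1 - 3%:R / 4%:R * (h * de ^+ 2).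
have FW x : W x -> W (F x) /\ Num.max 0 (d - g (F x)) <= q * Num.max 0 (d - g x).
  move=> Wx; have [dx|xd] := leP d (g x).
    by rewrite Ffix // (_ : Num.max 0 _ = 0) ?mulr0 //; apply/max_idPl; rewrite subr_le0.
  have Kx : K x by split=> //=; exact: ltW.
  have dx0 : 0 <= d - g x by rewrite subr_ge0 ltW.
  have mE : Num.max 0 (d - g x) = d - g x by apply/max_idPr.
  rewrite /F mE; set s := h * (d - g x).
  have s0 : 0 <= s by rewrite mulr_ge0 // ltW.
  have se : s < Num.min e1 e2.
    by apply: le_lt_trans h1; apply: ler_wpM2l; [exact: ltW|apply: lerB; [by []|exact: Wc]].
  move: se; rewrite lt_min => /andP[se1 se2].
  have /andP[lo up] := He1 x s Kx (introT andP (conj s0 se1)).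
  have Nst := He2 x s Kx (introT andP (conj s0 se2)).
  have GM2 : G x ^+ 2 <= M ^+ 2 by rewrite lerXn2r ?nnegrE ?enorm_ge0 ?(ltW M0) ?HM.
  have dG2 : de ^+ 2 <= G x ^+ 2 by rewrite lerXn2r ?nnegrE ?enorm_ge0 ?(ltW de0) ?Hde.
  have h2G : h * (5%:R / 4%:R) * G x ^+ 2 <= 1.
    by apply: le_trans h2; rewrite ler_wpM2l // mulr_ge0 // ltW.
  have [gd qd] := small_push c dx0 h2G (ltW h0)
    (introT andP (conj (sqr_ge0 de) dG2)) lo up.
  split.
    apply: (push_region _ lo Nst gd (ltW xd) Wx).
    by rewrite mulr_ge0 // sqr_ge0.
  by rewrite ge_max qd andbT; apply: le_trans qd; rewrite subr_ge0.
have /andP[q0 q1] : 0 <= q < 1.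
  have hd : 0 < h * de ^+ 2 by rewrite mulr_gt0 // exprn_gt0.
  have hM : h * de ^+ 2 <= h * M ^+ 2.
    apply: ler_wpM2l; first exact: ltW.
    by rewrite lerXn2r ?nnegrE // ltW.
  exact: contraction_rate hd hM h2.
suff itF k : exists S, [/\ connected S, S a, S b & forall x, S x -> W x /\
    Num.max 0 (d - g x) <= q ^+ k * (d - c)].
  have qq : `|q| < 1 by rewrite ger0_norm.
  have d1 : 0 < d - c + 1 by rewrite ltr_wpDl // subr_ge0.
  have dd1 : 0 < (d - d') / (d - c + 1) by rewrite divr_gt0 // subr_gt0.
  have [k _ Hk] := (@cvgrPdist_lt _ _ _ _ _ _ _).1 (cvg_expr qq) _ dd1.
  have [S [conS Sa Sb HS]] := itF k; exists S; split=> // x /HS[_ le].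
  have qk : q ^+ k * (d - c) < d - d'.
    have := Hk k (leqnn k); rewrite /= sub0r normrN ger0_norm ?exprn_ge0 //.
    rewrite ltr_pdivlMr //; apply: le_lt_trans.
    by rewrite ler_wpM2l ?exprn_ge0 // lerDl.
  have : d - g x <= Num.max 0 (d - g x) by rewrite le_max lexx orbT.
  by move=> h3; exact: below_gap h3 le qk.
elim: k => [|k [S [conS Sa Sb HS]]].
  exists (segment a b); split; [exact: connected_segment|exact: segment_left|
    exact: segment_right|].
  move=> x sx; have gx : g x0 <= g x by apply: Hx0; exact: mem_set.
  have Nx : N x <= B by apply: Hx1; exact: mem_set.
  have cx : c <= g x by apply: le_trans gx; rewrite ge_min lexx.
  split; last by rewrite expr0 mul1r ge_max subr_ge0 cd /= lerB.
  rewrite /W /= /pen (_ : Num.max 0 _ = 0); last by apply/max_idPl; rewrite subr_le0.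
  by rewrite mulr0 subr_ge0 le_min cx.
exists (F @` S); split.
- by apply: connected_continuous_connected => //; exact: continuous_subspaceT.
- by exists a => //; exact: Ffix.
- by exists b => //; exact: Ffix.
- move=> _ [x Sx <-]; have [Wx le] := HS x Sx; have [WF leF] := FW x Wx.
  split=> //; apply: le_trans leF _.
  by rewrite exprS -mulrA ler_wpM2l.
Qed.

Lemma controlled_regular : (forall c1 c2, controlled g c1 c2) -> regular_upwards g.
Proof.
move=> ctr; split; last exact: controlled_joined.
by move=> c1 c2 _ _ _; exact: controlled_ascends.
Qed.

End MetricRegular.

(** * Malgrange and Palais-Smale conditions *)

Section Arithmetic.
Variable R : realType.
Implicit Types a b c : R.

Lemma slope_arith (M1 M2 r1 r2 m Gx Gy e : R) : 0 <= r2 - r1 <= e -> 0 <= e ->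
  0 <= M2 - M1 <= 2 * m * (r2 - r1) -> m <= Gx -> 0 <= Gx -> Gx / 2 < Gy ->
  `|1 / 4%:R * M2 - 1 / 4%:R * M1| <= Gy * e.
Proof.
move=> /andP[d0 de] e0 /andP[h0 h1] mG G0 GG.
rewrite -mulrBr ger0_norm ?mulr_ge0 //.
have a1 : m * (r2 - r1) <= Gx * (r2 - r1) by rewrite ler_wpM2r.
have a2 : Gx * (r2 - r1) <= Gx * e by rewrite ler_wpM2l.
have a3 : Gx * e <= 2 * (Gy * e).
  by rewrite mulrA ler_wpM2r // mulrC -ler_pdivrMr // ltW.
rewrite -mulrA in h1; move: a1 a2 a3 h1.
by move: (m * _) (Gx * (r2 - r1)) (Gx * e) (Gy * e) => u v w z *; lra.
Qed.

Lemma ln_increment a b : 0 < a -> a <= b -> 0 <= ln b - ln a <= (b - a) / a.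
Proof.
move=> a0 ab; have b0 : 0 < b := lt_le_trans a0 ab.
rewrite -ln_div ?posrE //; apply/andP; split.
  by rewrite ln_ge0 // ler_pdivlMr // mul1r.
have -> : b / a = 1 + (b - a) / a by rewrite mulrBl divff ?gt_eqF // addrC subrK.
apply: le_ln1Dx; apply: (@lt_le_trans _ _ 0); first by rewrite oppr_lt0.
by rewrite divr_ge0 ?subr_ge0 // ltW.
Qed.

Lemma half_below a b : - ((1 + a) / 2) < b - a -> (1 + a) / 2 <= 1 + b.
Proof. by move=> *; lra. Qed.

Lemma norm_between a b c : a <= c <= b -> `|c| <= `|a| + `|b|.
Proof.
move=> /andP[ac cb]; rewrite ler_norml; apply/andP; split.
  rewrite opprD; apply: le_trans ac; rewrite -[leRHS]addr0; apply: lerD.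
    by rewrite lerNl; apply: le_trans (ler_norm _) _; rewrite normrN.
  by rewrite oppr_le0.
by apply: le_trans cb _; apply: le_trans (ler_norm _) _; rewrite lerDr.
Qed.
End Arithmetic.

Section Conditions.
Context {R : realType} {n : nat}.
Notation E := 'rV[R]_n.
Variable g : E -> R.
Hypotheses (g_diff : forall x, differentiable g x)
  (grad_cont : continuous (gradient g)) (grad_neq0 : forall x, gradient g x <> 0).
Let G x := enorm (gradient g x).

Let g_cont : continuous g.
Proof. by move=> x; exact: differentiable_continuous. Qed.

(** [M] stands for a primitive of [2 * m]. A quarter of it, as a function of the
distance to the origin, has slope at most half the norm of the gradient, which
allows for the variation of that norm near a point. *)
Lemma radial_controlled (m M : R -> R) c1 c2 :
  (forall B, exists r0, forall r, 0 <= r -> M r <= B -> r <= r0) ->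
  (forall r, 0 <= r -> exists2 eta, 0 < eta & forall r1 r2, 0 <= r1 -> r1 <= r2 ->
     `|r1 - r| < eta -> `|r2 - r| < eta -> 0 <= M r2 - M r1 <= 2 * m r * (r2 - r1)) ->
  (forall x, c1 <= g x <= c2 -> m (enorm x) <= G x) -> 
  (forall r, 0 <= r -> 0 <= m r) -> controlled g c1 c2.
Proof.
move=> Minf Mlip mG m0; exists (fun x => 1 / 4%:R * M (enorm x)).
have n1 : 0 < n%:R + 1 :> R by rewrite ltr_wpDl.
have enorm_close (x y : E) d : `|y - x| < d / (n%:R + 1) -> `|enorm y - enorm x| < d.
  move=> yx; apply: (le_lt_trans (enormB_le _ _)); apply: (le_lt_trans (enorm_le_norm _)).
  rewrite ltr_pdivlMr // in yx; apply: le_lt_trans yx.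
  by rewrite mulrC ler_wpM2l // lerDl.
split.
- move=> x; apply/continuous_dist => e e0.
  have [eta eta0 H] := Mlip (enorm x) (enorm_ge0 x).
  pose k := m (enorm x) + 1; have k0 : 0 < k by rewrite ltr_wpDl // m0 // enorm_ge0.
  pose d := Num.min eta (e / k).
  have d0 : 0 < d by rewrite lt_min eta0 divr_gt0.
  have dn0 : 0 < d / (n%:R + 1) by rewrite divr_gt0.
  apply: filterS (near_dist x dn0) => y; rewrite distrC => /enorm_close yx.
  have xx : `|enorm x - enorm x| < eta by rewrite subrr normr0.
  move: yx; rewrite lt_min => /andP[yx ye].
  have bound r1 r2 : 0 <= M r2 - M r1 <= 2 * m (enorm x) * (r2 - r1) ->
      `|r2 - r1| < e / k -> 0 <= r2 - r1 -> `|1 / 4%:R * M r2 - 1 / 4%:R * M r1| < e.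
    move=> h1 h2 h3; rewrite ger0_norm // ltr_pdivlMr // mulrC in h2.
    apply: le_lt_trans h2.
    apply: (@slope_arith _ _ _ r1 r2 (m (enorm x)) (m (enorm x)) k (r2 - r1)) => //.
    - by rewrite h3 lexx.
    - by rewrite m0 // enorm_ge0.
    - rewrite /k ltr_pwDr // ler_pdivrMr // ler_peMr ?m0 ?enorm_ge0 //.
      by rewrite ler1n.
  have [le|lt] := leP (enorm x) (enorm y).
    rewrite distrC; apply: bound => //; last by rewrite subr_ge0.
    by apply: H => //; exact: enorm_ge0.
  apply: bound; [|by rewrite distrC|by rewrite subr_ge0 ltW].
  by apply: H => //; [exact: enorm_ge0|exact: ltW].
- move=> B; have [r0 Hr0] := Minf (4%:R * B); exists r0 => x xB.
  apply: le_trans (norm_le_enorm x) _; apply: Hr0; first exact: enorm_ge0.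
  by move: xB; rewrite mul1r -ler_pdivrMl ?invr_gt0 // invrK.
move=> x wx; have [eta eta0 H] := Mlip (enorm x) (enorm_ge0 x).
have G0 := gradient_norm_gt0 grad_neq0 x.
have G2 : 0 < G x / 2 by rewrite divr_gt0.
have [eta2 eta20 Heta2] :=
  near_norm_lt ((continuous_dist G x).1 (@gradient_norm_continuous _ _ _ grad_cont x) _ G2).
exists (Num.min eta2 (eta / (n%:R + 1))); first by rewrite lt_min eta20 divr_gt0.
move=> y z; rewrite !lt_min => /andP[y2 /enorm_close y1] /andP[z2 /enorm_close z1].
have /andP[Gy _] := half_close (Heta2 y y2).
have key r1 r2 : 0 <= r1 -> r1 <= r2 -> `|r1 - enorm x| < eta -> `|r2 - enorm x| < eta ->
    r2 - r1 <= enorm (y - z) ->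
    `|1 / 4%:R * M r2 - 1 / 4%:R * M r1| <= G y * enorm (y - z).
  move=> r10 r12 h1 h2 h3.
  have d0 : 0 <= r2 - r1 <= enorm (y - z) by rewrite subr_ge0 r12.
  exact: slope_arith d0 (enorm_ge0 _) (H r1 r2 r10 r12 h1 h2) (mG x wx) (ltW G0) Gy.
have [le|lt] := leP (enorm z) (enorm y).
  apply: key => //; first exact: enorm_ge0.
  exact: le_trans (ler_norm _) (enormB_le _ _).
rewrite distrC; apply: key => //; [exact: enorm_ge0|exact: ltW|].
rewrite -(enormN (y - z)) opprB.
exact: le_trans (ler_norm _) (enormB_le _ _).
Qed.

(** Malgrange's condition, uniformly on a compact range of levels. *)
Definition malgrange (c1 c2 : R) : Prop := exists2 delta, 0 < delta &
  forall x, c1 <= g x <= c2 -> delta <= (1 + enorm x) * G x.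

(** The logarithm of the distance to the origin has slope [1 / (1 + r)]. *)
Lemma malgrange_controlled c1 c2 : malgrange c1 c2 -> controlled g c1 c2.
Proof.
move=> [delta d0 Hd].
apply: (@radial_controlled (fun r => delta / (1 + r)) (fun r => delta * ln (1 + r))).
- move=> B; exists (expR (B / delta)) => r r0 MB.
  have r1 : 0 < 1 + r by rewrite ltr_pwDl.
  apply: (@le_trans _ _ (1 + r)); first by rewrite lerDr.
  rewrite -[leLHS]lnK ?posrE // ler_expR ler_pdivlMr // mulrC //.
- move=> r r0; have r1 : 0 < 1 + r by rewrite ltr_pwDl.
  exists ((1 + r) / 2); first by rewrite divr_gt0.
  move=> r1' r2 r1'0 r12 h1 h2; rewrite -mulrBr.
  have p1 : 0 < 1 + r1' by rewrite ltr_pwDl.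
  have p12 : 1 + r1' <= 1 + r2 by rewrite lerD2l.
  have /andP[l0 l1] := ln_increment p1 p12.
  rewrite mulr_ge0 ?(ltW d0) //=.
  have -> : 2 * (delta / (1 + r)) * (r2 - r1') = delta * ((r2 - r1') / ((1 + r) / 2)).
    by field; rewrite gt_eqF.
  rewrite ler_wpM2l ?(ltW d0) //; apply: le_trans l1 _.
  rewrite opprD addrACA subrr add0r ler_wpM2l ?subr_ge0 // lef_pV2 ?posrE ?divr_gt0 //.
  by move: h1; rewrite ltr_norml => /andP[h1 _]; exact: half_below.
- move=> x /Hd; rewrite ler_pdivrMr ?ltr_pwDl ?enorm_ge0 //.
  by rewrite mulrC.
- by move=> r r0; rewrite divr_ge0 ?(ltW d0) // addr_ge0.
Qed.

Lemma increasing_seq_ge (s : nat -> nat) : increasing_seq s -> forall k, (k <= s k)%N.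
Proof.
move=> si; elim=> // k IH; apply: leq_ltn_trans IH _.
have := si k.+1 k; rewrite leEnat ltnn => /negbT; rewrite ltnNge; apply.
Qed.

(** Otherwise some points in the window have gradients that tend to zero, and a limit
of a subsequence of them would be a critical point. *)
Lemma palais_smale_malgrange c1 c2 : palais_smale g -> malgrange c1 c2.
Proof.
move=> ps; apply: contrapT => H.
have [u Hu] : {u : nat -> E & forall l, c1 <= g (u l) <= c2 /\ G (u l) < l.+1%:R^-1}.
  apply: (@choice _ _ (fun l x => c1 <= g x <= c2 /\ G x < l.+1%:R^-1)) => l.
  apply: contrapT => Hl; apply: H; exists l.+1%:R^-1; first by rewrite invr_gt0.
  move=> x wx; rewrite leNgt; apply/negP => lt; apply: Hl; exists x; split=> //.
  apply: le_lt_trans lt; rewrite ler_peMl ?enorm_ge0 //.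
  by rewrite lerDl enorm_ge0.
have small (e : R) : 0 < e -> \forall l \near \oo, l.+1%:R^-1 < e.
  by move=> e0; exact: near_infty_natSinv_lt (PosNum e0).
have [||s [si [x sx]]] := ps u.
- exists (`|c1| + `|c2|); split; first exact: num_real.
  move=> M ltM l _; have [w _] := Hu l.
  exact: le_trans (norm_between w) (ltW ltM).
- apply/cvgrPdist_lt => e e0; apply: filterS (small e e0) => l le.
  rewrite sub0r normrN; apply: le_lt_trans (norm_le_enorm _) _.
  by apply: lt_trans le; have [] := Hu l.
have G2 : 0 < G x / 2 by rewrite divr_gt0 // gradient_norm_gt0.
have n1 : \forall z \near x, G x / 2 < G z.
  apply: filterS ((continuous_dist G x).1 (@gradient_norm_continuous _ _ _ grad_cont x) _ G2).
  by move=> z /half_close /andP[].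
have n2 : \forall l \near \oo, G x / 2 < G (u (s l)) := sx _ n1.
have [l [h1 h2]] := filter_ex (filterI n2 (small _ G2)).
have [_ h3] := Hu (s l).
have : l.+1%:R^-1 < l.+1%:R^-1 :> R.
  apply: lt_trans h2 (lt_le_trans (lt_trans h1 h3) _).
  by rewrite lef_pV2 ?posrE // ler_nat ltnS; exact: increasing_seq_ge.
by rewrite ltxx.
Qed.

(** Far from the origin, the bound near each level follows from the absence of
asymptotic critical values, and is uniform since the range of levels is compact;
near the origin, the norm of the gradient has a positive minimum. *)
Lemma K_infty_malgrange c1 c2 : K_infty g = set0 -> malgrange c1 c2.
Proof.
move=> K0.
have loc y : exists2 eta, 0 < eta & forall x, `|g x - y| < eta -> eta^-1 < enorm x ->
    eta <= enorm x * G x.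
  apply: contrapT => H; have : K_infty g y; last by rewrite K0.
  have [u Hu] : {u : nat -> E & forall l, [/\ `|g (u l) - y| < l.+1%:R^-1,
      l.+1%:R < enorm (u l) & enorm (u l) * G (u l) < l.+1%:R^-1]}.
    apply: (@choice _ _ (fun l x => [/\ `|g x - y| < l.+1%:R^-1,
      l.+1%:R < enorm x & enorm x * G x < l.+1%:R^-1])) => l.
    apply: contrapT => Hl; apply: H; exists l.+1%:R^-1; first by rewrite invr_gt0.
    move=> x h1 h2; rewrite leNgt; apply/negP => h3; apply: Hl; exists x; split=> //.
    by rewrite invrK in h2.
  have small (e : R) : 0 < e -> \forall l \near \oo, l.+1%:R^-1 < e.
    by move=> e0; exact: near_infty_natSinv_lt (PosNum e0).
  exists u; split.
  - move=> [s [si [x sx]]].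
    have n1 : \forall z \near x, enorm z < enorm x + 1.
      apply: filterS ((continuous_dist (@enorm R n) x).1 (@enorm_continuous _ _ x) _ ltr01).
      by move=> z; exact: close_succ.
    have n2 : \forall l \near \oo, enorm (u (s l)) < enorm x + 1 := sx _ n1.
    have x1 : 0 < (enorm x + 1)^-1 by rewrite invr_gt0 ltr_wpDl // enorm_ge0.
    have [l [h1 h2]] := filter_ex (filterI n2 (small _ x1)).
    have [_ h3 _] := Hu (s l).
    have : l.+1%:R < l.+1%:R :> R.
      apply: (@le_lt_trans _ _ (s l).+1%:R).
        by rewrite ler_nat ltnS; exact: increasing_seq_ge.
      apply: (lt_trans h3); apply: (lt_trans h1).
      by move: h2; rewrite ltf_pV2 ?posrE // ltr_wpDl // enorm_ge0.
    by rewrite ltxx.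
  - apply/cvgrPdist_lt => e e0; apply: filterS (small e e0) => l le.
    by rewrite distrC; apply: lt_trans le; have [] := Hu l.
  - apply/cvgrPdist_lt => e e0; apply: filterS (small e e0) => l le.
    rewrite sub0r normrN ger0_norm ?mulr_ge0 ?enorm_ge0 //.
    by apply: lt_trans le; have [] := Hu l.
have /compact_near_coveringP cS : compact `[c1, c2]%classic := @segment_compact R c1 c2.
have H : \forall i \near (0 : R)^'+, `[c1, c2] `<=`
    (fun y => forall x, g x = y -> i^-1 < enorm x -> i <= enorm x * G x).
  apply: cS => y _; have [eta eta0 H] := loc y.
  exists ([set z | `|y - z| < eta], [set i | 0 < i < eta]) => /=.
    split; first exact: (near_dist (y : R^o) eta0).
    by apply: filterS (filterI (nbhs_right_gt (0 : R)) (nbhs_right_lt eta0)) => i [h1 h2] /=; apply/andP.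
  move=> [z i] /= [zy /andP[i0 ie]] x gx xi; apply: le_trans (ltW ie) _.
  apply: H; first by rewrite gx distrC.
  by apply: lt_trans xi; rewrite ltf_pV2.
have [i [Hi i0]] := filter_ex (filterI H (nbhs_right_gt (0 : R))).
have cB : compact [set x : E | enorm x <= i^-1].
  apply: (@compact_rV _ _ _ i^-1).
    by apply: closed_sublevel; exact: enorm_continuous.
  by move=> x /=; apply: le_trans; exact: norm_le_enorm.
have cG : continuous G by exact: gradient_norm_continuous.
have B0 : [set x : E | enorm x <= i^-1] !=set0.
  by exists 0; rewrite /= -(scale0r 0) enormZ normr0 mul0r invr_ge0 ltW.
have [z _ Hz] := compact_EVT_min B0 cB (continuous_subspaceT cG).
exists (Num.min (G z) i); first by rewrite lt_min i0 gradient_norm_gt0.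
move=> x wx; rewrite ge_min; have [le|lt] := leP (enorm x) i^-1.
  apply/orP; left; apply: (@le_trans _ _ (G x)); first by apply: Hz; exact: mem_set.
  by rewrite ler_peMl ?enorm_ge0 // lerDl enorm_ge0.
apply/orP; right; apply: (@le_trans _ _ (enorm x * G x)).
  by apply: (Hi (g x)) => //=; rewrite in_itv.
by rewrite ler_wpM2r ?enorm_ge0 // lerDr.
Qed.

End Conditions.

(** * Divergent integral of the gradient *)

Section Primitive.
Context {R : realType}.
Notation mu := (@lebesgue_measure R).
Variable m : R -> R.
Hypotheses (m_ge0 : forall r, 0 <= r -> 0 <= m r)
  (m_meas : measurable_fun (`[0, +oo[%classic : set R) m)
  (m_bd : forall r, exists C, forall r', 0 <= r' <= r -> m r' <= C).

Let I (r : R) : \bar R := (\int[mu]_(x in `[0%R, r]) (m x)%:E)%E.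

Let m_measS (A : set R) : measurable A -> A `<=` (`[0, +oo[%classic : set R) ->
  measurable_fun A (EFin \o m).
Proof.
move=> mA sA; apply/measurable_EFinP.
exact: measurable_funS sA m_meas.
Qed.

Let sub0 (a b : R) (c : bool) : 0 <= a ->
  [set` Interval (BSide c a) (BRight b)] `<=` `[0, +oo[.
Proof.
move=> a0 x; rewrite /= !in_itv /= andbT => /andP[ax _].
by apply: le_trans a0 _; case: c ax => //= /ltW.
Qed.

Let int_le (r1 r2 C : R) : 0 <= r1 -> r1 <= r2 ->
  (forall r, r1 <= r <= r2 -> m r <= C) ->
  (0 <= \int[mu]_(x in `]r1, r2]) (m x)%:E <= (C * (r2 - r1))%:E)%E.
Proof.
move=> r10 r12 mC; apply/andP; split.
  apply: integral_ge0 => x /=; rewrite in_itv /= => /andP[x1 _].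
  by rewrite lee_fin m_ge0 // (le_trans r10) // ltW.
apply: (@le_trans _ _ (\int[mu]_(x in `]r1, r2]) (cst C%:E) x)%E).
  apply: ge0_le_integral => //.
  - move=> x /=; rewrite in_itv /= => /andP[x1 _].
    by rewrite lee_fin m_ge0 // (le_trans r10) // ltW.
  - by apply: m_measS => //; exact: sub0.
  - by move=> x /=; rewrite in_itv /= => /andP[x1 x2]; rewrite lee_fin mC // ltW.
rewrite integral_cst //.
have muE : mu (`]r1, r2]%classic : set R) = if r1 < r2 then (r2 - r1)%:E else 0%E.
  by rewrite lebesgue_measure_itv /= lte_fin -EFinB.
rewrite [X in (_ * X)%E](_ : _ = if r1 < r2 then (r2 - r1)%:E else 0%E); last exact: muE.
have [eq|ne] := eqVneq r1 r2; first by rewrite eq ltxx mule0 subrr mulr0.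
by rewrite lt_neqAle ne r12 -EFinM.
Qed.

Let I_split r1 r2 : 0 <= r1 -> r1 <= r2 ->
  I r2 = (I r1 + \int[mu]_(x in `]r1, r2]) (m x)%:E)%E.
Proof.
move=> r10 r12; rewrite /I.
have U : `[0, r2]%classic = (`[0, r1] `|` `]r1, r2])%classic :> set R.
  apply/seteqP; split=> x /=; rewrite !in_itv /=.
    move=> /andP[x0 x2]; case: (leP x r1) => xr1; first by left; rewrite x0.
    by right.
  move=> [/andP[x0 x1]|/andP[x1 x2]].
    by rewrite x0 (le_trans x1).
  by rewrite x2 andbT (le_trans r10) // ltW.
rewrite U ge0_integral_setU //.
- rewrite -U; apply: m_measS => //; exact: sub0.
- by move=> x; rewrite -U => /sub0 /=; rewrite in_itv /= andbT lee_fin => /(_ (lexx 0)) /m_ge0.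
- rewrite disj_set2E; apply/eqP/seteqP; split=> // x [] /=; rewrite !in_itv /=.
  by move=> /andP[_ x1] /andP[]; rewrite ltNge x1.
Qed.

Let I0 : I 0 = 0%E.
Proof. by rewrite /I set_itv1 integral_set1. Qed.

Let I_fin r : 0 <= r -> I r \is a fin_num.
Proof.
move=> r0; rewrite (I_split (lexx 0) r0) I0 add0e.
have [C HC] := m_bd r; have /andP[h1 h2] := int_le (lexx 0) r0 HC.
by rewrite ge0_fin_numE //; apply: le_lt_trans h2 _; rewrite ltry.
Qed.

Lemma primitive_increment r1 r2 C : 0 <= r1 -> r1 <= r2 ->
  (forall r, r1 <= r <= r2 -> m r <= C) ->
  0 <= fine (I r2) - fine (I r1) <= C * (r2 - r1).
Proof.
move=> r10 r12 mC; have /andP[h1 h2] := int_le r10 r12 mC.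
have r20 := le_trans r10 r12.
have e := I_split r10 r12.
have f : (\int[mu]_(x in `]r1, r2]) (m x)%:E)%E \is a fin_num.
  by rewrite ge0_fin_numE //; apply: le_lt_trans h2 _; rewrite ltry.
have -> : fine (I r2) - fine (I r1) = fine (\int[mu]_(x in `]r1, r2]) (m x)%:E)%E.
  move: (I_fin r10) f e; move: (I r1) (I r2) (\int[_]_(_ in _) _)%E => a b c fa fc ->.
  by rewrite fineD // addrC addKr.
by rewrite -!lee_fin fineK // h1 h2.
Qed.

(** By monotone convergence the primitive tends to the divergent integral. *)
Lemma primitive_unbounded : (\int[mu]_(r in `[0%R, +oo[) (m r)%:E)%E = +oo%E ->
  forall B, exists r0, forall r, 0 <= r -> fine (I r) <= B -> r <= r0.
Proof.
move=> Ioo B.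
have cvgI : I k%:R @[k --> \oo] --> (\int[mu]_(r in `[0%R, +oo[) (m r)%:E)%E.
  have -> : `[0, +oo[%classic = \bigcup_k `[0, k%:R : R]%classic.
    apply/seteqP; split=> x /=; rewrite in_itv /= ?andbT.
      move=> x0; exists (Num.truncn x).+1 => //=; rewrite in_itv /= x0 /=.
      by apply: ltW; have /andP[] := truncn_itv x0.
    by move=> [k _ /=]; rewrite in_itv /= => /andP[].
  apply: ge0_nondecreasing_set_cvg_integral => //.
  - move=> i j ij; rewrite subsetEset => x /=; rewrite !in_itv /= => /andP[-> xi].
    by apply: le_trans xi _; rewrite ler_nat.
  - by move=> k; apply: m_measS => //; exact: sub0.
  - by move=> k x /=; rewrite in_itv /= => /andP[x0 _]; rewrite lee_fin m_ge0.
rewrite Ioo in cvgI; move/cvgeyPgt: cvgI => /(_ B) [k _ Hk].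
exists k%:R => r r0 rB; rewrite leNgt; apply/negP => kr.
have [C HC] := m_bd r.
have /andP[mono _] : 0 <= fine (I r) - fine (I k%:R) <= C * (r - k%:R).
  apply: primitive_increment => //; first exact: ltW.
  by move=> r' /andP[h1 h2]; apply: HC; rewrite h2 (le_trans _ h1).
have := Hk k (leqnn k); rewrite -(fineK (I_fin _)) // lte_fin ltNge => /negP; apply.
by apply: le_trans rB; rewrite -subr_ge0.
Qed.

End Primitive.

Section SphereMinimum.
Context {R : realType} {n : nat}.
Notation E := 'rV[R]_n.+1.
Variable G : E -> R.
Hypotheses (G_cont : continuous G) (G_gt0 : forall x, 0 < G x).

Definition sphere_min (r : R) : R := inf [set G x | x in [set x : E | enorm x = r]].

Let e0 : E := delta_mx 0 0.

Lemma enorm_delta : enorm e0 = 1.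
Proof.
rewrite /enorm big_ord_recl big1 ?mxE ?eqxx ?expr1n ?addr0 ?sqrtr1 // => i _.
by rewrite !mxE /= expr0n.
Qed.

Lemma sphere_min_le x : sphere_min (enorm x) <= G x.
Proof.
apply: ge_inf; last by exists x.
by exists 0 => _ [y _ <-]; exact: ltW.
Qed.

Lemma sphere_min_attained r : 0 <= r -> exists2 x, enorm x = r & G x = sphere_min r.
Proof.
move=> r0.
have sph0 : [set x : E | enorm x = r] !=set0.
  by exists (r *: e0); rewrite /= enormZ enorm_delta mulr1 ger0_norm.
have [||x /set_mem xr Hx] := @compact_EVT_min _ R G _ sph0.
- apply: (@compact_rV _ _ _ r).
    rewrite (_ : [set x : E | enorm x = r] = (@enorm R n.+1) @^-1` [set r]) //.
    apply: preimage_closed; first by move=> y _; exact: enorm_continuous.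
    exact: closed_eq.
  by move=> x <-; exact: norm_le_enorm.
- exact: continuous_subspaceT.
exists x => //; apply: le_anti; apply/andP; split.
  by apply: lb_le_inf; [exists (G x); exists x|
    move=> _ [y yr <-]; apply: Hx; exact: mem_set].
by rewrite -xr; exact: sphere_min_le.
Qed.

Lemma sphere_min_gt0 r : 0 <= r -> 0 < sphere_min r.
Proof. by move=> /sphere_min_attained[x _ <-]. Qed.

Lemma unit_direction (x : E) : exists2 e : E, enorm e = 1 & x = enorm x *: e.
Proof.
have [eq|ne] := eqVneq (enorm x) 0.
  by exists e0; [exact: enorm_delta|rewrite eq scale0r; exact: enorm_eq0].
exists ((enorm x)^-1 *: x); last by rewrite scalerA divff // scale1r.
by rewrite enormZ ger0_norm ?invr_ge0 ?enorm_ge0 // mulVf.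
Qed.

Lemma continuous_ray (e : E) : continuous (fun r : R => G (r *: e)).
Proof.
move=> r; apply: (@continuous_comp _ _ _ (fun r : R => r *: e) G); last exact: G_cont.
exact: (@scalel_continuous R E e).
Qed.

Lemma sphere_min_ray (e : E) r : enorm e = 1 -> 0 <= r -> sphere_min r <= G (r *: e).
Proof.
move=> e1 r0; have := sphere_min_le (r *: e).
by rewrite enormZ e1 mulr1 ger0_norm.
Qed.

(** A minimum point on the sphere is moved along its ray. *)
Lemma sphere_min_usc r : 0 <= r -> exists2 eta, 0 < eta &
  forall r', 0 <= r' -> `|r' - r| < eta -> sphere_min r' <= 2 * sphere_min r.
Proof.
move=> r0; have [x xr <-] := sphere_min_attained r0.
have [e e1 xe] := unit_direction x.
have Gx2 : G (r *: e) < 2 * G x by rewrite -xr -xe ltr_pMl // ltr1n.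
have d0 : 0 < 2 * G x - G (r *: e) by rewrite subr_gt0.
have [eta eta0 H] :=
  near_norm_lt ((continuous_dist (fun r : R => G (r *: e)) r).1 (@continuous_ray e r) _ d0).
exists eta => // r' r'0 /H h; apply: le_trans (sphere_min_ray e1 r'0) _.
by move: h; rewrite distrC => /(le_lt_trans (ler_norm _)); rewrite ltrD2r => /ltW.
Qed.

Lemma sphere_min_bounded r : exists C, forall r', 0 <= r' <= r -> sphere_min r' <= C.
Proof.
have [r0|rn] := leP 0 r; last first.
  by exists 0 => r' /andP[a b]; have := lt_le_trans rn (le_trans a b); rewrite ltxx.
have [|c _ Hc] := @EVT_max R (fun r : R => G (r *: e0)) 0 r r0.
  by apply: continuous_subspaceT; exact: continuous_ray.
exists (G (c *: e0)) => r' r'r; apply: le_trans (Hc r' _); last by rewrite in_itv.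
by apply: sphere_min_ray; [exact: enorm_delta|case/andP: r'r].
Qed.

(** On the half-line, a sublevel set of the minimum is the union, over the unit
vectors, of open sets of radii. *)
Lemma sphere_min_measurable : measurable_fun (`[0, +oo[%classic : set R) sphere_min.
Proof.
apply: (measurability _ (RGenInftyO.measurableE R)) => _ [_ [t ->] <-].
pose O := \bigcup_(e in [set e : E | enorm e = 1]) [set r : R | G (r *: e) < t].
rewrite (_ : _ `&` _ = `[0, +oo[%classic `&` O); last first.
  apply/seteqP; split=> r /=; rewrite !in_itv /= andbT => -[r0 h]; split=> //.
    have [x xr Gx] := sphere_min_attained r0.
    have [e e1 xe] := unit_direction x.
    by exists e => //=; rewrite -xr -xe Gx.
  by case: h => e /= e1 Ge; apply: le_lt_trans Ge; exact: sphere_min_ray.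
apply: measurableI; first exact: measurable_itv.
apply: open_measurable; apply: bigcup_open => e _.
rewrite (_ : [set r : R | G (r *: e) < t] = (fun r : R => G (r *: e)) @^-1` [set s | s < t]) //.
by apply: open_comp; [move=> r _; exact: continuous_ray|exact: open_lt].
Qed.

End SphereMinimum.

Section GradientIntegral.
Context {R : realType} {n : nat}.
Notation E := 'rV[R]_n.+1.
Variable g : E -> R.
Hypotheses (g_diff : forall x, differentiable g x)
  (grad_cont : continuous (gradient g)) (grad_neq0 : forall x, gradient g x <> 0).
Let G x := enorm (gradient g x).

Lemma gradient_integral_controlled c1 c2 : gradient_integral_infinite g ->
  controlled g c1 c2.
Proof.
move=> Ioo.
have cG : continuous G by exact: gradient_norm_continuous.
have G0 : forall x, 0 < G x by exact: gradient_norm_gt0.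
pose m := sphere_min G.
have m0 r : 0 <= r -> 0 <= m r by move=> r0; apply: ltW; exact: sphere_min_gt0.
have mm := sphere_min_measurable cG G0.
have mb := sphere_min_bounded cG G0.
apply: (@radial_controlled _ _ g grad_cont grad_neq0 m
  (fun r => fine (\int[@lebesgue_measure R]_(x in `[0%R, r]) (m x)%:E)%E)) => //.
- exact: primitive_unbounded m0 mm mb Ioo.
- move=> r r0; have [eta eta0 H] := sphere_min_usc cG G0 r0.
  exists eta => // r1 r2 r10 r12 h1 h2.
  apply: (primitive_increment m0 mm mb) => // s /andP[s1 s2]; apply: H.
    exact: le_trans s1.
  move: h1 h2; rewrite !ltr_norml => /andP[a1 a2] /andP[b1 b2]; apply/andP; split.
    by apply: lt_le_trans a1 _; rewrite lerD2r.
  by apply: le_lt_trans b2; rewrite lerD2r.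
- by move=> x _; exact: sphere_min_le.
Qed.

End GradientIntegral.

(** * Components of a local diffeomorphism *)

Section Components.
Context {R : realType} {n : nat}.
Notation E := 'rV[R]_n.
Implicit Types f : E -> E.

Let coord (i : 'I_n) : E -> R := fun x => x 0 i.

Let coord_linear i : linear (coord i).
Proof. by move=> a x y; rewrite /coord !mxE. Qed.

HB.instance Definition _ i := GRing.isLinear.Build R E R _ (coord i) (coord_linear i).

Let coord_diff i x : differentiable (coord i) x.
Proof. by apply: linear_differentiable; exact: coord_continuous. Qed.

Lemma component_differentiable f i x : differentiable f x ->
  differentiable (component f i) x.
Proof. by move=> df; apply: (@differentiable_comp _ _ _ _ f (coord i)). Qed.

Lemma derive_component f i x v : differentiable f x ->
  'D_v (component f i) x = ('D_v f x) 0 i.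
Proof.
move=> df; rewrite !deriveE //; last exact: component_differentiable.
rewrite (_ : component f i = coord i \o f) // diff_comp // diff_lin //.
exact: coord_continuous.
Qed.

Lemma local_diffeomorphism_differentiable k f x : Ck_local_diffeomorphism k.+1 f ->
  differentiable f x.
Proof. by move=> /(_ x)[U [Ux [_ _ [df _] _]]]; exact: df. Qed.

Lemma component_gradient_continuous k f i : Ck_local_diffeomorphism k.+2 f ->
  continuous (gradient (component f i)).
Proof.
move=> df x; apply: continuous_row => j.
rewrite (_ : (fun t => _ 0 j) = fun t => partial_derive j f t 0 i); last first.
  apply/funext => t; rewrite mxE; apply: derive_component.
  exact: local_diffeomorphism_differentiable df.
rewrite mxE /partial_derive derive_component; last exact: local_diffeomorphism_differentiable df.
have [U [Ux [_ _ [_ C1] _]]] := df x.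
apply: (@continuous_comp _ _ _ (partial_derive j f) (coord i)).
  by have [dp _] := C1 j; apply: differentiable_continuous; exact: dp.
exact: coord_continuous.
Qed.

(** If [h] is a local inverse of [f], then [component f i \o h] is a coordinate, whose
derivative in its own direction is one. *)
Lemma component_gradient_neq0 k f i x : Ck_local_diffeomorphism k.+1 f ->
  gradient (component f i) x <> 0.
Proof.
move=> df grad0; have [U [Ux [oU oV _ [h [[dh _] hK]]]]] := df x.
have fxV : (f @` U) (f x) by exists x.
have hfx : h (f x) = x by apply: hK; exact: mem_set.
have dfx y : differentiable f y := local_diffeomorphism_differentiable y df.
pose e : E := delta_mx 0 i.
have D1 : 'D_e (component f i \o h) (f x) = 1.
  have dc : 'D_e (coord i) (f x) = 1.
    rewrite deriveE // diff_lin; last exact: coord_continuous.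
    by rewrite -[LHS]/(e 0 i) mxE !eqxx.
  rewrite -dc; apply: near_eq_derive.
  apply: filterS (open_nbhs_nbhs (conj oV fxV)) => _ [z Uz <-] /=.
  by rewrite hK //; exact: mem_set.
have : 'D_e (component f i \o h) (f x) = 0.
  rewrite deriveE; last first.
    apply: differentiable_comp; first exact: dh.
    by apply: component_differentiable.
  rewrite diff_comp; [|exact: dh|exact: component_differentiable].
  rewrite /= hfx -deriveE; last exact: component_differentiable.
  rewrite derive_dotp; last by move=> y; exact: component_differentiable.
  by rewrite grad0 /dotp big1 // => j _; rewrite mxE mul0r.
by rewrite D1 => /eqP; rewrite oner_eq0.
Qed.

Lemma open_range_component f i : local_homeo f -> open (range (component f i)).
Proof.
move=> lh; rewrite openE => _ [x _ <-].
have /(local_homeo_nbhs lh) : nbhs x [set: E] by exact: filterT.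
move=> /near_norm_lt [eta eta0 H].
apply/(@nbhs_ballP R); exists eta => //= t; rewrite -ball_normE /= => xt.
have [|y _ fy] := H (f x + (t - f x 0 i) *: delta_mx 0 i).
  rewrite addrC addKr normrZ; apply: (@le_lt_trans _ _ `|t - f x 0 i|).
    rewrite -[leRHS]mulr1 ler_wpM2l //; apply/row_norm_le => // j.
    by rewrite mxE eqxx /=; case: eqP; rewrite ?normr1 ?normr0.
  by rewrite distrC.
by exists y => //; rewrite /component fy !mxE !eqxx mulr1 addrC subrK.
Qed.

End Components.

Section BothDirections.
Context {R : realType} {n : nat}.
Notation E := 'rV[R]_n.

Lemma gradientN (g : E -> R) x : differentiable g x ->
  gradient (fun y => - g y) x = - gradient g x.
Proof.
move=> dg; apply/rowP => j; rewrite !mxE /partial_derive.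
by rewrite -[LHS]/('D_(delta_mx 0 j) (- g) x) deriveN //; exact: diff_derivable.
Qed.

Lemma controlledN (g : E -> R) c1 c2 : (forall x, differentiable g x) ->
  controlled g (- c2) (- c1) -> controlled (fun x => - g x) c1 c2.
Proof.
move=> dg [N [cN Ninf NG]]; exists N; split=> // x /andP[gx1 gx2].
have [|eta eta0 H] := NG x; first by rewrite lerNl gx2 lerNr.
exists eta; first exact: eta0.
move=> y z yx zx; rewrite (gradientN (dg y)) enormN.
exact: H yx zx.
Qed.

Lemma regularN (g : E -> R) : (forall x, differentiable g x) ->
  continuous (gradient g) -> (forall x, gradient g x <> 0) ->
  (forall c1 c2, controlled g c1 c2) ->
  regular_upwards g /\ regular_upwards (fun x => - g x).
Proof.
move=> dg cg g0 ctl; split; first exact: controlled_regular.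
have gN : gradient (fun y => - g y) = (fun x => - gradient g x).
  by apply/funext => x; exact: gradientN.
apply: controlled_regular.
- by move=> x; apply: differentiableN.
- by rewrite gN => x; apply: continuousN; exact: cg.
- by rewrite gN => x /eqP; rewrite oppr_eq0 => /eqP; exact: g0.
- by move=> c1 c2; exact: controlledN.
Qed.

End BothDirections.

Lemma component_regular (R : realType) (f : 'rV[R]_3 -> 'rV[R]_3) (i : 'I_3) :
  Ck_local_diffeomorphism 2 f ->
  [\/ locally_trivial_at_image (component f i), K_infty (component f i) = set0,
      palais_smale (component f i) | gradient_integral_infinite (component f i)] ->
  regular_upwards (component f i) /\ regular_upwards (fun x => - component f i x).
Proof.
move=> df; have dg x := component_differentiable i (local_diffeomorphism_differentiable x df).
have cgrad := @component_gradient_continuous _ _ _ f i df.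
have grad0 x := @component_gradient_neq0 _ _ _ _ i x df.
have cg : continuous (component f i) by move=> x; exact: differentiable_continuous.
have lh := Ck_local_homeo df.
case=> H.
- have tr := locally_trivial_transport (open_range_component lh) H cg.
  split; first exact: transport_regular.
  apply: transport_regular; first by move=> x; apply: continuousN; exact: cg.
  exact: has_transportN.
- by apply: regularN => // c1 c2; apply: malgrange_controlled => //; exact: K_infty_malgrange.
- by apply: regularN => // c1 c2; apply: malgrange_controlled => //; exact: palais_smale_malgrange.
- by apply: regularN => // c1 c2; exact: gradient_integral_controlled.
Qed.

(** * Spheres and slices that avoid the nonproper set *)

Section Boundary.
Context {R : realType} {n m : nat}.
Variable f : 'rV[R]_n -> 'rV[R]_m.
Hypothesis f_cont : continuous f.

Lemma bounded_on_cube (r : R) : exists M, forall x, `|x| <= r -> `|f x| <= M.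
Proof.
have c : compact (f @` [set x | `|x| <= r]).
  by apply: continuous_compact; [exact: continuous_subspaceT|exact: compact_cube].
by have [M _ HM] := compact_norm_le c; exists M => x xr; apply: HM; exists x.
Qed.

(** The image of a cube is closed, so that values close to [y] are only taken outside
the cube. *)
Lemma closure_range_nonproper y : closure (range f) y -> ~ range f y ->
  nonproper_set f y.
Proof.
move=> cy ny; apply/(nonproperP _ f_cont) => eps N eps0 N0.
pose K := f @` [set x | `|x| <= N].
have cK : closed K.
  apply: compact_closed; first exact: norm_hausdorff.
  by apply: continuous_compact; [exact: continuous_subspaceT|exact: compact_cube].
have nK : \forall z \near y, ~ K z.
  have oK : open (~` K) by exact: closed_openC.
  by apply: (open_nbhs_nbhs (conj oK _)) => -[x _ fx]; apply: ny; exists x.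
have [_ [[x _ <-] [nKx xy]]] := cy _ (filterI nK (near_dist y eps0)).
exists x; split; last by rewrite distrC.
by rewrite ltNge; apply/negP => xN; apply: nKx; exists x.
Qed.

Lemma preimage_bounded (Q : set 'rV[R]_m) : compact Q ->
  (forall y, Q y -> ~ nonproper_set f y) ->
  exists2 rho : R, 0 <= rho & forall x, Q (f x) -> `|x| <= rho.
Proof.
move=> cQ nQ.
pose P (y : 'rV[R]_m) (s : R) := 0 < s -> forall x, f x = y -> `|x| <= s^-1.
have [y Qy|eta eta0 H] := @compact_uniform R m Q P cQ.
  apply: contrapT => nP; apply: (nQ y Qy); apply/(nonproperP _ f_cont) => eps N eps0 N0.
  apply: contrapT => nx; apply: nP.
  exists (Num.min eps N^-1); first by rewrite lt_min eps0 invr_gt0.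
  move=> z s; rewrite lt_min => /andP[zy _]; rewrite lt_min => /and3P[_ _ sN] s0 x fx.
  have Ns : N <= s^-1 by rewrite -[N]invrK lef_pV2 ?posrE ?invr_gt0 // ltW.
  by rewrite leNgt; apply/negP => /(le_lt_trans Ns) Nx; apply: nx; exists x; rewrite fx.
have e0 : 0 < eta / 2 by rewrite divr_gt0.
exists (eta / 2)^-1; first by rewrite invr_ge0 ltW.
move=> x Qx; apply: (H _ _ Qx _ e0) => //.
by rewrite (ltW e0) ltr_pdivrMr // ltr_pMr // ltr1n.
Qed.

End Boundary.

Section Avoiding.
Context {R : realType}.

Lemma avoid_countable (A : set R) a b : countable A -> a < b ->
  exists2 t, a < t < b & ~ A t.
Proof.
move=> cA ab; apply: contrapT => H; apply: (uncountable_itv ab).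
apply: sub_countable cA; apply: subset_card_le => t /=; rewrite in_itv /= => tab.
by apply: contrapT => nt; apply: H; exists t.
Qed.

Lemma open_ball_real (A : set R) c : open A -> A c -> exists2 eta : R, 0 < eta &
  forall t, `|t - c| < eta -> A t.
Proof. by move=> oA Ac; apply: near_norm_lt; exact: open_nbhs_nbhs (conj oA Ac). Qed.

Lemma avoid_radius n (S : set 'rV[R]_n) (p : 'rV[R]_n) (B : set R) : countable B ->
  (forall y, S y -> B `|y - p|) -> exists2 r, 0 < r & forall y, `|y - p| = r -> ~ S y.
Proof.
move=> cB SB; have [r /andP[r0 _] nr] := avoid_countable cB (@ltr01 R).
by exists r => // y yr Sy; apply: nr; rewrite -yr; exact: SB.
Qed.

Lemma closed_sphere n (p : 'rV[R]_n) (r : R) : closed [set y | `|y - p| = r].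
Proof.
rewrite (_ : [set y | _] = (fun y => `|y - p|) @^-1` [set r]) //.
apply: preimage_closed; last exact: closed_eq.
move=> y _; apply/continuous_dist => e e0; apply: filterS (near_dist y e0) => z yz.
apply: le_lt_trans yz; apply: le_trans (ler_dist_dist _ _) _.
by rewrite opprB addrA subrK.
Qed.

Lemma sphere_bounded n (p y : 'rV[R]_n) (r : R) : `|y - p| = r -> `|y| <= r + `|p|.
Proof. by move=> <-; rewrite -{1}(subrK p y); exact: ler_normD. Qed.

Lemma compact_sphere n (p : 'rV[R]_n) (r : R) : compact [set y | `|y - p| = r].
Proof. exact: (compact_rV (@closed_sphere n p r) (fun y => @sphere_bounded n p y r)). Qed.

Lemma continuous_coord_dist n (i : 'I_n) (c : R) :
  continuous (fun y : 'rV[R]_n => `|y 0 i - c|).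
Proof.
move=> y; apply/continuous_dist => e e0; apply: filterS (near_dist y e0) => z yz.
apply: le_lt_trans yz; apply: le_trans (ler_dist_dist _ _) _.
rewrite opprB addrA subrK -[X in `|X|]/((y 0 i) - (z 0 i)).
by have := row_norm_coord (y - z) i; rewrite !mxE.
Qed.

(** On the part of the sphere contained in [S], which is compact, the distance to the
hyperplane does not vanish; it has a positive minimum. *)
Lemma slab_sphere_avoids n (S : set 'rV[R]_n) (p : 'rV[R]_n) i (c r : R) : closed S ->
  (forall y : 'rV[R]_n, y 0 i = c -> `|y - p| = r -> ~ S y) ->
  exists2 eps, 0 < eps & forall y : 'rV[R]_n, `|y 0 i - c| <= eps -> `|y - p| = r -> ~ S y.
Proof.
move=> cS H; pose K := S `&` [set y : 'rV[R]_n | `|y - p| = r].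
have cK : compact K.
  apply: (@compact_rV _ _ _ (r + `|p|)); first by apply: closedI => //; exact: closed_sphere.
  by move=> y [_ /sphere_bounded].
have [K0|K0] := pselect (K !=set0); last first.
  by exists 1 => // y _ yr Sy; apply: K0; exists y.
have ch := @continuous_coord_dist n i c.
have [y /set_mem[Sy yr] Hy] := compact_EVT_min K0 cK (continuous_subspaceT ch).
have d0 : 0 < `|y 0 i - c|.
  by rewrite normr_gt0 subr_eq0; apply/eqP => /H /(_ yr).
exists (`|y 0 i - c| / 2); first by rewrite divr_gt0.
move=> z zc zr Sz; have := Hy z (mem_set (conj Sz zr)).
by move=> /le_trans /(_ zc); apply/negP; rewrite -ltNge ltr_pdivrMr // ltr_pMr // ltr1n.
Qed.

End Avoiding.

Section Parity.
Context {R : realType} {V : normedModType R}.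
Variables (u w : V -> R) (k : V -> bool) (T T' : set V) (a b : V).
Hypotheses (cu : continuous u) (cw : continuous w).

Lemma constant_on_connected (Q : set V) (h : V -> bool) : connected Q -> Q a ->
  (forall x, Q x -> \forall z \near x, Q z -> h z = h x) ->
  forall x, Q x -> h x = h a.
Proof.
move=> cQ Qa H x Qx.
apply: (connected_local_ind (P := fun x => h x = h a) cQ Qa) => // y Qy hy;
  by apply: filterS (H y Qy) => z hz Qz; rewrite hz.
Qed.

(** On [T], where [w >= 0], the branch does not meet the cut; on [T'], where [w <= 0],
it does not either once its sign is changed on the half-line itself. This change
affects [a], and would not affect [b] if [u b <= 0]. *)
Lemma branch_obstruction : connected T -> connected T' -> T a -> T b -> T' a -> T' b ->
  (forall x, T x -> branch u w k x /\ 0 <= w x) ->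
  (forall x, T' x -> [/\ branch u w k x, w x <= 0 & ~ (u x = 0 /\ w x = 0)]) ->
  0 < u a -> w a = 0 -> 0 < u b.
Proof.
move=> cT cT' Ta Tb Ta' Tb' HT HT' ua wa; rewrite ltNge; apply/negP => ub.
have kab : k b = k a.
  apply: (constant_on_connected cT) => // x Tx; have [br _] := HT x Tx.
  apply: filterS br => z -> Tz; have [_ wz] := HT z Tz.
  by rewrite (ltNge (w z)) wz !andbF addbF.
pose k' x := k x (+) ((0 < u x) && (w x == 0)).
have : k' b = k' a.
  apply: (constant_on_connected cT') => // x Tx; have [br wx nz] := HT' x Tx.
  have negw : w x < 0 -> \forall z \near x, T' z -> k' z = k' x.
    move=> wx0; apply: filterS (filterI br (near_neg cw wx0)) => z [kz wz] _.
    by rewrite /k' kz (lt_eqF wz) (lt_eqF wx0) /= !andbF !addbF.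
  have [w0|w0] := eqVneq (w x) 0; last by apply: negw; rewrite lt_neqAle w0.
  have [u0|u0|u0] := ltgtP (u x) 0; last by case: nz.
    apply: filterS (filterI br (near_neg cu u0)) => z [kz uz] _.
    by rewrite /k' kz !ltNge (ltW uz) (ltW u0) /= !addbF.
  apply: filterS (filterI br (near_pos cu u0)) => z [kz uz] Tz; have [_ wz _] := HT' z Tz.
  rewrite /k' kz uz u0 w0 eqxx /= lt_neqAle wz andbT.
  by case: (w z == 0); case: (k x).
by rewrite /k' ua wa eqxx kab (ltNge 0) ub /= addbF addbT; case: (k a).
Qed.

End Parity.

Section LevelJoining.
Context {R : realType} {n : nat}.
Notation E := 'rV[R]_n.

(** Both points climb to a level that exceeds all values on the cube, and are joined
above that level. *)
Lemma far_points_joined (g : E -> R) (c rho : R) : continuous g -> open (range g) ->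
  regular_upwards g -> range g c -> 0 <= rho ->
  exists2 eps, 0 < eps & exists rho', forall a b, `|g a - c| < eps -> g b = g a ->
    rho' < `|a| -> rho' < `|b| -> joined_in [set x | rho < `|x| /\ g a <= g x] a b.
Proof.
move=> cg og [asc joi] rc rho0.
have [xm _ Hm] : exists2 x, x \in [set x : E | `|x| <= rho] &
    forall t, t \in [set x : E | `|x| <= rho] -> g t <= g x.
  have [||x xr Hx] := @compact_EVT_min _ R (fun x => - g x) [set x : E | `|x| <= rho] _ (@compact_cube R n rho).
  - by exists 0; rewrite /= normr0.
  - by apply: continuous_subspaceT => x; apply: continuousN; exact: cg.
  by exists x => // t /Hx; rewrite lerN2.
pose m := Num.max (g xm) c.
have rm : range g m by rewrite /m; case: (leP (g xm) c) => _ //; exists xm.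
have [eta eta0 Heta] := open_ball_real og rm.
have [eta' eta'0 Heta'] := open_ball_real og rc.
have cm : c <= m by rewrite le_max lexx orbT.
have gm : g xm <= m by rewrite le_max lexx.
pose eps := Num.min (eta / 4%:R) (eta' / 2).
have eps0 : 0 < eps by rewrite lt_min !divr_gt0.
have epse : eps <= eta / 4%:R by rewrite ge_min lexx.
have epse' : eps <= eta' / 2 by rewrite ge_min lexx orbT.
have [|||rho' H] := asc (c - eps) (m + eta / 2) _ _ _ rho.
- by move: eta0 eps0 cm; clear; lra.
- by apply: Heta'; rewrite addrC addKr normrN gtr0_norm //; move: epse' eta'0; clear; lra.
- by apply: Heta; rewrite addrC addKr gtr0_norm ?divr_gt0 // ltr_pdivrMr // ltr_pMr // ltr1n.
exists eps => //; exists rho' => a b ga gb ar br.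
have ca : c - eps <= g a <= m + eta / 2.
  move: ga epse eta0 cm; rewrite ltr_norml => /andP[]; clear; move: (g a) (eps) => s e.
  by move=> *; apply/andP; split; lra.
have [A [cA Aa HA [a' Aa' ga']]] := H a ar ca.
have [|B [cB Bb HB [b' Bb' gb']]] := H b br; first by rewrite gb.
have [|||J [cJ Ja Jb HJ]] := joi (m + eta / 4%:R) (m + eta / 2) a' b'.
- by move: eta0; clear; lra.
- by rewrite ga'.
- by rewrite gb'.
exists (A `|` J `|` B); split.
- apply: connectedU; [by exists b'; split; [right|]| |exact: cB].
  by apply: connectedU; [exists a'| |].
- by left; left.
- by right.
move=> x [[/HA //|/HJ /= gx]|/HB]; last by rewrite gb.
have le4 : m < m + eta / 4%:R by rewrite ltrDl divr_gt0.
split.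
  rewrite ltNge; apply/negP => xr; have := Hm x (mem_set xr).
  by move=> /(le_trans gx) /le_trans /(_ gm); rewrite leNgt le4.
apply: le_trans gx; move: ga epse cm; rewrite ltr_norml => /andP[_]; clear.
by move: (g a) (eps) => s e; lra.
Qed.

End LevelJoining.

Section Slices.
Context {R : realType}.
Notation E := 'rV[R]_3.
Variable f : E -> E.
Hypothesis f_lh : local_homeo f.
Let S := nonproper_set f.

(** Starting from each point of a short segment in a coordinate direction of the
slice, move in the other direction: since the image is bounded there, it has to be
left, at a frontier point and hence at a nonproper point. *)
Lemma bounded_slice (i : 'I_3) (c B : R) : range (component f i) c ->
  (forall x, component f i x = c -> `|f x| <= B) ->
  ~ countable (S `&` [set y : E | y 0 i = c]).
Proof.
move=> [x0 _ fx0] bnd cS.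
have fc : continuous f := @local_homeo_continuous _ _ _ f_lh.
have oW : open (range f).
  rewrite openE => _ [x _ <-]; rewrite /interior.
  by apply: (local_homeo_nbhs f_lh); exact: filterT.
have [j ji] : exists j : 'I_3, j != i.
  by case: (eqVneq i ord0) => [->|ne]; [exists ord_max|exists ord0; rewrite eq_sym].
have [l [lj li _]] := ord3_third ji.
pose el : E := delta_mx 0 l; pose ej : E := delta_mx 0 j.
have W0 : range f (f x0) by exists x0.
have [e e0 He] := near_line el oW W0.
apply: (@uncountable_itv R (f x0 0 l - e) (f x0 0 l + e)); first by rewrite ltrD2l gtrN.
apply: sub_countable (countable_image (fun y : E => y 0 l) cS).
apply: subset_card_le => t /=; rewrite in_itv /= => /andP[t1 t2].
pose path (s : R) : E := f x0 + (t - f x0 0 l) *: el + s *: ej.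
have pathi s : path s 0 i = c.
  by rewrite !mxE (eq_sym i) (negPf li) (eq_sym i) (negPf ji) /= !mulr0 !addr0.
have pathl s : path s 0 l = t.
  by rewrite !mxE !eqxx (negPf lj) /= mulr0 mulr1 addr0 addrC subrK.
suff [s Sp] : exists s, S (path s) by exists (path s).
apply: contrapT => nS.
have cpath : continuous path.
  by move=> s; apply: cvgD; [exact: cvg_cst|exact: (@scalel_continuous R E ej)].
have all s : range f (path s).
  have cI : connected [set: R] by apply/connected_intervalP; move=> ? *.
  apply: (connected_local_ind (P := fun s => range f (path s)) (x0 := 0) cI) => //.
  - rewrite /path scale0r addr0; apply: He.
    by rewrite ltr_norml; apply/andP; split; move: t1 t2; clear; move: (f x0 0 l) => z; lra.
  - move=> s' _ Ws.
    have h : \forall z \near s', range f (path z) := cpath s' _ (open_nbhs_nbhs (conj oW Ws)).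
    by apply: filterS h.
  move=> s' _ nW.
  have [C [oC nC CW]] : exists C : set E, [/\ open C, C (path s') &
      forall y, C y -> ~ range f y].
    exists (~` closure (range f)); split.
    - by apply: closed_openC; exact: closed_closure.
    - by move=> cW; apply: nS; exists s'; exact: closure_range_nonproper.
    - by move=> y ny Wy; apply: ny; exact: subset_closure.
  have h : \forall z \near s', C (path z) := cpath s' _ (open_nbhs_nbhs (conj oC nC)).
  by apply: filterS h => z /CW.
pose s := `|f x0 0 j| + `|B| + 1.
have [x _ fx] := all s.
have pathj : path s 0 j = f x0 0 j + s.
  by rewrite !mxE !eqxx (eq_sym j) (negPf lj) /= mulr0 addr0 mulr1.
have := bnd x; rewrite /component fx pathi => /(_ erefl) /(le_trans (row_norm_coord _ j)).
rewrite pathj => h.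
have : f x0 0 j + s <= B by apply: le_trans (ler_norm _) h.
have := ler_norm B; have := ler_norm (- f x0 0 j); rewrite normrN /s; clear.
by move: (f x0 0 j) => z; lra.
Qed.

End Slices.

(** * Emptiness of the nonproper set *)

Lemma countable_interval_frontier (R : realType) (A : set R) : is_interval A ->
  countable (closure A `\` A).
Proof.
move=> iA; apply: (@sub_countable _ _ _ [set sup A; inf A]); last first.
  by apply: finite_set_countable; exact: finite_set2.
apply: subset_card_le => x [cx nx].
have near_x e : 0 < e -> exists2 a, A a & `|x - a| < e.
  by move=> e0; have [a [Aa xa]] := cx _ (near_dist x e0); exists a.
have A0 : A !=set0 by have [a Aa _] := near_x 1 ltr01; exists a.
have [ub|] := pselect (ubound A x).
  left; apply: le_anti; apply/andP; split; last exact: ge_sup.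
  rewrite leNgt; apply/negP => lt; have d0 : 0 < x - sup A by rewrite subr_gt0.
  have [a Aa] := near_x _ d0; rewrite ltr_norml => /andP[_]; rewrite ltrD2l ltrN2.
  by rewrite ltNge => /negP; apply; apply: ub_le_sup => //; exists x.
move=> /existsNP[b /not_implyP[Ab /negP]]; rewrite -ltNge => xb.
have lb : lbound A x.
  move=> a Aa; rewrite leNgt; apply/negP => ax; apply: nx; apply: (iA a b) => //.
  by rewrite (ltW ax) (ltW xb).
right; apply: le_anti; apply/andP; split; first exact: lb_le_inf.
rewrite leNgt; apply/negP => lt; have d0 : 0 < inf A - x by rewrite subr_gt0.
have [a Aa] := near_x _ d0; rewrite distrC ltr_norml => /andP[_]; rewrite ltrD2r.
by rewrite ltNge => /negP; apply; apply: ge_inf => //; exists x.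
Qed.

Section Main.
Context {R : realType}.
Notation E := 'rV[R]_3.
Variable f : E -> E.
Hypothesis f_lh : local_homeo f.
Let S := nonproper_set f.
Let g := component f.

Hypotheses (thick : forall i, countable [set c | ~ countable (S `&` [set y : E | y 0 i = c])])
  (reg : forall i, regular_upwards (g i) /\ regular_upwards (fun x => - g i x)).

Let f_cont : continuous f := @local_homeo_continuous _ _ _ f_lh.

Let g_cont i : continuous (g i).
Proof.
move=> x; apply: (@continuous_comp _ _ _ f (fun y : E => y 0 i)); first exact: f_cont.
exact: coord_continuous.
Qed.

Let g_open i : open (range (g i)). Proof. exact: open_range_component. Qed.

(** The levels to be avoided: those of uncountable slices, and the end points of the
range of the component, beyond which there is no level to move to. *)
Let exceptional i : set R := [set c | ~ countable (S `&` [set y : E | y 0 i = c])]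
  `|` (closure (range (g i)) `\` range (g i)).

Let exceptional_countable i : countable (exceptional i).
Proof.
apply: countableU; first exact: thick.
apply: countable_interval_frontier => a b ra rb t tab.
exact: (range_interval (@g_cont i) ra rb).
Qed.

Let continuous_normB (p : E) : continuous (fun x => `|f x - p|).
Proof.
move=> x; apply/continuous_dist => e e0.
apply: filterS ((continuous_dist f x).1 (@f_cont x) _ e0) => z xz.
apply: le_lt_trans xz; apply: le_trans (ler_dist_dist _ _) _.
by rewrite opprB addrA subrK.
Qed.

(** Nonproperness provides far away points with image near [p]; as [f] is open, such a
point can be moved a little in order to avoid a countable set of levels. *)
Lemma far_point_near (p : E) i (A : set R) (N e : R) : S p -> countable A -> 0 < N -> 0 < e ->
  exists a, [/\ N < `|a|, `|f a - p| < e & ~ A (g i a)].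
Proof.
move=> Sp cA N0 e0.
have [x [Nx xp]] := (nonproperP p f_cont).1 Sp e N e0 N0.
have nbx : nbhs x [set z | N < `|z| /\ `|f z - p| < e].
  have h1 : 0 < `|x| - N by rewrite subr_gt0.
  have h2 : 0 < e - `|f x - p| by rewrite subr_gt0.
  apply: filterS (filterI (near_dist x h1) ((continuous_dist _ x).1 (@continuous_normB p x) _ h2)).
  move=> z [z1 z2]; split.
    have := le_lt_trans (ler_norm _) (le_lt_trans (ler_dist_dist x z) z1).
    by rewrite ltrD2l ltrN2.
  by move: z2; rewrite distrC => /(le_lt_trans (ler_norm _)); rewrite ltrD2r.
have [eta eta0 H] := near_norm_lt (local_homeo_nbhs f_lh nbx).
have [t /andP[t0 te] nt] := avoid_countable cA (ltr_pwDr eta0 (lexx (g i x))).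
have [|z [z1 z2] fz] := H (f x + (t - g i x) *: delta_mx 0 i).
  rewrite addrC addKr normrZ; apply: (@le_lt_trans _ _ `|t - g i x|).
    rewrite -[leRHS]mulr1 ler_wpM2l //; apply: row_norm_le => // j.
    by rewrite mxE eqxx /=; case: eqP; rewrite ?normr1 ?normr0.
  by rewrite ger0_norm ?subr_ge0 ?(ltW t0) // ltrBlDl.
exists z; split=> //; rewrite /g /component fz !mxE !eqxx mulr1.
by rewrite addrC subrK.
Qed.

(** Otherwise, a point [a] near infinity with image near [p] can be joined with a
point [b] of the same level whose image is far from [p], both above and below that
level and away from the common zeros of [u] and [w], against
[branch_obstruction]. *)
Lemma nonproper_coord_exceptional p i : S p -> exceptional i (p 0 i).
Proof.
move=> Sp; apply: contrapT => nex; set c := p 0 i in nex *.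
have cS : countable (S `&` [set y : E | y 0 i = c]).
  by apply: contrapT => nc; apply: nex; left.
have coordB x : `|g i x - c| <= `|f x - p|.
  by have := row_norm_coord (f x - p) i; rewrite !mxE.
have rc : range (g i) c.
  apply: contrapT => nrc; apply: nex; right; split=> // B /near_norm_lt[eta eta0 HB].
  have [a [_ fa _]] := @far_point_near p i set0 1 eta Sp (@countable0 _) ltr01 eta0.
  by exists (g i a); split; [exists a|apply: HB; exact: le_lt_trans (coordB a) fa].
have [r r0 Hr] := @avoid_radius _ _ (S `&` [set y : E | y 0 i = c]) p
  _ (countable_image (fun y => `|y - p|) cS) (fun y Sy => ex_intro2 _ _ y Sy erefl).
have [|eps0 eps00 Heps0] := @slab_sphere_avoids _ _ S p i c r (@closed_nonproper _ _ _ f).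
  by move=> y yc yr Sy; exact: (Hr y yr).
pose Q := [set y : E | `|y 0 i - c| <= eps0] `&` [set y | `|y - p| = r].
have cQ : compact Q.
  apply: (@compact_rV _ _ _ (r + `|p|)); last by move=> y [_ /sphere_bounded].
  apply: closedI; last exact: closed_sphere.
  rewrite (_ : [set y : E | _] = (fun y : E => `|y 0 i - c|) @^-1` [set t | t <= eps0]) //.
  by apply: preimage_closed; [move=> y _; exact: continuous_coord_dist|exact: closed_le].
have [rho rho0 Hrho] := preimage_bounded f_cont cQ (fun y Qy => Heps0 y Qy.1 Qy.2).
have [reg1 reg2] := reg i.
have [eps1 eps10 [N1 H1]] := far_points_joined (@g_cont i) (@g_open i) reg1 rc rho0.
have rcN : range (fun x => - g i x) (- c) by have [x _ <-] := rc; exists x.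
have cgN : continuous (fun x => - g i x) by move=> x; apply: continuousN; exact: g_cont.
have ogN : open (range (fun x => - g i x)).
  have -> : range (fun x => - g i x) = (fun t : R => - t) @^-1` range (g i).
    apply/seteqP; split=> [_ [x _ <-]|t [x _ gx]]; last by exists x => //; rewrite gx opprK.
    by exists x => //; rewrite opprK.
  by apply: open_comp (@g_open i) => x _; exact: opp_continuous.
have [eps2 eps20 [N2 H2]] := far_points_joined cgN ogN reg2 rcN rho0.
pose N := Num.max rho (Num.max N1 N2).
pose eps := Num.min (Num.min eps0 r) (Num.min eps1 eps2).
have N10 : 0 < N + 1 by rewrite ltr_wpDl // /N le_max rho0.
have eps'0 : 0 < eps by rewrite !lt_min eps00 r0 eps10.
have [a [Na fa nea]] := @far_point_near p i _ _ _ Sp (thick i) N10 eps'0.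
have {}Na : N < `|a| by apply: lt_trans Na; rewrite ltrDl.
move: fa; rewrite !lt_min => /andP[/andP[fa0 far] /andP[fa1 fa2]].
have [ga0 ga1 ga2] : [/\ `|g i a - c| < eps0, `|g i a - c| < eps1 & `|g i a - c| < eps2].
  by split; apply: le_lt_trans (coordB a) _.
(* If there were no such point, the slice of the image would be bounded. *)
have [b [Nb gb fb]] : exists b, [/\ N < `|b|, g i b = g i a & r < `|f b - p|].
  apply: contrapT => nb; apply: nea; have [M HM] := bounded_on_cube f_cont N.
  apply: (@bounded_slice _ _ f_lh i (g i a) (Num.max M (r + `|p|))); first by exists a.
  move=> x gx; rewrite le_max; have [xN|Nx] := leP `|x| N; first by rewrite HM.
  apply/orP; right; rewrite -{1}(subrK p (f x)); apply: le_trans (ler_normD _ _) _.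
  by rewrite lerD2r leNgt; apply/negP => rx; apply: nb; exists x.
have outside (x : E) : N < `|x| -> [/\ rho < `|x|, N1 < `|x| & N2 < `|x|].
  by rewrite !gt_max => /and3P[].
have [arho a1 a2] := outside a Na; have [brho b1 b2] := outside b Nb.
have [T [cT Ta Tb HT]] := H1 a b ga1 gb a1 b1.
have [||T' [cT' Ta' Tb' HT']] := H2 a b _ _ a2 b2.
- by rewrite -opprD normrN.
- by rewrite gb.
pose u x := r - `|f x - p|; pose w x := g i x - g i a.
have cu : continuous u.
  move=> x; apply/continuous_dist => e e0.
  apply: filterS ((continuous_dist _ x).1 (@continuous_normB p x) _ e0) => z.
  by rewrite /u opprD addrACA subrr add0r -opprD normrN.
have cw : continuous w.
  move=> x; apply/continuous_dist => e e0.
  apply: filterS ((continuous_dist _ x).1 (@g_cont i x) _ e0) => z.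
  by rewrite /w opprB addrA subrK.
have nz x : rho < `|x| -> ~ (u x = 0 /\ w x = 0).
  move=> rx [/eqP]; rewrite subr_eq0 => /eqP ux /eqP; rewrite subr_eq0 => /eqP wx.
  have : `|x| <= rho by apply: Hrho; split=> //=; rewrite -[f x 0 i]/(g i x) wx ltW.
  by rewrite leNgt rx.
have [k Hk] := branch_outside_cube rho0 cu cw nz.
have : 0 < u b.
  apply: (branch_obstruction cu cw cT cT' Ta Tb Ta' Tb') => //.
  - by move=> x /HT[rx gx]; split; [exact: Hk|rewrite subr_ge0].
  - move=> x /HT'[rx]; rewrite lerN2 => gx.
    by split; [exact: Hk|rewrite subr_le0|exact: nz].
  - by rewrite subr_gt0.
  - by rewrite /w subrr.
by rewrite subr_gt0 ltNge (ltW fb).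
Qed.

(** The distance from [p] to another nonproper point is the difference of two
coordinates, hence one of countably many numbers. *)
Lemma no_nonproper_point : S = set0.
Proof.
apply/seteqP; split=> // p Sp.
pose B : set R := \bigcup_(i in [set: 'I_3]) ((fun c => `|c - p 0 i|) @` exceptional i).
have cB : countable B.
  apply: bigcup_countable; first exact: finite_set_countable.
  by move=> i _; apply: countable_image; exact: exceptional_countable.
have SB y : S y -> B `|y - p|.
  move=> Sy; have [i ->] : exists i, `|y - p| = `|y 0 i - p 0 i|.
    have [/eqP e|ne] := eqVneq `|y - p| 0.
      by exists 0; move: e; rewrite normr_eq0 subr_eq0 => /eqP ->; rewrite !subrr !normr0.
    have [[j i] h] := mx_norm_neq0 ne; exists i.
    by move: h; rewrite (ord1 j) !mxE.
  by exists i => //; exists (y 0 i) => //; exact: nonproper_coord_exceptional.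
have [r r0 Hr] := avoid_radius cB SB.
have [rho rho0 Hrho] := preimage_bounded f_cont (@compact_sphere _ _ p r) Hr.
have N0 : 0 < rho + 1 by rewrite ltr_wpDl.
have [a [Na fa _]] := @far_point_near p 0 set0 _ _ Sp (@countable0 _) N0 r0.
have arho : rho < `|a| by apply: lt_trans Na; rewrite ltrDl.
(* Some far away point is mapped inside the sphere, and none is mapped to it. *)
have inside x : rho < `|x| -> `|f x - p| < r.
  apply: (connected_local_ind (P := fun x => `|f x - p| < r) (connected_outside_cube rho0) arho fa).
    move=> y _ fy; have d0 : 0 < r - `|f y - p| by rewrite subr_gt0.
    apply: filterS ((continuous_dist _ y).1 (@continuous_normB p y) _ d0) => z yz _.
    by move: yz; rewrite distrC => /(le_lt_trans (ler_norm _)); rewrite ltrD2r.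
  move=> y yr /negP; rewrite -leNgt le_eqVlt => /orP[/eqP e|fy].
    by have := Hrho y (esym e); rewrite leNgt yr.
  have d0 : 0 < `|f y - p| - r by rewrite subr_gt0.
  apply: filterS ((continuous_dist _ y).1 (@continuous_normB p y) _ d0) => z yz _.
  move/(le_lt_trans (ler_norm _)): yz; rewrite ltrD2l ltrN2 => h.
  by apply/negP; rewrite -leNgt ltW.
have [M HM] := bounded_on_cube f_cont rho.
have [x [_ _ nx]] := @far_point_near p 0 _ _ _ Sp (thick 0) ltr01 ltr01.
apply: nx; apply: (@bounded_slice _ _ f_lh 0 _ (Num.max M (r + `|p|))); first by exists x.
move=> z _; rewrite le_max; have [zr|zr] := leP `|z| rho; first by rewrite HM.
apply/orP; right; rewrite -{1}(subrK p (f z)); apply: le_trans (ler_normD _ _) _.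
by rewrite lerD2r ltW // inside.
Qed.

End Main.

Theorem corollary1p5 (R : realType) (f : 'rV[R]_3 -> 'rV[R]_3)
    (f_diffeo : Ck_local_diffeomorphism 2 f)
    (f_semialg : semialgebraic_map_on setT f)
    (codim_Sf : (2%:R%:E <= semialgebraic_codim (nonproper_set f))%E)
    (f_cond : forall i : 'I_3,
      [\/ locally_trivial_at_image (component f i),
          K_infty (component f i) = set0,
          palais_smale (component f i) |
          gradient_integral_infinite (component f i)]) :
  bijective f.
Proof.
have f_lh := Ck_local_homeo f_diffeo.
apply: (proper_local_homeo_bijective f_lh); apply: (no_nonproper_point f_lh) => i.
  apply: countable_thick_slices; last exact: codim2_no_cell.
    by apply: semialgebraic_nonproper => //; exact: local_homeo_continuous.
  exact: closed_nonproper.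
exact: component_regular.
Qed.
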